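(* Every convex body $K\subset\mathbb{R}^2$ satisfies $\mathrm{Sym}_1(K)\ge \frac{2}{41}(10+3\sqrt2)$. Moreover, there is a sequence of convex quadrilaterals $Q_j$ with $\mathrm{Sym}_1(Q_j)\to \frac13(\sqrt2+1)$. Consequently $$\frac{2}{41}(10+3\sqrt2)\le \sigma(2,1)\le \frac13(\sqrt2+1).$$
   Context: A convex body is a compact convex set with nonempty interior. For a convex body $K\subset\mathbb{R}^n$ and an integer $0\le k<n$, the $k$-symmetry of $K$ is $$\mathrm{Sym}_k(K)=\frac{1}{\mathrm{vol}_n(K)}\max_{\mathcal L}\mathrm{vol}_n\big(K\cap \mathrm{refl}_{\mathcal L}(K)\big),$$ where the maximum is over all $k$-dimensional affine flats $\mathcal L\subset\mathbb{R}^n$, $\mathrm{vol}_n$ is Lebesgue measure, and $\mathrm{refl}_{\mathcal L}$ is the orthogonal reflection through $\mathcal L$ (the isometry fixing $\mathcal L$ pointwise and acting as $-\mathrm{id}$ on directions orthogonal to $\mathcal L$). For $n=2,k=1$ this is the axiality of $K$. Define $\sigma(n,k)=\inf\{\mathrm{Sym}_k(K): K\subset\mathbb{R}^n \text{ a convex body}\}$. *)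

(* Defs.v *)
(* The plane R^2 is modelled as R * R with the
   product (= Euclidean) topology and the product Lebesgue measure. *)
From HB Require Import structures.
From mathcomp Require Import all_boot all_order all_algebra.
From mathcomp Require Import all_classical all_reals all_analysis.
Set Implicit Arguments. Unset Strict Implicit. Unset Printing Implicit Defensive.
Import Order.TTheory GRing.Theory Num.Theory.
Import numFieldNormedType.Exports.
Local Open Scope classical_set_scope.
Local Open Scope ring_scope.

Section Defs.
Variable R : realType.

Definition lam2 : set (R * R) -> \bar R :=
  (@lebesgue_measure R \x @lebesgue_measure R)%E.

Definition convex_set2 (K : set (R * R)) : Prop :=
  forall x y, K x -> K y -> forall t : R, 0 <= t -> t <= 1 ->
    K (t * x.1 + (1 - t) * y.1, t * x.2 + (1 - t) * y.2).

Definition convex_body2 (K : set (R * R)) : Prop :=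
  compact K /\ convex_set2 K /\ (K^°) !=set0.

(* orthogonal reflection through the line {x | a x.1 + b x.2 = c},
   where (a,b) is a unit normal vector *)
Definition refl_line (a b c : R) (x : R * R) : R * R :=
  let s := a * x.1 + b * x.2 - c in (x.1 - 2 * s * a, x.2 - 2 * s * b).

Definition sym1_ratios (K : set (R * R)) : set R :=
  [set r | exists a b c : R, a ^+ 2 + b ^+ 2 = 1 /\
     r = fine (lam2 (K `&` (refl_line a b c @` K))) / fine (lam2 K)].

(* Sym_1(K) (the paper's max, taken here as the supremum) *)
Definition Sym1 (K : set (R * R)) : R := sup (sym1_ratios K).

Definition sigma21 : R := inf [set Sym1 K | K in convex_body2].

Definition hull3 (p q r : R * R) : set (R * R) :=
  [set x | exists l1 l2 l3 : R, [/\ 0 <= l1, 0 <= l2, 0 <= l3 & l1 + l2 + l3 = 1] /\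
     x = (l1 * p.1 + l2 * q.1 + l3 * r.1, l1 * p.2 + l2 * q.2 + l3 * r.2)].

Definition hull4 (p q r s : R * R) : set (R * R) :=
  [set x | exists l1 l2 l3 l4 : R,
     [/\ 0 <= l1, 0 <= l2, 0 <= l3, 0 <= l4 & l1 + l2 + l3 + l4 = 1] /\
     x = (l1 * p.1 + l2 * q.1 + l3 * r.1 + l4 * s.1,
          l1 * p.2 + l2 * q.2 + l3 * r.2 + l4 * s.2)].

Definition convex_quadrilateral (Q : set (R * R)) : Prop :=
  exists p q r s : R * R,
    [/\ ~ hull3 q r s p, ~ hull3 p r s q, ~ hull3 p q s r, ~ hull3 p q r s
      & Q = hull4 p q r s].

End Defs.

(* Main.v *)
(** Lower bound. Every convex body has an inscribed affinely regular hexagon: for each direction there are unique levels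
    at which two parallel sides of such a hexagon and the diagonal between them must lie, and when the direction is
    turned by 180 degrees the offset of the diagonal changes sign. Lines supporting the body at the six vertices confine
    it to the hexagon and six small triangles. Make the hexagon regular by an affine map and reflect in a principal
    axis of the ellipse that was the circle: in the new coordinates this is a reflection of the plane which
    differs from a symmetry of the hexagon by a rotation of at most 30 degrees. An estimate of the overlap in each of
    the six sectors gives the ratio 41/59, slightly more than required.

    Upper bound. Take the region between the first axis and the graph of e min(1 + m x, m (1 - x)), where m = sqrt 2 + 1
    and e tends to 0. A line that is neither nearly horizontal nor nearly vertical gives two strips with a small
    intersection. For a nearly vertical line the overlap is at most twice the area of the part of the body between c and
    2c, where c is the abscissa of the line. For a nearly horizontal one, cut the axis into quarters and bound the
    overlap by the part above the axis over the outer quarters and by the part below over the inner ones. All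
    maxima equal m/3 in the limit, and the line x = 1/3 attains it. *)
Require Import Defs.
From HB Require Import structures.
From mathcomp Require Import all_boot all_order all_algebra.
From mathcomp Require Import all_classical all_reals all_analysis.
From mathcomp Require Import measurable_realfun.
From mathcomp Require Import ring lra.
Import Order.TTheory GRing.Theory Num.Theory.
Import numFieldNormedType.Exports.
Local Open Scope classical_set_scope.
Local Open Scope ring_scope.
Set Implicit Arguments. Unset Strict Implicit. Unset Printing Implicit Defensive.

(** Affine maps preserve ratios of areas but not reflections; the axes of the ellipse are used
    because their reflections remain orthogonal for the norm in which the hexagon is regular. Having
    two axes to choose from matters: conjugation by the rotations of the hexagon turns a reflection
    by multiples of 120 degrees, and only together with the half-turn that relates the two
    reflections does one of them come within 30 degrees of a reflection that maps two opposite sides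
    of the hexagon to themselves. Two opposite sectors are then matched with themselves and the
    others in two pairs. The chords of an inscribed hexagon need not have unique positions, so the
    sign change of the offset is not that of a continuous function of the direction; compactness of
    the set of all solutions and connectedness of the interval of directions replace the
    intermediate value theorem. For the upper bound the area is e; nearly vertical lines give at
    most m e/3 and nearly horizontal ones (1 + m)^2 e/(6 m), up to factors tending to 1. The
    equation m^2 = 2 m + 1 says that the two agree. *)

Lemma eq_ler (R : porderZmodType) (x y : R) : x = y -> x <= y.
Proof. by move->. Qed.

(** * Area of plane sets *)

Section PlaneMeasure.
Variable R : realType.
Local Notation mR := (measurableTypeR R).
Local Notation plane := (mR * mR)%type.
Implicit Types A B : set (R * R).

(* The plane of the statement carries no canonical sigma-algebra: measurability is that of the alias [measurableTypeR R]. *)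
Definition mble A := @measurable _ plane A.

(** The product sigma-algebra is generated by rectangles, not by open sets; the countably many boxes
    with rational corners inside the open set bridge the gap. *)
Lemma mble_open A : open A -> mble A.
Proof.
move=> oA.
pose box (q : (rat * rat) * (rat * rat)) : set (R * R) :=
  [set` `](ratr q.1.1 : R), (ratr q.1.2 : R)[%R] `*` [set` `](ratr q.2.1 : R), (ratr q.2.2 : R)[%R].
have -> : A = \bigcup_q (if `[< box q `<=` A >] then box q else set0).
  rewrite eqEsubset; split; last first.
    by move=> x [q _]; case: asboolP => // h bx; exact: h.
  move=> [x y] Axy.
  have : nbhs (x, y) A by exact: open_nbhs_nbhs.
  case=> -[/= U V] [/= /nbhs_ballP[e /= e0 He] /nbhs_ballP[d /= d0 Hd]] UVA.
  have ratin (z r : R) : 0 < r -> exists q1 q2 : rat,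
    z \in `](ratr q1 : R), (ratr q2 : R)[%R /\
    [set` `](ratr q1 : R), (ratr q2 : R)[%R] `<=` ball z r.
    move=> r0.
    have : z - r < z by lra. case/rat_in_itvoo => q1; rewrite in_itv/= => /andP[a1 a2].
    have : z < z + r by lra. case/rat_in_itvoo => q2; rewrite in_itv/= => /andP[b1 b2].
    exists q1, q2; split; first by rewrite in_itv/= a2 b1.
    move=> u; rewrite /= in_itv/= => /andP[u1 u2].
    rewrite /ball /= ltr_distl; apply/andP; split; lra.
  have [q1 [q2 [zx sx]]] := ratin x e e0.
  have [q3 [q4 [zy sy]]] := ratin y d d0.
  exists ((q1, q2), (q3, q4)) => //.
  case: asboolP => [_|[]]; first by split.
  move=> [u v] [/= hu hv]; apply: UVA; split => /=.
  by apply: He; apply: sx.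
  by apply: Hd; apply: sy.
apply: countable_bigcupT_measurable; first exact: countableP.
move=> q; case: asboolP => _; last exact: measurable0.
by apply: measurableX; apply: measurable_itv.
Qed.

Lemma mble_closed A : closed A -> mble A.
Proof.
by move=> cA; rewrite -(setCK A); apply: measurableC; apply: mble_open; exact: closed_openC.
Qed.

Lemma compact2_closed A : compact A -> closed A.
Proof. by apply: compact_closed; apply: norm_hausdorff. Qed.

Lemma mble_compact A : compact A -> mble A.
Proof. by move=> /compact2_closed/mble_closed. Qed.

Definition bdd A := exists M : R, forall x, A x -> `|x.1| <= M /\ `|x.2| <= M.

Lemma bdd_compact A : compact A -> bdd A.
Proof.
move=> cA; have [M [Mr HM]] := compact_bounded cA.
exists (M + 1) => x Ax.
have : `|x| <= M + 1 by apply: HM => //; rewrite ltrDl.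
by rewrite prod_normE ge_max => /andP[].
Qed.

Lemma measurable_affine1 (k g : R) :
  measurable_fun setT (fun y : mR => k * y + g : mR).
Proof.
apply: measurable_funD => //; apply: measurable_funM => //.
Qed.

(** By uniqueness of Lebesgue measure it is enough to compare half-open intervals. For negative [k]
    the preimage is half-open at the other end, with the same length. *)
Lemma lebesgue_measure_affine (k g : R) (B : set R) : k != 0 ->
  measurable (B : set mR) ->
  (`|k|%:E * @lebesgue_measure R ((fun y : R => (k * y + g)%R) @^-1` B) = @lebesgue_measure R B)%E.
Proof.
move=> k0 mB; apply/esym.
pose f : mR -> mR := fun y => k * y + g.
have mf : measurable_fun setT f := measurable_affine1 k g.
have [mu muE] : exists mu : {measure set mR -> \bar R},
    forall X : set mR, mu X = (`|k|%:E * @lebesgue_measure R (f @^-1` X))%E.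
  by unshelve eexists (mscale (NngNum (normr_ge0 k)) (pushforward (@lebesgue_measure R) f)).
rewrite (@lebesgue_measure_unique R mu _ B mB); first by rewrite muE.
move=> _ [[a b]] _ <-.
rewrite muE.
have [kp|kn|/eqP] := ltgtP 0 k; last by rewrite eq_sym (negbTE k0).
- have -> : (f @^-1` [set` `]a, b]%R] = [set` `]((a - g) / k), ((b - g) / k)]%R]).
    apply/seteqP; split => y; rewrite /= !in_itv/= /f ltr_pdivrMr// ler_pdivlMr// => /andP[]*; apply/andP; split; lra.
  rewrite !lebesgue_measure_itv/= !lte_fin.
  have -> : ((a - g) / k < (b - g) / k) = (a < b) by rewrite ltr_pM2r ?invr_gt0// ltrD2r.
  case: ifPn => ab; last by rewrite mule0.
  rewrite -!EFinD -EFinM gtr0_norm//; congr EFin; field; lra.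
- have -> : (f @^-1` [set` `]a, b]%R] = [set` `[((b - g) / k), ((a - g) / k)[%R]).
    apply/seteqP; split => y; rewrite /= !in_itv/= /f ltr_ndivlMr// ler_ndivrMr// => /andP[]*; apply/andP; split; lra.
  rewrite !lebesgue_measure_itv/= !lte_fin.
  have -> : ((b - g) / k < (a - g) / k) = (a < b) by rewrite ltr_nM2r ?invr_lt0// ltrD2r.
  case: ifPn => ab; last by rewrite mule0.
  rewrite -!EFinD -EFinM ltr0_norm//; congr EFin; field; lra.
Qed.

Definition vmap (k m n : R) (x : R * R) : R * R := (x.1, k * x.2 + (m * x.1 + n)).
Definition swap2 (x : R * R) : R * R := (x.2, x.1).

Lemma lam2_mble A : mble A -> measurable_fun setT (fun x => @lebesgue_measure R (xsection A x)).
Proof. by move=> mA; apply: measurable_fun_xsection. Qed.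

Lemma mble_vmap k m n A : mble A -> mble (vmap k m n @^-1` A).
Proof.
move=> mA; rewrite -[X in mble X]setTI.
have h : measurable_fun setT (vmap k m n : plane -> plane).
  apply: measurable_fun_pair => //=.
  apply: measurable_funD; first by apply: measurable_funM.
  by apply: measurable_funD => //; apply: measurable_funM.
exact: h.
Qed.

Lemma lam2_vmap k m n A : k != 0 -> mble A ->
  (`|k|%:E * lam2 (vmap k m n @^-1` A) = lam2 A)%E.
Proof.
move=> k0 mA.
have mA' := mble_vmap k m n mA.
rewrite /lam2 /product_measure1 -ge0_integralZl//=; last exact: lam2_mble.
apply: eq_integral => x _ /=.
rewrite -[RHS](lebesgue_measure_affine (m * x + n) k0); last exact: measurable_xsection.
suff -> : xsection (vmap k m n @^-1` A) x =
    (fun y => (k * y + (m * x + n))%R) @^-1` xsection A x by [].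
by apply/seteqP; split => y; rewrite /xsection /= !inE.
Qed.

Lemma mble_swap A : mble A -> mble (swap2 @^-1` A).
Proof.
move=> mA; rewrite -[X in mble X]setTI.
have h : measurable_fun setT (swap2 : plane -> plane) by apply: measurable_fun_pair => //=.
exact: h.
Qed.

Lemma lam2_swap A : mble A -> lam2 (swap2 @^-1` A) = lam2 A.
Proof.
move=> mA.
have h : measurable_fun setT (swap2 : plane -> plane) by apply: measurable_fun_pair => //=.
have [mu muE] : exists mu : {measure set plane -> \bar R},
    forall A, mu A = (@lebesgue_measure R \x @lebesgue_measure R)%E (swap2 @^-1` A).
  by unshelve eexists (pushforward (@lebesgue_measure R \x @lebesgue_measure R)%E (swap2 : plane -> plane)).
rewrite /lam2 [RHS](@product_measure_unique _ _ _ _ _ _ _ mu _ A mA) ?muE//.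
move=> B C mB mC; rewrite muE.
have -> : swap2 @^-1` (B `*` C) = C `*` B by apply/seteqP; split => x [].
by rewrite product_measure1E// muleC.
Qed.

End PlaneMeasure.

(** * Affine changes of coordinates and areas between lines *)

Section PlaneArea.
Variable R : realType.
Local Notation mR := (measurableTypeR R).
Local Notation plane := (mR * mR)%type.
Implicit Types A B : set (R * R).

Definition affmap (a b e c d f : R) (x : R * R) : R * R :=
  (a * x.1 + b * x.2 + e, c * x.1 + d * x.2 + f).

(** An LU factorization: the inner factor changes only the first coordinate, the outer one only the
    second. So [lam2_vmap] and [lam2_swap] account for every determinant; for [a = 0] the rows are
    exchanged first. *)
Lemma affmap_decomp a b e c d f : a != 0 ->
  affmap a b e c d f = vmap (d - c * b / a) (c / a) (f - c / a * e)
    \o (@swap2 R \o (vmap a b e \o @swap2 R)).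
Proof.
move=> a0; apply/funext => -[x y]; rewrite /affmap /vmap /swap2 /=.
by congr pair; [ring | field].
Qed.

Lemma affmap_swap a b e c d f :
  affmap a b e c d f = @swap2 R \o affmap c d f a b e.
Proof. by []. Qed.

Lemma mble_affmap a b e c d f A : a * d - b * c != 0 ->
  mble A -> mble (affmap a b e c d f @^-1` A).
Proof.
have H a' b' e' c' d' f' B : a' != 0 -> mble B -> mble (affmap a' b' e' c' d' f' @^-1` B).
  move=> a0 mB; rewrite affmap_decomp// !comp_preimage.
  by do 2 (apply: mble_swap; apply: mble_vmap).
move=> D mA; have [a0|a0] := eqVneq a 0; last exact: H.
rewrite affmap_swap comp_preimage; apply: H; last exact: mble_swap.
by apply: contraNneq D => ->; rewrite a0; apply/eqP; ring.
Qed.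

Lemma lam2_affmap a b e c d f A : a * d - b * c != 0 -> mble A ->
  (`|a * d - b * c|%:E * lam2 (affmap a b e c d f @^-1` A) = lam2 A)%E.
Proof.
have H a' b' e' c' d' f' B : a' != 0 -> a' * d' - b' * c' != 0 -> mble B ->
    (`|a' * d' - b' * c'|%:E * lam2 (affmap a' b' e' c' d' f' @^-1` B) = lam2 B)%E.
  move=> a0 D mB; rewrite affmap_decomp// !comp_preimage.
  have k0 : d' - c' * b' / a' != 0.
    apply: contraNneq D => /(congr1 ( *%R a')); rewrite mulr0 => <-.
    by apply/eqP; field.
  have -> : a' * d' - b' * c' = (d' - c' * b' / a') * a' by field.
  rewrite normrM EFinM -muleA lam2_swap; last first.
    by apply: mble_vmap; apply: mble_swap; apply: mble_vmap.
  rewrite lam2_vmap//; last by apply: mble_swap; apply: mble_vmap.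
  by rewrite lam2_swap; [rewrite lam2_vmap|apply: mble_vmap].
move=> D mA; have [a0|a0] := eqVneq a 0; last exact: H.
rewrite affmap_swap comp_preimage.
have c0 : c != 0 by apply: contraNneq D => ->; rewrite a0; apply/eqP; ring.
rewrite -[RHS](lam2_swap mA) -(H c d f a b e _ c0 _ (mble_swap mA)); last first.
  by apply: contraNneq D => h; rewrite -oppr_eq0 -h; apply/eqP; ring.
congr (_ * _)%E; congr EFin; rewrite -normrN.
by have -> : - (a * d - b * c) = c * b - d * a by ring.
Qed.

Lemma integral_affine (a b p q : R) : a <= b ->
  (\int[@lebesgue_measure R]_(x in `[a, b]) (p * x + q)%:E)%E =
  ((b - a) * (p * (a + b) / 2 + q))%:E.
Proof.
rewrite le_eqVlt => /predU1P[->|ab].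
  by rewrite set_itv1 integral_set1 subrr mul0r.
pose P : {poly R} := (p / 2) *: 'X^2 + q *: 'X.
pose F : R -> R := horner P.
have FE x : F x = p / 2 * x ^+ 2 + q * x by rewrite /F /P !hornerE.
have dF (x : R) : is_derive x 1 F (p * x + q).
  suff <- : P^`().[x] = p * x + q by exact: is_derive_poly.
  rewrite /P derivD !derivZ derivXn derivX !hornerE /=.
  by rewrite -mulr_natr; field.
have cF : continuous F by move=> x; apply: differentiable_continuous; apply/derivable1_diffP; have [] := dF x.
rewrite (@continuous_FTC2 R (fun x => p * x + q) F a b ab).
- by rewrite -EFinB; congr EFin; rewrite !FE; field.
- apply: continuous_subspaceT => x.
  by apply: continuousD; [apply: continuousM; [exact: cst_continuous|exact: cvg_id] | exact: cst_continuous].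
- split.
  + by move=> x _; have [] := dF x.
  + exact/cvg_at_right_filter/cF.
  + exact/cvg_at_left_filter/cF.
- by move=> x _; rewrite derive1E; have [_ ->] := dF x.
Qed.

Lemma lam2_strip A (a b : R) : (forall x, A x -> a <= x.1 <= b) ->
  lam2 A = (\int[@lebesgue_measure R]_(x in `[a, b]) @lebesgue_measure R (xsection A x))%E.
Proof.
move=> Aab; rewrite /lam2 /product_measure1 [RHS]integral_mkcond.
apply: eq_integral => x _ /=; rewrite /restrict /=; case: ifPn => // xab.
rewrite (_ : xsection A x = set0) ?measure0//.
rewrite -subset0 => y /xsectionP /Aab /= h; apply/negP: xab; apply/negPn.
by rewrite inE /= in_itv.
Qed.

Lemma measurable_affine_itv (a b p q : R) :
  measurable_fun (`[a, b] : set mR) (fun x : mR => (p * x + q)%:E).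
Proof.
apply: measurable_funTS; apply/measurable_EFinP.
exact: measurable_affine1.
Qed.

(** The bound is the area of a trapezoid. The area estimates below come down to this lemma and
    [lam2_ge_sections], combined with affine changes of coordinates. *)
Lemma lam2_le_sections A (a b p q : R) : a <= b -> mble A ->
  (forall x, A x -> a <= x.1 <= b) ->
  (forall x, a <= x <= b -> (@lebesgue_measure R (xsection A x) <= (p * x + q)%:E)%E) ->
  (lam2 A <= ((b - a) * (p * (a + b) / 2 + q))%:E)%E.
Proof.
move=> ab mA Aab H; rewrite (lam2_strip Aab) -integral_affine//.
apply: ge0_le_integral => //.
- by apply: measurable_funTS; exact: lam2_mble.
- exact: measurable_affine_itv.
Qed.

Lemma lam2_ge_sections A (a b p q : R) : a <= b -> mble A ->
  (forall x, a <= x <= b -> 0 <= p * x + q) ->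
  (forall x, a <= x <= b -> ((p * x + q)%:E <= @lebesgue_measure R (xsection A x))%E) ->
  (((b - a) * (p * (a + b) / 2 + q))%:E <= lam2 A)%E.
Proof.
move=> ab mA p0 H; rewrite -integral_affine//.
apply: (@le_trans _ _ (\int[@lebesgue_measure R]_(x in `[a, b]) @lebesgue_measure R (xsection A x))%E).
  apply: ge0_le_integral => //.
  - exact: measurable_affine_itv.
  - by apply: measurable_funTS; exact: lam2_mble.
rewrite /lam2 /product_measure1; apply: ge0_subset_integral => //.
exact: lam2_mble.
Qed.

(** [fine] sends an infinite measure to 0, which is why [bdd] accompanies [mble] throughout. *)
Definition area A : R := fine (lam2 A).

Lemma lam2_fin A : mble A -> bdd A -> lam2 A \is a fin_num.
Proof.
move=> mA [M AM].
have mB : mble ([set` `[- M, M]%R] `*` [set` `[- M, M]%R]).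
  by apply: measurableX; exact: measurable_itv.
rewrite ge0_fin_numE; last exact: measure_ge0.
apply: (@le_lt_trans _ _ (lam2 ([set` `[- M, M]%R] `*` [set` `[- M, M]%R]))).
  apply: le_measure; rewrite ?inE// => x /AM[h1 h2].
  by split; rewrite /= in_itv/= -ler_norml.
rewrite /lam2 product_measure1E; [|exact: measurable_itv..].
by rewrite /= lebesgue_measure_itv/=; case: ifP => _; rewrite ?mul0e// -EFinM ltry.
Qed.

Lemma areaE A : mble A -> bdd A -> (area A)%:E = lam2 A.
Proof. by move=> mA bA; rewrite /area fineK// lam2_fin. Qed.

Lemma area_ge0 A : 0 <= area A.
Proof. exact/fine_ge0/measure_ge0. Qed.

Lemma bdd_sub A B : A `<=` B -> bdd B -> bdd A.
Proof. by move=> AB [M BM]; exists M => x /AB /BM. Qed.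

Lemma mbleI A B : mble A -> mble B -> mble (A `&` B).
Proof. exact: measurableI. Qed.

Lemma mbleU A B : mble A -> mble B -> mble (A `|` B).
Proof. exact: measurableU. Qed.

Lemma mbleC A : mble A -> mble (~` A).
Proof. exact: measurableC. Qed.

Lemma area_mono A B : mble A -> mble B -> bdd B -> A `<=` B -> area A <= area B.
Proof.
move=> mA mB bB AB; have bA := bdd_sub AB bB.
by rewrite -lee_fin !areaE//; apply: le_measure; rewrite ?inE.
Qed.

Lemma area_disjU A B : mble A -> mble B -> bdd (A `|` B) -> A `&` B = set0 ->
  area (A `|` B) = area A + area B.
Proof.
move=> mA mB bAB dis.
have bA : bdd A by apply: bdd_sub bAB => x; left.
have bB : bdd B by apply: bdd_sub bAB => x; right.
apply: EFin_inj; rewrite EFinD !areaE//; last exact: measurableU.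
exact: measureU.
Qed.

Lemma area_split A B : mble A -> mble B -> bdd A ->
  area A = area (A `&` B) + area (A `&` ~` B).
Proof.
move=> mA mB bA.
have mA1 := mbleI mA mB.
have mA2 : mble (A `&` ~` B) by apply: mbleI => //; exact: measurableC.
rewrite -area_disjU//.
- by rewrite -setIUr setUCr setIT.
- by apply: bdd_sub bA => x [[]|[]].
- by rewrite setIACA setICr setI0.
Qed.

Lemma area_subadd A B C : mble A -> mble B -> mble C -> bdd B -> bdd C ->
  A `<=` B `|` C -> area A <= area B + area C.
Proof.
move=> mA mB mC bB bC AB.
have bA : bdd A.
  move: bB bC => [M HM] [N HN]; exists (Num.max M N) => x /AB[/HM|/HN] [h1 h2];
  by rewrite !le_max h1 h2 ?orbT.
have m1 : mble (A `&` B) by exact: mbleI.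
have m2 : mble (A `&` ~` B) by apply: mbleI => //; exact: measurableC.
rewrite (area_split mA mB bA) lerD//.
  by apply: area_mono => // x [].
apply: area_mono => // x [Ax nB].
by case: (AB x Ax).
Qed.

Lemma lam2_swap_area A : mble A -> bdd A -> area (@swap2 R @^-1` A) = area A.
Proof. by move=> mA bA; rewrite /area lam2_swap. Qed.

Lemma bdd_affmap a b e c d f A : a * d - b * c != 0 -> bdd A -> bdd (affmap a b e c d f @^-1` A).
Proof.
move=> D [M HM].
pose D' := a * d - b * c.
exists (`|D'|^-1 * ((`|d| + `|b| + `|c| + `|a|) * (M + `|e| + `|f|))) => -[x y] /HM /= [h1 h2].
have D0 : D' != 0 := D.
(* Cramer's rule, with the translation subtracted first. *)
have hx : x = D'^-1 * (d * (a * x + b * y + e - e) - b * (c * x + d * y + f - f)).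
  by apply: (mulfI D0); rewrite mulrA mulfV// mul1r /D'; ring.
have hy : y = D'^-1 * (a * (c * x + d * y + f - f) - c * (a * x + b * y + e - e)).
  by apply: (mulfI D0); rewrite mulrA mulfV// mul1r /D'; ring.
have M0 : 0 <= M by exact: le_trans h1.
have k1 : `|a * x + b * y + e - e| <= M + `|e| + `|f|.
  by apply: le_trans (ler_normB _ _) _; have := normr_ge0 f; lra.
have k2 : `|c * x + d * y + f - f| <= M + `|e| + `|f|.
  by apply: le_trans (ler_normB _ _) _; have := normr_ge0 e; lra.
have N0 : 0 <= M + `|e| + `|f| by apply: le_trans k1.
have aux p q u v : `|u| <= M + `|e| + `|f| -> `|v| <= M + `|e| + `|f| ->
    `|p| + `|q| <= `|d| + `|b| + `|c| + `|a| ->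
    `|D'^-1 * (p * u - q * v)| <= `|D'|^-1 * ((`|d| + `|b| + `|c| + `|a|) * (M + `|e| + `|f|)).
  move=> hu hv hpq; rewrite normrM normfV ler_wpM2l ?invr_ge0//.
  apply: le_trans (ler_normB _ _) _; rewrite !normrM.
  apply: (@le_trans _ _ ((`|p| + `|q|) * (M + `|e| + `|f|))).
    by rewrite mulrDl lerD// ler_wpM2l.
  by rewrite ler_wpM2r.
have := normr_ge0 a; have := normr_ge0 b; have := normr_ge0 c; have := normr_ge0 d.
by move=> ????; split; [rewrite [X in `|X|]hx|rewrite [X in `|X|]hy]; apply: aux => //; lra.
Qed.

Lemma area_affmap a b e c d f A : a * d - b * c != 0 -> mble A -> bdd A ->
  `|a * d - b * c| * area (affmap a b e c d f @^-1` A) = area A.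
Proof.
move=> D mA bA; apply: EFin_inj; rewrite EFinM !areaE//.
- exact: lam2_affmap.
- exact: mble_affmap.
- exact: bdd_affmap.
Qed.
Lemma area_between A (p q a1 b1 a2 b2 : R) : p <= q -> mble A -> bdd A ->
  (forall P, A P -> [/\ p <= P.1, P.1 <= q, a1 * P.1 + b1 <= P.2 & P.2 <= a2 * P.1 + b2]) ->
  a1 * p + b1 <= a2 * p + b2 -> a1 * q + b1 <= a2 * q + b2 ->
  area A <= (q - p) * ((a2 - a1) * (p + q) / 2 + (b2 - b1)).
Proof.
move=> pq mA bA H gp gq; rewrite -lee_fin areaE//.
apply: lam2_le_sections => //; first by move=> x /H[-> ->].
move=> x /andP[px xq].
have g : a1 * x + b1 <= a2 * x + b2.
  have [h|h] := leP a1 a2.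
    have : 0 <= (a2 - a1) * (x - p) by rewrite mulr_ge0; lra.
    by lra.
  have : 0 <= (a1 - a2) * (q - x) by rewrite mulr_ge0; lra.
  by lra.
apply: (@le_trans _ _ (@lebesgue_measure R [set` `[(a1 * x + b1), (a2 * x + b2)]%R])).
  apply: le_measure; rewrite ?inE; [exact: measurable_xsection|exact: measurable_itv|].
  by move=> y /xsectionP /H [/= _ _ h1 h2]; rewrite /= in_itv/= h1.
rewrite lebesgue_measure_itv/= lte_fin; case: ifPn => _; rewrite ?lee_fin; last by lra.
by lra.
Qed.

End PlaneArea.

(** * Continuity of elementary functions and closed conditions *)

Section Cont.
Variable (R : realType).

Lemma cont_fst (T U V : topologicalType) (f : T -> U * V) : continuous f -> continuous (fun x => (f x).1).
Proof. by move=> cf x; apply: (@continuous_comp T (U * V)%type U f fst); [exact: cf|exact: cvg_fst]. Qed.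
Lemma cont_snd (T U V : topologicalType) (f : T -> U * V) : continuous f -> continuous (fun x => (f x).2).
Proof. by move=> cf x; apply: (@continuous_comp T (U * V)%type V f snd); [exact: cf|exact: cvg_snd]. Qed.
Lemma cont_pair (T U V : topologicalType) (f : T -> U) (g : T -> V) : continuous f -> continuous g ->
  continuous (fun x => (f x, g x)).
Proof. by move=> cf cg x; apply: (@cvg_pair _ _ _ (nbhs x) (nbhs (f x)) (nbhs (g x)) _ _ _ f g); [exact: cf|exact: cg]. Qed.
Lemma contD (T : topologicalType) (f g : T -> R) : continuous f -> continuous g -> continuous (fun x => f x + g x).
Proof. by move=> cf cg x; apply: (@cvgD _ _ _ _ _ f g); [exact: cf|exact: cg]. Qed.
Lemma contM (T : topologicalType) (f g : T -> R) : continuous f -> continuous g -> continuous (fun x => f x * g x).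
Proof. by move=> cf cg x; apply: (@cvgM _ _ _ _ f g); [exact: cf|exact: cg]. Qed.
Lemma contN (T : topologicalType) (f : T -> R) : continuous f -> continuous (fun x => - f x).
Proof. by move=> cf x; apply: (@cvgN _ _ _ _ _ f); exact: cf. Qed.
Lemma cont_cst (T U : topologicalType) (c : U) : continuous (fun _ : T => c).
Proof. exact: cst_continuous. Qed.
Lemma cont_id (T : topologicalType) : continuous (fun x : T => x).
Proof. by move=> x. Qed.

Lemma closed_pre (T U : topologicalType) (f : T -> U) (A : set U) : continuous f -> closed A -> closed [set x | A (f x)].
Proof. by move=> /continuous_closedP H /H. Qed.
Lemma closed_le0 (T : topologicalType) (f g : T -> R) : continuous f -> continuous g -> closed [set x | f x <= g x].
Proof.
move=> cf cg; have -> : [set x | f x <= g x] = [set x | [set y : R | 0 <= y] (g x + - f x)].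
  by apply/seteqP; split => x /=; rewrite subr_ge0.
by apply: (closed_pre _ (@closed_ge R 0)); apply: contD => //; exact: contN.
Qed.
End Cont.

(** Recursion on the syntax of a function built from sums, products, pairs and projections; the
    second-order patterns recover its parts as functions. *)
Ltac cont := lazymatch goal with
  | |- continuous (fun x => x) => exact: cont_id
  | |- continuous (fun x => (@?f x, @?g x)) => apply: (@cont_pair _ _ _ f g); cont
  | |- continuous (fun x => @GRing.add _ (@?f x) (@?g x)) => apply: (@contD _ _ f g); cont
  | |- continuous (fun x => @GRing.mul _ (@?f x) (@?g x)) => apply: (@contM _ _ f g); cont
  | |- continuous (fun x => @GRing.opp _ (@?f x)) => apply: (@contN _ _ f); cont
  | |- continuous (fun x => fst (@?f x)) => apply: (@cont_fst _ _ _ f); cont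
  | |- continuous (fun x => snd (@?f x)) => apply: (@cont_snd _ _ _ f); cont
  | |- _ => first [exact: cont_cst | idtac]
  end.

(** * Half-planes, cones and triangles *)

Section Bodies.
Variable R : realType.
Implicit Types (A K S : set (R * R)) (P Q x : R * R).

Lemma continuous_lin (a b c : R) : continuous (fun x : R * R => a * x.1 + b * x.2 + c).
Proof. by cont. Qed.

Lemma continuous_affmap (a b e c d f : R) : continuous (affmap a b e c d f).
Proof. by rewrite /affmap; cont. Qed.

Lemma closed_le_lin (a b c : R) : closed [set x : R * R | a * x.1 + b * x.2 + c <= 0].
Proof. by apply: (@closed_le0 _ _ (fun x : R * R => a * x.1 + b * x.2 + c) (fun=> 0)); cont. Qed.

Lemma mble_le_lin (a b c : R) : mble [set x : R * R | a * x.1 + b * x.2 + c <= 0].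
Proof. by apply: mble_closed; exact: closed_le_lin. Qed.

Lemma mble_lt_lin (a b c : R) : mble [set x : R * R | a * x.1 + b * x.2 + c < 0].
Proof.
have -> : [set x : R * R | a * x.1 + b * x.2 + c < 0] =
    ~` [set x : R * R | - a * x.1 + - b * x.2 + - c <= 0].
  apply/seteqP; split => x /=; first by move=> h; apply/negP; rewrite -ltNge; lra.
  by move=> /negP; rewrite -ltNge; lra.
by apply: measurableC; exact: mble_le_lin.
Qed.

Lemma mble_le1 (a : R) : mble [set x : R * R | x.1 <= a].
Proof.
have := @mble_le_lin 1 0 (- a); congr mble; apply/seteqP; split => x /=; lra.
Qed.

Lemma convex_affmap (a b e c d f : R) A : convex_set2 A -> convex_set2 (affmap a b e c d f @^-1` A).
Proof.
move=> cA x y /= Ax Ay t t0 t1; have := cA _ _ Ax Ay t t0 t1.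
by rewrite /affmap /=; congr A; congr pair; ring.
Qed.

Lemma convexI A S : convex_set2 A -> convex_set2 S -> convex_set2 (A `&` S).
Proof. by move=> cA cS x y [Ax Sx] [Ay Sy] t t0 t1; split; [exact: cA|exact: cS]. Qed.

Lemma affmap_inv (a b e c d f : R) : a * d - b * c != 0 -> exists a' b' e' c' d' f',
  [/\ cancel (affmap a b e c d f) (affmap a' b' e' c' d' f'),
      cancel (affmap a' b' e' c' d' f') (affmap a b e c d f) &
      a' * d' - b' * c' = (a * d - b * c)^-1].
Proof.
(* An opaque name with an equation, here and later, turns a compound term into an atom for [field]
   and [lra]. *)
move=> D0; have [D DE] : exists D, D = a * d - b * c by eexists.
rewrite -DE in D0.
exists (d / D), (- b / D), ((b * f - d * e) / D), (- c / D), (a / D), ((c * e - a * f) / D).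
have h (u v : R) : D * u = v -> v / D = u by move=> <-; rewrite mulrAC mulfV ?mul1r.
split.
- by move=> [x y]; rewrite /affmap /=; congr pair; rewrite [RHS](esym (h _ _ erefl)) DE; field; rewrite -DE.
- by move=> [x y]; rewrite /affmap /=; congr pair; rewrite [RHS](esym (h _ _ erefl)) DE; field; rewrite -DE.
- by rewrite -DE; transitivity ((a * d - b * c) / D / D); [field | rewrite -DE mulfV ?mul1r].
Qed.

Lemma affmap_preimage_image (a b e c d f : R) A : a * d - b * c != 0 ->
  exists g, continuous g /\ affmap a b e c d f @^-1` A = g @` A.
Proof.
move=> D0; have [a' [b' [e' [c' [d' [f' [h1 h2 _]]]]]]] := affmap_inv e f D0.
exists (affmap a' b' e' c' d' f'); split; first exact: continuous_affmap.
apply/seteqP; split => x /=; first by move=> Ax; exists (affmap a b e c d f x); rewrite ?h1.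
by move=> [y Ay <-]; rewrite h2.
Qed.

Lemma compact_affmap (a b e c d f : R) A : a * d - b * c != 0 -> compact A ->
  compact (affmap a b e c d f @^-1` A).
Proof.
move=> D0 cA; have [g [cg ->]] := affmap_preimage_image e f A D0.
by apply: continuous_compact => //; exact: continuous_subspaceT.
Qed.

Definition cross P Q : R := P.1 * Q.2 - P.2 * Q.1.
(* Half-open, so that consecutive cones tile the punctured plane. *)
Definition cone P Q : set (R * R) := [set x | 0 < cross P x /\ 0 <= cross x Q].

Lemma mble_cone P Q : mble (cone P Q).
Proof.
have -> : cone P Q = [set x | P.2 * x.1 + - P.1 * x.2 + 0 < 0] `&`
    [set x | - Q.2 * x.1 + Q.1 * x.2 + 0 <= 0].
  apply/seteqP; split => x; rewrite /cone /cross /= => -[h1 h2]; split; lra.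
by apply: mbleI; [exact: mble_lt_lin|exact: mble_le_lin].
Qed.

(** The linear map with columns [P] and [Q] has determinant [cross P Q] and carries the standard
    triangle, with sections of length 1 - x, into [S]. *)
Lemma area_triangle S P Q : mble S -> bdd S -> convex_set2 S -> S (0, 0) -> S P -> S Q ->
  0 <= cross P Q -> cross P Q / 2 <= area (S `&` cone P Q).
Proof.
move=> mS bS cS S0 SP SQ; rewrite le_eqVlt => /predU1P[<-|PQ].
  by rewrite mul0r area_ge0.
pose f := affmap P.1 Q.1 0 P.2 Q.2 0.
have D : P.1 * Q.2 - Q.1 * P.2 = cross P Q by rewrite /cross; ring.
have D0 : P.1 * Q.2 - Q.1 * P.2 != 0 by rewrite D gt_eqF.
have mSC : mble (S `&` cone P Q) by apply: mbleI => //; exact: mble_cone.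
have bSC : bdd (S `&` cone P Q) by apply: bdd_sub bS => x [].
rewrite -(area_affmap 0 0 D0 mSC bSC) D gtr0_norm// ler_pM2l//.
rewrite -lee_fin areaE; [|exact: mble_affmap|exact: bdd_affmap].
have -> : (2^-1 : R)%:E = ((1 - 0) * ((- 1) * (0 + 1) / 2 + 1))%:E.
  by congr EFin; field.
apply: lam2_ge_sections => //.
- exact: mble_affmap.
- by move=> x /andP[x0 x1]; lra.
move=> x /andP[x0 x1].
have -> : (-1 * x + 1 : R)%:E = @lebesgue_measure R [set` `]0, (1 - x)]%R].
  rewrite lebesgue_measure_itv/= lte_fin; case: ifPn => h.
    by rewrite -EFinD; congr EFin; ring.
  by congr EFin; move: h; rewrite -leNgt; lra.
apply: le_measure; rewrite ?inE.
- exact: measurable_itv.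
- by apply: measurable_xsection; exact: mble_affmap.
move=> y; rewrite /= in_itv/= => /andP[y0 y1]; apply/xsectionP => /=.
rewrite /affmap /cone /cross /=; split; last first.
  split.
    have -> : P.1 * (P.2 * x + Q.2 * y + 0) - P.2 * (P.1 * x + Q.1 * y + 0) = y * cross P Q.
      by rewrite /cross; ring.
    exact: mulr_gt0.
  have -> : (P.1 * x + Q.1 * y + 0) * Q.2 - (P.2 * x + Q.2 * y + 0) * Q.1 = x * cross P Q.
    by rewrite /cross; ring.
  by rewrite mulr_ge0// ltW.
have s0 : 0 < x + y by lra.
(* First a point of the segment from [Q] to [P], then a contraction towards the origin. *)
have H := cS P Q SP SQ (x / (x + y)).
have {}H := H (divr_ge0 x0 (ltW s0)).
have {}H : S (x / (x + y) * P.1 + (1 - x / (x + y)) * Q.1, x / (x + y) * P.2 + (1 - x / (x + y)) * Q.2).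
  by apply: H; rewrite ler_pdivrMr// mul1r lerDl ltW.
have {}H := cS _ _ H S0 (x + y) (ltW s0).
move: H => /= /(_ _)/Wrap[]; first by lra.
congr S; congr pair; field; lra.
Qed.

(** Superadditivity is enough for lower bounds. Half-open cones make the two pieces disjoint, and
    the three-term identity between 2 by 2 determinants puts each of them inside the large cone. *)
Lemma area_cone_split S P M Q : mble S -> bdd S ->
  0 < cross P M -> 0 < cross M Q -> 0 < cross P Q ->
  area (S `&` cone P M) + area (S `&` cone M Q) <= area (S `&` cone P Q).
Proof.
move=> mS bS PM MQ PQ.
have mc X Y : mble (S `&` cone X Y) by apply: mbleI => //; exact: mble_cone.
have bc X Y : bdd (S `&` cone X Y) by apply: bdd_sub bS => x [].
have mU : mble (S `&` cone P M `|` S `&` cone M Q) by apply: mbleU.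
have dis : (S `&` cone P M) `&` (S `&` cone M Q) = set0.
  apply/seteqP; split => // x [[_ [_ h1]] [_ [h2 _]]].
  have e : cross x M = - cross M x by rewrite /cross; ring.
  by move: h1 h2 => /=; rewrite e; lra.
have bU : bdd (S `&` cone P M `|` S `&` cone M Q) by apply: bdd_sub bS => x [[]|[]].
rewrite -(area_disjU (mc _ _) (mc _ _) bU dis).
- apply: area_mono (mU) (mc _ _) (bc _ _) _.
  move=> x [[Sx [h1 h2]]|[Sx [h1 h2]]]; split=> //; split=> //.
  + rewrite -(pmulr_rge0 _ PM).
    have -> : cross P M * cross x Q = cross x M * cross P Q + cross P x * cross M Q.
      by rewrite /cross; ring.
    by rewrite addr_ge0// mulr_ge0// ltW.
  + rewrite -(pmulr_rgt0 _ MQ).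
    have -> : cross M Q * cross P x = cross P M * cross x Q + cross P Q * cross M x.
      by rewrite /cross; ring.
    by apply: ltr_wpDl; [rewrite mulr_ge0// ltW | rewrite mulr_gt0].
Qed.

End Bodies.

(** * The bound for a body with an inscribed regular hexagon *)

Section Algebra.
Variable R : realFieldType.
Implicit Types t p w c : R.

(* Piecewise linear minorant of the contribution of a sector to the overlap: [t] is the height of the body above the
   hexagon in that sector, [p] the smaller of [t] and the height in the sector matched with it by the reflection. The
   coefficients are fitted numerically so that both [term_ge_Jt] and [sum_Jt] hold. *)
Definition Jt t p : R := 92%:R / 100%:R + 7%:R / 100%:R * Num.min 1 (2 * t)
   + Num.min (4%:R / 10%:R * p) (7%:R / 100%:R + 13%:R / 100%:R * p).

(** What remains of the case p = t of [term_small] at t = (1 - w)/2, the largest height allowed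
    there. *)
Lemma poly_aux w : 0 <= w -> w <= 13/28 ->
  0 <= 18/100 - 106/100 * w + 22/10 * w^+2 - w^+3.
Proof.
move=> w0 w1.
have : 0 <= (w - 29/100)^+2 * (17/10) by rewrite mulr_ge0// ?sqr_ge0//; lra.
have : 0 <= w^+2 * (13/28 - w) by rewrite mulr_ge0// ?sqr_ge0//; lra.
rewrite !exprS !expr0; nra.
Qed.

(** Both sides are affine in p, so it is enough to treat p = 0 ([key0]) and p = t ([key1]). The
    inequality is [term_ge_Jt], cleared of denominators, where the minimum in [mut] is its second
    argument. *)
Lemma term_small w t p : 0 <= w -> w <= 13/28 -> 0 <= p -> p <= t -> 2 * t <= 1 - w ->
 (3+w) * ((3-w)*(1+w) - 4* w* t) * (92/100 + 14/100* t + 4/10* p)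
   <= ((3-w)*(1+w) + (3+w)*(1-w)^+2* p/2)*(3+w^+2).
Proof.
move=> w0 w1 p0 pt tw.
have [U UE] : exists U, U = (3-w)*(1+w) by eexists.
have [V VE] : exists V, V = 3 + w^+2 by eexists.
have [y yE] : exists y, y = w^+2 by eexists.
have y0 : 0 <= y by rewrite yE sqr_ge0.
have UE' : U = 3 + 2 * w - y by rewrite UE yE; ring.
have w3 : 0 < 3 + w by clear -w0; lra.
have yw : y <= 13/28 * w by rewrite yE expr2 ler_wpM2r.
have U0 : 3 <= U by clear -UE' w0 yw; lra.
have UV : U / (3 + w) * V - 92/100 * U = U / (3 + w) * (24/100 - 92/100* w + y).
  by rewrite VE yE; field; rewrite gt_eqF.
have U3 : 1 <= U / (3 + w) by rewrite ler_pdivlMr ?mul1r//; clear -UE' w0 w1 yw; lra.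
have q0 : 0 <= 24/100 - 92/100* w + y.
  have := sqr_ge0 (w - 46/100); rewrite sqrrB -yE => h; clear -h; lra.
have hUV : 24/100 - 92/100* w + y <= U / (3 + w) * V - 92/100 * U.
  by rewrite UV ler_peMl.
have [Q QE] : exists Q, Q = U / (3 + w) * V by eexists.
rewrite -QE in hUV.
have t0 : 0 <= t by exact: le_trans pt.
have t2 : 0 <= w* t^+2 by rewrite mulr_ge0 ?sqr_ge0.
have ty : 0 <= t*y by rewrite mulr_ge0.
have key0 : (U - 4* w* t) * (92/100 + 14/100* t) <= Q.
  have e : (U - 4* w* t) * (92/100 + 14/100* t) - 92/100 * U =
    t * (42/100 - 34/10* w) - 14/100 * (t * y) - 56/100*(w* t^+2) by rewrite UE'; field.
  have [h|h] := lerP (42/100 - 34/10* w) 0.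
    have : t * (42/100 - 34/10* w) <= 0 by rewrite mulr_ge0_le0.
    clear -e q0 hUV t2 ty; lra.
  have : t * (42/100 - 34/10* w) <= 1/2 * (42/100 - 34/10* w).
    by rewrite ler_wpM2r ?(ltW h)//; clear -tw w0; lra.
  clear -e hUV t2 ty w0 y0; lra.
have [Z ZE] : exists Z, Z = (1-w)^+2 * V / 2 by eexists.
have key1 : (U - 4* w* t) * (92/100 + 54/100* t) <= Q + t * Z.
  have e0 : (U - 4* w* t) * (92/100 + 54/100* t) =
     92/100 * U + t * (54/100 * U - 368/100 * w) - 216/100 * (w * t^+2) by field.
  have e : t * Z - t * (54/100 * U - 368/100 * w) =
     t * (- 12/100 - 4/10* w + 2*y) + t * y * (54/100 - w) + t * y * y / 2.
    by rewrite ZE UE VE yE; field.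
  have h2 : 0 <= t * y * (54/100 - w) by rewrite mulr_ge0//; clear -w1; lra.
  have h3 : 0 <= t * y * y by rewrite mulr_ge0.
  have pa := poly_aux w0 w1.
  have [h|h] := lerP (- 12/100 - 4/10* w + 2*y) 0.
    have h5 : (1 - w) / 2 * (- 12/100 - 4/10* w + 2*y) <= t * (- 12/100 - 4/10* w + 2*y).
      by rewrite ler_wnM2r//; clear -tw; lra.
    have h6 : (1 - w) / 2 * (- 12/100 - 4/10* w + 2*y) = - 6/100 - 14/100 * w + 12/10 * y - w^+3.
      by rewrite yE; field.
    rewrite -yE in pa; clear -e0 e h2 h3 h5 h6 pa hUV t2; lra.
  have : 0 <= t * (- 12/100 - 4/10* w + 2*y) by rewrite mulr_ge0// ltW.
  clear -hUV q0 e0 e h2 h3 t2; lra.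
have key : (U - 4* w* t) * (92/100 + 14/100* t + 4/10* p) <= Q + p * Z.
  have [h|h] := lerP (4/10 * (U - 4* w* t)) Z.
    have : p * (4/10 * (U - 4* w* t)) <= p * Z by rewrite ler_wpM2l.
    clear -key0; lra.
  have : (t - p) * Z <= (t - p) * (4/10 * (U - 4* w* t)).
    by rewrite ler_wpM2l ?(ltW h)//; clear -pt; lra.
  clear -key1; lra.
rewrite -UE -VE -mulrA.
have -> : (U + (3 + w) * (1 - w) ^+ 2 * p / 2) * V = (3+w) * (Q + p * Z).
  by rewrite QE ZE; field; rewrite gt_eqF.
by rewrite ler_wpM2l// ltW.
Qed.

Lemma term_big w p : 0 <= w -> w <= 13/28 -> 0 <= p -> p <= 1 ->
  99/100 + Num.min (4/10* p) (7/100 + 13/100* p) <= 4* w/(3+w) + (1-w) * (2 / (2 - p*(1-w))).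
Proof.
move=> w0 w1 p0 p1.
have [z zE] : exists z, z = 1 - w by eexists.
have [T TE] : exists T, T = w * z / (3 + w) by eexists.
have z0 : 0 <= z by rewrite zE; clear -w1; lra.
have z1 : z <= 1 by rewrite zE; clear -w0; lra.
have pz : p * z <= 1 by have := ler_pM p0 z0 p1 z1; rewrite mulr1.
have pz0 : 0 <= p * z by rewrite mulr_ge0.
have wz0 : 0 <= w * z by rewrite mulr_ge0.
have w3 : 0 < 3 + w by clear -w0; lra.
have T0 : 28/97 * (w * z) <= T.
  rewrite TE ler_pdivlMr// mulrAC ler_piMl//.
  clear -w1 w0; lra.
have ww : w * w <= 13/28 * w by rewrite ler_wpM2r.
have wwz : w * z = w - w * w by rewrite zE; ring.
have T1 : T <= 8/100.
  rewrite TE ler_pdivrMr// wwz.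
  have := sqr_ge0 (w - 46/100); rewrite sqrrB expr2 => h; clear -h; lra.
have d0 : 0 < 2 - p * z by clear -pz; lra.
have [F FE] : exists F, F = z^+2 * p / (2 - p * z) by eexists.
have -> : 4* w/(3+w) + (1-w) * (2 / (2 - p*(1-w))) = 1 + T + F.
  by rewrite TE FE zE; field; rewrite -zE !gt_eqF.
(* The two arguments of the minimum agree at p = 7/27, just below 26/100. *)
have [pp|pp] := lerP p (26/100).
  have hF : z^+2 * p / 2 <= F.
    rewrite FE ler_wpM2l ?mulr_ge0 ?sqr_ge0// lef_pV2 ?posrE//.
    by rewrite lerBlDr lerDl.
  have m3 : Num.min (4/10 * p) (7/100 + 13/100 * p) <= 4/10 * p by rewrite ge_min lexx.
  have [q qE] : exists q, q = 4/10 - z^+2/2 by eexists.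
  have qp : z^+2 * p / 2 = 4/10 * p - p * q by rewrite qE; field.
  have qw : q = - 1/10 + w - w * w / 2 by rewrite qE zE; field.
  have [h|h] := lerP q 0.
    have : p * q <= 0 by rewrite mulr_ge0_le0.
    clear -m3 hF T0 wz0 qp; lra.
  have : p * q <= 26/100 * q by rewrite ler_wpM2r// ltW.
  clear -m3 hF T0 qp qw wwz ww w0 w1; lra.
have m3 : Num.min (4/10 * p) (7/100 + 13/100 * p) <= 7/100 + 13/100 * p by rewrite ge_min lexx orbT.
suff : -1/100 + (7/100 + 13/100 * p) <= T + F by clear -m3; lra.
rewrite -subr_ge0 -(@pmulr_rge0 _ (2 - p * z))//.
have -> : (2 - p * z) * (T + F - (-1/100 + (7/100 + 13/100 * p))) =
   2 * (T - 6/100) + p * (z^+2 - 26/100 + 6/100*z - z*T) + 13/100 * (z * p^+2).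
  by rewrite FE; field; rewrite gt_eqF.
have zT : z * T <= z * (8/100) by rewrite ler_wpM2l.
have [q qE] : exists q, q = z^+2 - 26/100 + 6/100*z - z*T by eexists.
have zp : 0 <= z * p^+2 by rewrite mulr_ge0 ?sqr_ge0.
have zz : z^+2 = 1 - 2 * w + w * w by rewrite zE; ring.
have q0 : 0 <= q.
  have : 0 <= (z - 15/28) * (z + 1/2) by rewrite mulr_ge0// zE; clear -w1; lra.
  rewrite qE expr2 => h; clear -h zT z0; lra.
have : 26/100 * q <= p * q by rewrite ler_wpM2r// ltW.
rewrite -qE.
clear -T0 zT zp zz qE wwz ww zE w0 w1; lra.
Qed.

(* [mu_] and [a * ze_] below, in the half-angle parameter [w] of [rotation_param]. *)
Definition mut w t : R := Num.min 1 ((3 + w^+2) / ((3-w)*(1+w) - 4* w* t)).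
Definition rt w p : R := 2 / (2 - p * (1 - w)).

(** For w > 0 the minimum in [mut] drops below 1 exactly when 2 t < 1 - w, which separates
    [term_small] from [term_big]. *)
Lemma term_ge_Jt w t p : 0 <= w -> w <= 13/28 -> 0 <= p -> p <= t -> t <= 1 ->
  Jt t p <= mut w t * (4* w/(3+w) + (1-w) * rt w p).
Proof.
move=> w0 w1 p0 pt t1.
have z0 : 0 <= 1 - w by clear -w1; lra.
have z1 : 1 - w <= 1 by clear -w0; lra.
have p1 : p <= 1 by exact: le_trans t1.
have t0 : 0 <= t by exact: le_trans pt.
have pz : p * (1 - w) <= 1 by have := ler_pM p0 z0 p1 z1; rewrite mulr1.
have pz0 : 0 <= p * (1 - w) by rewrite mulr_ge0.
have m1 : Num.min 1 (2 * t) <= 1 by rewrite ge_min lexx.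
have m2 : Num.min 1 (2 * t) <= 2 * t by rewrite ge_min lexx orbT.
have m3 : Num.min (4/10 * p) (7/100 + 13/100 * p) <= 4/10 * p by rewrite ge_min lexx.
have wt : w * t <= w by rewrite ler_piMr.
have ww : w * w <= w * 1 by rewrite ler_wpM2l//; clear -w1; lra.
have [D DE] : exists D, D = (3-w)*(1+w) - 4* w* t by eexists.
have DE' : D = 3 + 2 * w - w * w - 4 * (w * t) by rewrite DE; ring.
have den : 0 < D by clear -DE' wt ww w0 w1; lra.
have d0 : 0 < 2 - p * (1 - w) by clear -pz; lra.
have w3 : 0 < 3 + w by clear -w0; lra.
rewrite /mut -DE; have [h|h] := lerP (1 - w) (2 * t).
  have -> : Num.min 1 ((3 + w^+2) / D) = 1.
    apply/min_idPl; rewrite ler_pdivlMr// mul1r.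
    have : w * (1 - w) <= w * (2 * t) by rewrite ler_wpM2l.
    by rewrite expr2; clear -DE'; lra.
  rewrite mul1r; apply: le_trans (term_big w0 w1 p0 p1).
  by rewrite /Jt; clear -m1; lra.
have -> : Num.min 1 ((3 + w^+2) / D) = (3 + w^+2) / D.
  apply/min_idPr; rewrite ler_pdivrMr// mul1r.
  have : w * (2 * t) <= w * (1 - w) by rewrite ler_wpM2l// ltW.
  by rewrite expr2; clear -DE'; lra.
apply: (@le_trans _ _ (92/100 + 14/100* t + 4/10* p)); first by rewrite /Jt; clear -m2 m3; lra.
rewrite [X in _ <= X]mulrAC ler_pdivlMr//.
have e : 4 * w / (3 + w) + (1 - w) * rt w p =
  ((3-w)*(1+w)) / (3+w) + (1-w)^+2 * p / (2 - p * (1-w)).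
  by rewrite /rt; field; rewrite !gt_eqF.
have h4 : (1-w)^+2 * p / 2 <= (1-w)^+2 * p / (2 - p * (1-w)).
  rewrite ler_wpM2l ?mulr_ge0 ?sqr_ge0// lef_pV2 ?posrE//.
  by rewrite lerBlDr lerDl.
have ts := term_small w0 w1 p0 pt (ltW h).
apply: (@le_trans _ _ ((3 + w^+2) * (((3-w)*(1+w)) / (3+w) + (1-w)^+2 * p / 2))); last first.
  by rewrite ler_wpM2l ?e ?lerD2l// addr_ge0// sqr_ge0.
rewrite -(@ler_pM2l _ (3+w))//.
have -> : (3 + w) * ((3 + w ^+ 2) * ((3 - w) * (1 + w) / (3 + w) + (1 - w) ^+ 2 * p / 2)) =
   ((3-w)*(1+w) + (3+w)*(1-w)^+2* p/2)*(3+w^+2) by field; rewrite gt_eqF.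
by apply: le_trans ts; rewrite DE -!mulrA [X in _ * X]mulrC.
Qed.

(** Heights are eliminated in favour of caps in three versions: [cap_A] for a sector matched with
    itself, [cap_C] for the lower sector of a matched pair, whose height enters both terms [Jt], and
    [cap_B] for the higher one. *)
Lemma cap_B t c : 0 <= t -> c <= 1 -> c <= 2* t - t^+2 ->
  41/59 * c - 7/100 * Num.min 1 (2* t) <= (41/59 - 7/100) * c.
Proof.
move=> t0 c1 h; have : 0 <= t^+2 by exact: sqr_ge0.
by case: (leP 1 (2* t)) => ?; lra.
Qed.

Lemma cap_A t c : 0 <= t -> t <= 1 -> c <= 1 -> c <= 2* t - t^+2 ->
  41/59 * c - 7/100 * Num.min 1 (2* t) - Num.min (4/10* t) (7/100+13/100* t)
   <= 4/9 * c.
Proof.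
move=> t0 t1 c1 h; have : 0 <= t^+2 by exact: sqr_ge0.
(* 74/100 and 46/100 are close to the vertices of the quadratics in t that the branches with larger
   t leave. *)
have : 0 <= (t - 74/100)^+2 by exact: sqr_ge0.
have : 0 <= (t - 46/100)^+2 by exact: sqr_ge0.
have : 0 <= (t - 2/10)^+2 by exact: sqr_ge0.
move: h; rewrite !exprS !expr0.
by case: (leP 1 (2* t)) => ?; case: (leP (4/10* t) (7/100+13/100* t)) => ?; lra.
Qed.

Lemma cap_C t c : 0 <= t -> t <= 1 -> c <= 1 -> c <= 2* t - t^+2 ->
  41/59 * c - 7/100 * Num.min 1 (2* t) - 2 * Num.min (4/10* t) (7/100+13/100* t)
   <= 27/100 * c.
Proof.
move=> t0 t1 c1 h; have : 0 <= t^+2 by exact: sqr_ge0.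
have : 0 <= (t - 69/100)^+2 by exact: sqr_ge0.
have : 0 <= (t - 5/10)^+2 by exact: sqr_ge0.
move: h; rewrite !exprS !expr0.
by case: (leP 1 (2* t)) => ?; case: (leP (4/10* t) (7/100+13/100* t)) => ?; lra.
Qed.

(** By [cap_A], [cap_B] and [cap_C] the claim becomes linear in the caps, with neighbours summing to
    at most 1 around a cycle of six. The critical configurations are the alternate triples: each
    contains one self-matched sector and one matched pair, hence has weight 4/9 + (41/59 - 7/100) +
    27/100, which is less than the available 6 (92/100 - 41/59). *)
Lemma sum_Jt (t0 t1 t2 t3 t4 t5 c0 c1 c2 c3 c4 c5 : R) :
  (forall t c, (t, c) \in [:: (t0, c0); (t1, c1); (t2, c2); (t3, c3); (t4, c4); (t5, c5)] ->
     [/\ 0 <= t, t <= 1, 0 <= c, c <= 1 & c <= 2* t - t^+2]) ->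
  c0 + c1 <= 1 -> c1 + c2 <= 1 -> c2 + c3 <= 1 -> c3 + c4 <= 1 -> c4 + c5 <= 1 -> c5 + c0 <= 1 ->
  41/59 * (6 + (c0 + c1 + c2 + c3 + c4 + c5)) <=
  Jt t0 t0 + Jt t3 t3 + Jt t1 (Num.min t1 t5) + Jt t5 (Num.min t1 t5)
   + Jt t2 (Num.min t2 t4) + Jt t4 (Num.min t2 t4).
Proof.
move=> H s01 s12 s23 s34 s45 s50.
have [a0 b0 d0 e0 f0] := H t0 c0 ltac:(by rewrite !inE eqxx).
have [a1 b1 d1 e1 f1] := H t1 c1 ltac:(by rewrite !inE eqxx ?orbT).
have [a2 b2 d2 e2 f2] := H t2 c2 ltac:(by rewrite !inE eqxx ?orbT).
have [a3 b3 d3 e3 f3] := H t3 c3 ltac:(by rewrite !inE eqxx ?orbT).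
have [a4 b4 d4 e4 f4] := H t4 c4 ltac:(by rewrite !inE eqxx ?orbT).
have [a5 b5 d5 e5 f5] := H t5 c5 ltac:(by rewrite !inE eqxx ?orbT).
have A0 := cap_A a0 b0 e0 f0. have A3 := cap_A a3 b3 e3 f3.
have B1 := cap_B a1 e1 f1. have B2 := cap_B a2 e2 f2.
have B4 := cap_B a4 e4 f4. have B5 := cap_B a5 e5 f5.
have C1 := cap_C a1 b1 e1 f1. have C2 := cap_C a2 b2 e2 f2.
have C4 := cap_C a4 b4 e4 f4. have C5 := cap_C a5 b5 e5 f5.
clear H a0 a1 a2 a3 a4 a5 b0 b1 b2 b3 b4 b5 e0 e1 e2 e3 e4 e5 f0 f1 f2 f3 f4 f5.
rewrite /Jt; case: (leP t1 t5) => _; case: (leP t2 t4) => _; lra.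
Qed.

End Algebra.

(** * Rotations by 60 degrees and the six sectors *)

Section HexBodies.
Variable R : realType.
Implicit Types (A K S : set (R * R)) (P Q x : R * R).

(* In these oblique coordinates (0,1), (-1,1), (-1,0), (0,-1), (1,-1), (1,0) are the vertices of a regular hexagon, the
   squared Euclidean norm is x^2 + xy + y^2, and [rot] is the rotation by 60 degrees. *)
Definition rot x : R * R := (- x.2, x.1 + x.2).
(** A preimage: [A] is turned backwards by 60 k degrees, so that its k-th sector comes to lie over
    [C0]. *)
Definition rotk k A : set (R * R) := [set x | A (iter k rot x)].
Definition C0 : set (R * R) := cone (1, 0) (0, 1).

Lemma rot_affmap : rot = affmap 0 (-1) 0 1 1 0.
Proof. by apply/funext => -[a b]; rewrite /rot /affmap /=; congr pair; ring. Qed.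

Lemma iter6_rot x : iter 6 rot x = x.
Proof. by case: x => a b; rewrite /= /rot /=; congr pair; ring. Qed.

Lemma rotkS k A : rotk k.+1 A = rot @^-1` rotk k A.
Proof. by apply/seteqP; split => x; rewrite /rotk /= -iterSr. Qed.

Lemma rotk_rotk j k A : rotk j (rotk k A) = rotk (j + k) A.
Proof. by apply/seteqP; split => x; rewrite /rotk /= addnC iterD. Qed.

Lemma rotk6 A : rotk 6 A = A.
Proof. by apply/funext => x; rewrite /rotk -[in RHS](iter6_rot x). Qed.

Lemma rot_det : (0 : R) * 1 - (-1) * 1 = 1. Proof. by ring. Qed.
Lemma rot_det0 : (0 : R) * 1 - (-1) * 1 != 0. Proof. by rewrite rot_det oner_eq0. Qed.

Lemma mble_rotk k A : mble A -> mble (rotk k A).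
Proof.
elim: k => [//|k IH] mA; rewrite rotkS rot_affmap.
by apply: mble_affmap; [exact: rot_det0|exact: IH].
Qed.

Lemma bdd_rotk k A : bdd A -> bdd (rotk k A).
Proof.
elim: k => [//|k IH] mA; rewrite rotkS rot_affmap.
by apply: bdd_affmap; [exact: rot_det0|exact: IH].
Qed.

Lemma convex_rotk k A : convex_set2 A -> convex_set2 (rotk k A).
Proof.
elim: k => [//|k IH] mA; rewrite rotkS rot_affmap.
by apply: convex_affmap; exact: IH.
Qed.

Lemma compact_rotk k A : compact A -> compact (rotk k A).
Proof.
elim: k => [//|k IH] mA; rewrite rotkS rot_affmap.
by apply: compact_affmap; [exact: rot_det0|exact: IH].
Qed.

Lemma area_rotk k A : mble A -> bdd A -> area (rotk k A) = area A.
Proof.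
elim: k => [//|k IH] mA bA; rewrite -(IH mA bA) rotkS rot_affmap.
rewrite -[RHS](area_affmap 0 0 rot_det0 (mble_rotk k mA) (bdd_rotk k bA)).
by rewrite rot_det normr1 mul1r.
Qed.

Lemma mble_C0 : mble C0. Proof. exact: mble_cone. Qed.

Lemma area_set0 : area [set (0, 0) : R * R] = 0.
Proof.
have m0 : mble [set (0, 0) : R * R] by apply: mble_compact; exact: compact_set1.
have b0 : bdd [set (0, 0) : R * R] by apply: bdd_compact; exact: compact_set1.
apply/eqP; rewrite eq_le area_ge0 andbT -lee_fin areaE//.
have -> : (0 : R)%:E = ((0 - 0) * (0 * (0 + 0) / 2 + 0))%:E by congr EFin; ring.
apply: lam2_le_sections => //.
- by move=> x ->; rewrite /= lexx.
- move=> x _; rewrite mul0r addr0.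
  apply: (@le_trans _ _ (@lebesgue_measure R [set 0])); last by rewrite lebesgue_measure_set1.
  apply: le_measure; rewrite ?inE; [exact: measurable_xsection|exact: measurable_set1|].
  by move=> y /xsectionP[_ ->].
Qed.

(** The sectors are split off one at a time; what is left is at most the centre, a null set. *)
Lemma area_sectors A : mble A -> bdd A ->
  area A = \sum_(k < 6) area (rotk k A `&` C0).
Proof.
move=> mA bA.
(* [C0] turned forwards by 60 k degrees; 6 - k appears because [rotk] is a preimage. *)
pose B k := rotk (6 - k) C0.
have mB k : mble (B k) by apply: mble_rotk; exact: mble_C0.
have rB (k : 'I_6) : area (rotk k A `&` C0) = area (A `&` B k).
  rewrite -(area_rotk k (mbleI mA (mB k))); last by apply: bdd_sub bA => x [].
  congr area; rewrite /B -[X in _ `&` X]rotk6.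
  have -> : rotk 6 C0 = rotk k (rotk (6 - k) C0) by rewrite rotk_rotk subnKC// ltnW.
  by [].
rewrite (eq_bigr _ (fun k _ => rB k)) {rB}.
have step A' k : mble A' -> bdd A' -> A' `&` B k = A `&` B k ->
    area A' = area (A `&` B k) + area (A' `&` ~` B k).
  by move=> mA' bA' <-; exact: area_split.
pose A1 := A `&` ~` B 0%N. pose A2 := A1 `&` ~` B 1%N. pose A3 := A2 `&` ~` B 2%N.
pose A4 := A3 `&` ~` B 3%N. pose A5 := A4 `&` ~` B 4%N.
have mD A' k : mble A' -> mble (A' `&` ~` B k) by move=> mA'; apply: mbleI => //; exact: mbleC.
have bD A' k : bdd A' -> bdd (A' `&` ~` B k) by apply: bdd_sub => x [].
rewrite !big_ord_recl big_ord0 addr0 /=.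
have BE : (forall x, B 0%N x <-> (0 < x.2 /\ 0 <= x.1)) /\
          (forall x, B 1%N x <-> (0 < - x.1 /\ 0 <= x.1 + x.2)) /\
          (forall x, B 2%N x <-> (0 < - x.1 - x.2 /\ 0 <= x.2)) /\
          (forall x, B 3%N x <-> (0 < - x.2 /\ 0 <= - x.1)) /\
          (forall x, B 4%N x <-> (0 < x.1 /\ 0 <= - x.1 - x.2)) /\
          (forall x, B 5%N x <-> (0 < x.1 + x.2 /\ 0 <= - x.2)).
  do 5!(split; first by move=> x; rewrite /B /rotk /C0 /cone /cross /rot /=; split => -[]; split; lra).
  by move=> x; rewrite /B /rotk /C0 /cone /cross /rot /=; split => -[]; split; lra.
move: BE => [E0 [E1 [E2 [E3 [E4 E5]]]]].
have nB0 x : (~ B 0%N x) -> 0 < x.2 -> x.1 < 0.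
  by move=> h h2; rewrite ltNge; apply/negP => h1; apply: h; apply/E0.
rewrite (step A 0%N)//; congr (_ + _).
rewrite (step A1 1%N); [|exact: mD|exact: bD|]; last first.
  apply/seteqP; split => x; first by move=> [[]].
  by move=> [Ax /[dup] Bx /E1 h]; split=> //; split=> // /E0; lra.
congr (_ + _).
rewrite (step A2 2%N); [|by do 2 apply: (mD)|by do 2 apply: (bD)|]; last first.
  apply/seteqP; split => x; first by move=> [[[]]].
  move=> [Ax /[dup] Bx /E2 h]; split=> //; split; first by split=> // /E0; lra.
  by move=> /E1; lra.
congr (_ + _).
rewrite (step A3 3%N); [|by do 3 apply: (mD)|by do 3 apply: (bD)|]; last first.
  apply/seteqP; split => x; first by move=> [[[[]]]].
  move=> [Ax /[dup] Bx /E3 h]; split=> //; split; last by move=> /E2; lra.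
  by split; [split=> // /E0; lra|move=> /E1; lra].
congr (_ + _).
rewrite (step A4 4%N); [|by do 4 apply: (mD)|by do 4 apply: (bD)|]; last first.
  apply/seteqP; split => x; first by move=> [[[[[]]]]].
  move=> [Ax /[dup] Bx /E4 h]; split=> //; split; last by move=> /E3; lra.
  split; last by move=> /E2; lra.
  by split; [split=> // /E0; lra|move=> /E1; lra].
congr (_ + _).
rewrite (step A5 5%N); [|by do 5 apply: (mD)|by do 5 apply: (bD)|]; last first.
  apply/seteqP; split => x; first by move=> [[[[[[]]]]]].
  move=> [Ax /[dup] Bx /E5 h]; split=> //; split; last by move=> /E4; lra.
  split; last by move=> /E3; lra.
  split; last by move=> /E2; lra.
  by split; [split=> // /E0; lra|move=> /E1; lra].
rewrite -[RHS]addr0; congr (_ + _).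
apply/eqP; rewrite eq_le area_ge0 andbT -area_set0; apply: area_mono.
- by do 6 apply: (mD).
- by apply: mble_compact; exact: compact_set1.
- by apply: bdd_compact; exact: compact_set1.
move=> [x y] [[[[[[_ /E0 n0] /E1 n1] /E2 n2] /E3 n3] /E4 n4] /E5 n5] /=.
have P2 (p q : R) : ~ (0 < p /\ 0 <= q) -> p <= 0 \/ q < 0.
  move=> h; have [p0|p0] := ltrP 0 p; last by left.
  by right; rewrite ltNge; apply/negP => q0; apply: h.
move: (P2 _ _ n0) (P2 _ _ n1) (P2 _ _ n2) (P2 _ _ n3) (P2 _ _ n4) (P2 _ _ n5) => /=.
move=> a0 a1 a2 a3 a4 a5.
have y0 : y = 0 by apply/eqP; rewrite eq_le; apply/andP; split; lra.
have x0 : x = 0 by apply/eqP; rewrite eq_le; apply/andP; split; lra.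
by rewrite x0 y0.
Qed.

End HexBodies.

(** * Height and area of the body above a side of the hexagon *)

Section Caps.
Variable R : realType.
Implicit Types (A K S : set (R * R)) (P Q x : R * R).

Definition trap (a b p q : R) : set (R * R) :=
  [set x | [/\ a <= x.1, x.1 <= b, 0 <= x.2 & x.2 <= p * x.1 + q]].

Lemma mble_trap a b p q : mble (trap a b p q).
Proof.
have -> : trap a b p q = [set x | -1 * x.1 + 0 * x.2 + a <= 0] `&` [set x | 1 * x.1 + 0 * x.2 + - b <= 0]
   `&` ([set x | 0 * x.1 + -1 * x.2 + 0 <= 0] `&` [set x | - p * x.1 + 1 * x.2 + - q <= 0]).
  apply/seteqP; split => x; rewrite /trap /=.
    by move=> [h1 h2 h3 h4]; split; split; lra.
  by move=> [[h1 h2] [h3 h4]]; split; lra.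
by do 2 (apply: mbleI; try exact: mble_le_lin); apply: mbleI; exact: mble_le_lin.
Qed.

Lemma bdd_trap a b p q : bdd (trap a b p q).
Proof.
exists (`|a| + `|b| + `|p| * (`|a| + `|b|) + `|q|) => x [h1 h2 h3 h4].
have hx : `|x.1| <= `|a| + `|b|.
  rewrite ler_norml; apply/andP; split.
    by have := ler_norm (- a); have := normr_ge0 b; rewrite normrN; lra.
  by have := ler_norm b; have := normr_ge0 a; lra.
have hp : p * x.1 <= `|p| * (`|a| + `|b|).
  by apply: le_trans (ler_norm _) _; rewrite normrM ler_wpM2l.
have hp0 : 0 <= `|p| * (`|a| + `|b|) by rewrite mulr_ge0// addr_ge0.
have := ler_norm q; have := normr_ge0 q; have := normr_ge0 a; have := normr_ge0 b => *.
by split; [lra | rewrite ger0_norm//; lra].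
Qed.

Lemma area_trap_le a b p q : a <= b -> 0 <= p * a + q -> 0 <= p * b + q ->
  area (trap a b p q) <= (b - a) * (p * (a + b) / 2 + q).
Proof.
move=> ab pa pb.
have -> : (b - a) * (p * (a + b) / 2 + q) = (b - a) * ((p - 0) * (a + b) / 2 + (q - 0)) by rewrite !subr0.
apply: area_between => //; [exact: mble_trap|exact: bdd_trap| |lra|lra].
by move=> P [h1 h2 h3 h4]; split => //; lra.
Qed.

(* A line supporting [K] at (0,1); if [K] contains the hexagon, its slope is automatically as stated. *)
Definition supp1 K := K (0, 1) /\ exists s : R, [/\ 0 <= s, s <= 1 & forall P, K P -> s * P.1 + P.2 <= 1].
Definition hexbody K := [/\ compact K, convex_set2 K & forall k, supp1 (rotk k K)].

Lemma hexbody_rotk j K : hexbody K -> hexbody (rotk j K).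
Proof.
move=> [cK vK sK]; split; [exact: compact_rotk|exact: convex_rotk|].
by move=> k; rewrite rotk_rotk; exact: sK.
Qed.

(** Height above the side from (0,1) to (1,0), in the scale in which the small triangle on that side
    has height 1. *)
Definition is_top K t := (exists P, [/\ K P, 0 <= P.1, 0 <= P.2 & P.1 + P.2 = 1 + t]) /\
  (forall P, K P -> 0 <= P.1 -> 0 <= P.2 -> P.1 + P.2 <= 1 + t).

Section HexBody.
Variables (K : set (R * R)) (hK : hexbody K).

Let cK : compact K. Proof. by case: hK. Qed.
Let vK : convex_set2 K. Proof. by case: hK. Qed.
Lemma hex_mble : mble K. Proof. exact: mble_compact. Qed.
Lemma hex_bdd : bdd K. Proof. exact: bdd_compact. Qed.

Lemma hex01 : K (0, 1).
Proof. by case: hK => _ _ /(_ 0%N) []. Qed.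

Lemma hex10 : K (1, 0).
Proof.
case: hK => _ _ /(_ 5%N) [h _]; move: h; rewrite /rotk /= /rot /=.
by congr K; congr pair; ring.
Qed.

Lemma hex00 : K (0, 0).
Proof.
have e : rot (rot (rot (0, 1))) = (0, -1) :> R * R by rewrite /rot /=; congr pair; ring.
case: hK => _ _ /(_ 3%N) [h _]; move: h; rewrite /rotk /= e => h.
have h2 : (0 : R) <= 2^-1 by rewrite invr_ge0.
have h3 : (2^-1 : R) <= 1 by lra.
have := vK hex01 h h2 h3.
by rewrite /=; congr K; congr pair; field.
Qed.

Lemma hex_supp1 : exists s : R, [/\ 0 <= s, s <= 1 & forall P, K P -> s * P.1 + P.2 <= 1].
Proof. by case: hK => _ _ /(_ 0%N) [_]. Qed.

Lemma hex_supp0 : exists s : R, [/\ 0 <= s, s <= 1 & forall P, K P -> P.1 + s * P.2 <= 1].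
Proof.
case: hK => _ _ /(_ 5%N) [_ [s [s0 s1 H]]]; exists (1 - s); split; [lra|lra|] => P KP.
have KP' : rotk 5 K (rot P) by rewrite /rotk /= -[rot _]/(iter 6 (@rot R) P) iter6_rot.
by have := H _ KP'; rewrite /rot /=; lra.
Qed.

Lemma hex_box P : K P -> 0 <= P.1 -> 0 <= P.2 -> P.1 <= 1 /\ P.2 <= 1.
Proof.
move=> KP p1 p2; have [s [s0 s1 H1]] := hex_supp1; have [r [r0 r1 H0]] := hex_supp0.
have := H1 P KP; have := H0 P KP; have := mulr_ge0 s0 p1; have := mulr_ge0 r0 p2.
by move=> *; split; lra.
Qed.

Lemma hex_top : exists t, is_top K t.
Proof.
pose A : set (R * R) := K `&` ([set x | -1 * x.1 + 0 * x.2 + 0 <= 0] `&` [set x | 0 * x.1 + -1 * x.2 + 0 <= 0]).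
have cA : compact A.
  apply: compact_closedI => //; apply: closedI; exact: closed_le_lin.
have A0 : A !=set0.
  by exists (0, 1); split; [exact: hex01|split => /=; lra].
have cf : {within A, continuous (fun x : R * R => 1 * x.1 + 1 * x.2 + -1)}.
  by apply: continuous_subspaceT; exact: continuous_lin.
have [P /set_mem [KP [/= p1 p2]] HP] := compact_EVT_max A0 cA cf.
exists (1 * P.1 + 1 * P.2 + -1); split.
  by exists P; split => //; lra.
move=> Q KQ q1 q2.
have := HP Q; rewrite inE => h; have {}h := h _.
have : A Q by split => //; split => /=; lra.
by move=> /h; lra.
Qed.

Variables (t : R) (ht : is_top K t).

Lemma top_ge0 : 0 <= t.
Proof. have [_ /(_ _ hex01)] := ht; rewrite /= ler01 lexx => /(_ isT isT); lra. Qed.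

Lemma top_le1 : t <= 1.
Proof. by have [[P [KP p1 p2 e]] _] := ht; have := hex_box KP p1 p2; lra. Qed.

(** A highest point [X] may lie anywhere on the segment from (t,1) to (1,t). The two inequalities,
    which come from its two extreme positions, describe what the hulls of (0,0), (1,0), (0,1) and
    [X] have in common. *)
Lemma top_hull a b : 0 <= a -> 0 <= b -> (1 - t) * a + b <= 1 -> a + (1 - t) * b <= 1 -> K (a, b).
Proof.
move=> a0 b0 h1 h2.
have [[X [KX x1 x2 e]] _] := ht.
have [X1 X2] := hex_box KX x1 x2.
have t0 := top_ge0.
have tri (P1 P2 : R * R) (u v x y : R) : K P1 -> K P2 -> 0 <= u -> 0 <= v -> u + v <= 1 ->
    u * P1.1 + v * P2.1 = x -> u * P1.2 + v * P2.2 = y -> K (x, y).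
  move=> k1 k2 u0 v0 uv <- <-.
  have [s0|s0] := lerP (u + v) 0.
    have u_0 : u = 0 by lra.
    have v_0 : v = 0 by lra.
    by rewrite u_0 v_0 !mul0r !addr0; exact: hex00.
  have H := vK k1 k2 (divr_ge0 u0 (ltW s0)).
  have {}H : K (u / (u + v) * P1.1 + (1 - u / (u + v)) * P2.1, u / (u + v) * P1.2 + (1 - u / (u + v)) * P2.2).
    by apply: H; rewrite ler_pdivrMr// mul1r lerDl.
  have {}H := vK H hex00 (ltW s0) uv.
  by move: H => /=; congr K; congr pair; field; rewrite gt_eqF.
(* The ray through [X] decides whether the point falls in the triangle with vertex (1,0) or in the
   one with vertex (0,1). *)
have [c0|c0] := lerP 0 (a * X.2 - b * X.1).
  have [X20|X20] := lerP X.2 0.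
    have t_0 : t = 0 by lra.
    apply: (tri _ _ a b _ _ hex10 hex01 a0 b0); rewrite ?mulr1 ?mulr0 ?addr0 ?add0r//=.
    by move: h1; rewrite t_0; lra.
  apply: (tri _ _ (a - b * X.1 / X.2) (b / X.2) _ _ hex10 KX) => /=.
  - by rewrite subr_ge0 ler_pdivrMr//; lra.
  - by rewrite divr_ge0.
  - have -> : a - b * X.1 / X.2 + b / X.2 = a + b * (1 - X.1) / X.2 by field; rewrite gt_eqF.
    apply: le_trans h2; rewrite lerD2l ler_pdivrMr//.
    have h : 0 <= b * (t * (1 - X.2)) by rewrite !mulr_ge0//; lra.
    have -> : X.1 = 1 + t - X.2 by lra.
    by move: h; lra.
  - by field; rewrite gt_eqF.
  - by field; rewrite gt_eqF.
have X10 : 0 < X.1.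
  rewrite lt_neqAle x1 andbT; apply/eqP => h; move: c0; rewrite -h mulr0 subr0.
  by have := mulr_ge0 a0 x2; lra.
apply: (tri _ _ (b - a * X.2 / X.1) (a / X.1) _ _ hex01 KX) => /=.
- by rewrite subr_ge0 ler_pdivrMr//; lra.
- by rewrite divr_ge0.
- have -> : b - a * X.2 / X.1 + a / X.1 = b + a * (1 - X.2) / X.1 by field; rewrite gt_eqF.
  apply: le_trans h1; rewrite [leRHS]addrC lerD2l ler_pdivrMr//.
  have h : 0 <= a * (t * (1 - X.1)) by rewrite !mulr_ge0//; lra.
  have -> : X.2 = 1 + t - X.1 by lra.
  by move: h; lra.
- by field; rewrite gt_eqF.
- by field; rewrite gt_eqF.
Qed.

(* Twice the area of [K] in the sector outside the hexagon. *)
Definition cap := 2 * area (K `&` @C0 R) - 1.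

Let mKC : mble (K `&` @C0 R). Proof. by apply: mbleI; [exact: hex_mble|exact: mble_C0]. Qed.
Let bKC : bdd (K `&` @C0 R). Proof. by apply: bdd_sub hex_bdd => x []. Qed.
Let C0K P : (K `&` @C0 R) P -> [/\ K P, 0 <= P.1, 0 <= P.2, P.1 <= 1 & P.2 <= 1].
Proof.
move=> [KP]; rewrite /C0 /cone /cross /= => -[h1 h2].
have p1 : 0 <= P.1 by lra.
have p2 : 0 <= P.2 by lra.
by have [] := hex_box KP p1 p2.
Qed.

Lemma cap_ge0 : 0 <= cap.
Proof.
have := area_triangle hex_mble hex_bdd vK hex00 hex10 hex01.
rewrite /cross /= mul1r mul0r subr0 => /(_ ler01); rewrite -/(@C0 R) /cap; lra.
Qed.

(** The sector of [K] lies in the part of the unit square below the line x + y = 1 + t, a polygon of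
    area (1 + 2 t - t^2)/2. *)
Lemma cap_top : cap <= 2 * t - t ^+ 2.
Proof.
have t0 := top_ge0. have t1 := top_le1.
have h1 : area (trap 0 t 0 1) <= (t - 0) * (0 * (0 + t) / 2 + 1) by apply: area_trap_le; lra.
have := @area_trap_le t 1 (-1) (1 + t) t1 => h2.
have {}h2 : area (trap t 1 (-1) (1 + t)) <= (1 - t) * (-1 * (t + 1) / 2 + (1 + t)) by apply: h2; lra.
have h : area (K `&` @C0 R) <= area (trap 0 t 0 1) + area (trap t 1 (-1) (1 + t)).
  apply: area_subadd => //; [exact: mble_trap|exact: mble_trap|exact: bdd_trap|exact: bdd_trap|].
  move=> P /C0K[KP p1 p2 q1 q2].
  have := ht.2 P KP p1 p2.
  have [h|h] := lerP P.1 t; [left|right]; rewrite /trap /=; split; lra.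
move: h h1 h2; rewrite /cap; move: (area _) (area _) (area _) => x y z.
by rewrite expr2; nra.
Qed.

Lemma cap_le1 : cap <= 1.
Proof. by have := cap_top; have := sqr_ge0 (t - 1); rewrite sqrrB; lra. Qed.

End HexBody.

(** The two sectors share the vertex (0,1), and one supporting line there cuts both small triangles:
    it leaves caps of at most 1 - s and s. *)
Lemma cap_pair K : hexbody K -> cap K + cap (rotk 1 K) <= 1.
Proof.
move=> hK; have [s [s0 s1 H]] := hex_supp1 hK.
have hK1 := hexbody_rotk 1 hK.
have mC A : mble A -> mble (A `&` @C0 R) by move=> mA; apply: mbleI => //; exact: mble_C0.
have h3 := @area_trap_le 0 1 (- s) 1 ler01.
have h4 := @area_trap_le 0 1 (- (1 - s)) 1 ler01.
have {}h3 : area (trap 0 1 (- s) 1) <= (1 - 0) * (- s * (0 + 1) / 2 + 1) by apply: h3; lra.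
have {}h4 : area (trap 0 1 (- (1 - s)) 1) <= (1 - 0) * (- (1 - s) * (0 + 1) / 2 + 1) by apply: h4; lra.
have h1 : area (K `&` @C0 R) <= area (trap 0 1 (- s) 1).
  apply: area_mono; [by apply: mC; exact: hex_mble|exact: mble_trap|exact: bdd_trap|].
  move=> P [KP]; rewrite /C0 /cone /cross /= => -[p2 p1].
  have q1 : 0 <= P.1 by lra.
  have q2 : 0 <= P.2 by lra.
  by have := hex_box hK KP q1 q2; have := H P KP; rewrite /trap /= => ? [? ?]; split; lra.
have h2 : area (rotk 1 K `&` @C0 R) <= area (trap 0 1 (- (1 - s)) 1).
  rewrite -(lam2_swap_area (mble_trap _ _ _ _) (bdd_trap _ _ _ _)).
  apply: area_mono; [by apply: mC; exact: hex_mble|by apply: mble_swap; exact: mble_trap| |].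
    have [M HM] := @bdd_trap 0 1 (- (1 - s)) 1.
    by exists M => x /HM[].
  move=> P [KP]; rewrite /C0 /cone /cross /= => -[p2 p1].
  have q1 : 0 <= P.1 by lra.
  have q2 : 0 <= P.2 by lra.
  have := hex_box hK1 KP q1 q2; have := H _ KP; rewrite /trap /rot /= => ? [? ?]; split; lra.
move: h1 h2 h3 h4; rewrite /cap; move: (area _) (area _) (area _) (area _) => x y z w *.
by clear H; lra.
Qed.

End Caps.

(** * Overlap within one sector *)

Section Sector.
Variable R : realType.
Implicit Types (A K S : set (R * R)) (P Q x : R * R).

Lemma area_triangle_scaled S P Q (s r : R) : mble S -> bdd S -> convex_set2 S -> S (0, 0) ->
  0 < s -> 0 < r -> S (s * P.1, s * P.2) -> S (r * Q.1, r * Q.2) ->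
  0 <= cross P Q -> s * r * cross P Q / 2 <= area (S `&` cone P Q).
Proof.
move=> mS bS cS S0 s0 r0 SP SQ PQ.
have -> : cone P Q = cone (s * P.1, s * P.2) (r * Q.1, r * Q.2).
  apply/seteqP; split => x; rewrite /cone /cross /= => -[h1 h2]; split.
  - by rewrite -!mulrA -mulrBr pmulr_rgt0.
  - by rewrite mulrCA [x.2 * _]mulrCA -mulrBr pmulr_rge0.
  - by move: h1; rewrite -!mulrA -mulrBr pmulr_rgt0.
  - by move: h2; rewrite mulrCA [x.2 * _]mulrCA -mulrBr pmulr_rge0.
have e : s * r * cross P Q = cross (s * P.1, s * P.2) (r * Q.1, r * Q.2).
  by rewrite /cross /=; ring.
by rewrite e; apply: area_triangle => //; rewrite -e !mulr_ge0// ltW.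
Qed.

(** A fan of four triangles with apex 0, spanned by the directions (1,0), (1 + a, b), (a, b), (a, 1
    + b), (0,1). For b = 0 the first two degenerate, and [hb] lets the other two carry the bound. *)
Lemma area_sector S (a b l m n z l' : R) : mble S -> bdd S -> convex_set2 S ->
  0 < a -> 0 <= b -> 0 < l -> 0 < m -> 0 < n -> 0 < z -> 0 < l' ->
  (b = 0 -> a = 1 /\ m <= l) ->
  S (0, 0) -> S (l, 0) -> S (n * (1 + a), n * b) -> S (m * a, m * b) ->
  S (z * a, z * (1 + b)) -> S (0, l') ->
  ((l + m) * (n * b) + a * z * (m + l')) / 2 <= area (S `&` @C0 R).
Proof.
move=> mS bS cS a0 b0 l0 m0 n0 z0 l'0 hb S0 Sl Sn Sm Sz Sl'.
have ta (p q r s u v c : R) : 0 < u -> 0 < v -> S (u * p, u * q) -> S (v * r, v * s) ->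
    p * s - q * r = c -> 0 <= c -> u * v * c / 2 <= area (S `&` cone (p, q) (r, s)).
  by move=> u0 v0 h1 h2 <- h3; apply: (@area_triangle_scaled S (p, q) (r, s) u v).
have sp (p q r s u v c d e : R) : p * s - q * r = c -> r * v - s * u = d -> p * v - q * u = e ->
    0 < c -> 0 < d -> 0 < e ->
    area (S `&` cone (p, q) (r, s)) + area (S `&` cone (r, s) (u, v)) <= area (S `&` cone (p, q) (u, v)).
  by move=> <- <- <- *; apply: (@area_cone_split _ S (p, q) (r, s) (u, v)).
have Sl1 : S (l * 1, l * 0) by rewrite mulr1 mulr0.
have Sl1' : S (l' * 0, l' * 1) by rewrite mulr1 mulr0.
have b1 : 0 < 1 + b by rewrite ltr_wpDr.
have t4 : z * l' * a / 2 <= area (S `&` cone (a, 1 + b) (0, 1)).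
  by apply: ta => //; [ring|exact: ltW].
have s3 : area (S `&` cone (1, 0) (a, 1 + b)) + area (S `&` cone (a, 1 + b) (0, 1)) <= area (S `&` @C0 R).
  by apply: (sp 1 0 a (1 + b) 0 1 (1 + b) a 1) => //; ring.
move: b0; rewrite le_eqVlt => /predU1P[be|b0].
  have [a1 ml] := hb (esym be); rewrite -be mulr0 mulr0 add0r.
  have t1 : l * z * (1 + b) / 2 <= area (S `&` cone (1, 0) (a, 1 + b)).
    by apply: ta => //; [ring|exact: ltW].
  have mz : z * m / 2 <= l * z * (1 + b) / 2.
    by rewrite ler_pM2r// -be addr0 mulr1 [z * m]mulrC ler_pM2r.
  apply: le_trans s3; apply: le_trans (lerD (le_trans mz t1) t4).
  have e : a * z * (m + l') / 2 = z * m / 2 + z * l' * a / 2 by rewrite a1; field.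
  by rewrite e.
have t1 : l * n * b / 2 <= area (S `&` cone (1, 0) (1 + a, b)).
  by apply: ta => //; [ring|exact: ltW].
have t2 : n * m * b / 2 <= area (S `&` cone (1 + a, b) (a, b)).
  by apply: ta => //; [ring|exact: ltW].
have t3 : m * z * a / 2 <= area (S `&` cone (a, b) (a, 1 + b)).
  by apply: ta => //; [ring|exact: ltW].
have s1 : area (S `&` cone (1, 0) (1 + a, b)) + area (S `&` cone (1 + a, b) (a, b)) <= area (S `&` cone (1, 0) (a, b)).
  by apply: (sp 1 0 (1 + a) b a b b b b) => //; ring.
have s2 : area (S `&` cone (1, 0) (a, b)) + area (S `&` cone (a, b) (a, 1 + b)) <= area (S `&` cone (1, 0) (a, 1 + b)).
  by apply: (sp 1 0 a b a (1 + b) b a (1 + b)) => //; ring.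
have lin (A1 A2 A3 A4 A12 A123 A u1 u2 u3 u4 : R) : u1 <= A1 -> u2 <= A2 -> u3 <= A3 -> u4 <= A4 ->
    A1 + A2 <= A12 -> A12 + A3 <= A123 -> A123 + A4 <= A -> u1 + u2 + u3 + u4 <= A by clear; lra.
by apply: le_trans (lin _ _ _ _ _ _ _ _ _ _ _ t1 t2 t3 t4 s1 s2 s3); apply: eq_ler; field.
Qed.

(* For a^2 + ab + b^2 = 1 these are the reflections that preserve the quadratic form x^2 + xy + y^2. *)
Definition gmap (a b : R) x : R * R := (a * x.2 - b * x.1, b * x.2 + (a + b) * x.1).

Lemma gmap_affmap a b : gmap a b = affmap (- b) a 0 (a + b) b 0.
Proof. by apply/funext => -[x y]; rewrite /gmap /affmap /=; congr pair; ring. Qed.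

Definition gsym a b K : set (R * R) := [set x | K x /\ K (gmap a b x)].

(** A reflection g satisfies the dihedral relation [rot] g [rot] = g, so the overlap in sector k
    compares sector k of [K] with sector 6 - k. *)
Lemma rotk_gsym a b K (k : nat) : (k <= 6)%N ->
  rotk k (gsym a b K) = [set x | rotk k K x /\ rotk (6 - k) K (gmap a b x)].
Proof.
move=> k6; apply/seteqP; rewrite /gsym /rotk.
have e x : gmap a b (iter k (@rot R) x) = iter (6 - k) (@rot R) (gmap a b x).
  have e1 y : iter k (@rot R) (gmap a b (iter k (@rot R) y)) = gmap a b y.
    elim: k y {k6} => [//|k IH] y; rewrite iterS iterSr.
    have -> : @rot R (iter k (@rot R) (gmap a b (iter k (@rot R) (rot y)))) = rot (gmap a b (rot y)) by rewrite IH.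
    by rewrite /rot /gmap /=; congr pair; ring.
  rewrite -[LHS]iter6_rot -[in LHS](subnK k6) iterD.
  by rewrite e1.
by split => x /=; rewrite e.
Qed.

Lemma scale_hull K (x y s : R) : hexbody K -> 0 <= s -> s <= 1 -> K (x, y) -> K (s * x, s * y).
Proof.
move=> hK s0 s1 Kxy; have [_ vK _] := hK.
have := vK _ _ Kxy (hex00 hK) s s0 s1.
by rewrite /=; congr K; congr pair; ring.
Qed.

(* [mu_] and [ze_] say how far the convex hull of the unit triangle and a point at height [1 + t] reaches in the
   directions (a, b) and (a, 1 + b). *)
Definition mu_ (a b t : R) : R := Num.min 1 ((a + b - t * b)^-1).
Definition ze_ (a b t : R) : R := (1 + a + b - t * a)^-1.

(** The five points for [area_sector] come from the action of the reflection on their rays: (1,0)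
    goes to the next sector of [K2], whence [t3]; (a, b) and (0,1) are exchanged; (a, 1 + b) is on
    the axis and needs the smaller of two heights; on the ray of (1 + a, b) only the hexagon is
    used. *)
Lemma area_gsym_sector (a b : R) (K1 K2 : set (R * R)) (t1 t2 t3 : R) : hexbody K1 -> hexbody K2 ->
  is_top K1 t1 -> is_top K2 t2 -> is_top (rotk 1 K2) t3 ->
  0 <= b -> b <= a -> a ^+ 2 + a * b + b ^+ 2 = 1 ->
  ((mu_ a b t3 + mu_ a b t1) * (b / (1 + a + b)) +
    a * ze_ a b (Num.min t1 t2) * (mu_ a b t1 + mu_ a b t2)) / 2
   <= area ([set x | K1 x /\ K2 (gmap a b x)] `&` @C0 R).
Proof.
move=> h1 h2 p1 p2 p3 b0 ba ab1.
have h3 := hexbody_rotk 1 h2.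
have a0 : 0 < a.
  rewrite lt_neqAle (le_trans b0 ba) andbT; apply/eqP => a0.
  have b_0 : b = 0 by apply/eqP; rewrite eq_le b0 a0 ba.
  by move: ab1; rewrite -a0 b_0 => /eqP; rewrite expr2 !mul0r !addr0 eq_sym oner_eq0.
set S := [set x | K1 x /\ K2 (gmap a b x)].
have Sd : - b * b - a * (a + b) != 0.
  have -> : - b * b - a * (a + b) = - 1 by rewrite -ab1; ring.
  by rewrite oppr_eq0 oner_eq0.
have SE : S = K1 `&` gmap a b @^-1` K2 by [].
have cS : convex_set2 S.
  rewrite SE gmap_affmap; apply: convexI; first by case: h1.
  by apply: convex_affmap; case: h2.
have mS : mble S.
  rewrite SE gmap_affmap; apply: mbleI; first exact: hex_mble.
  by apply: mble_affmap => //; exact: hex_mble.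
have bS : bdd S by apply: bdd_sub (hex_bdd h1) => x [].
have [t10 t20 t30] : [/\ 0 <= t1, 0 <= t2 & 0 <= t3].
  by split; [exact: top_ge0 p1|exact: top_ge0 p2|exact: top_ge0 p3].
have [t11 t21 t31] : [/\ t1 <= 1, t2 <= 1 & t3 <= 1].
  by split; [exact: top_le1 p1|exact: top_le1 p2|exact: top_le1 p3].
have dmu (t : R) : 0 <= t -> t <= 1 -> 0 < a + b - t * b.
  by move=> t0 t1'; have := ler_wpM2r b0 t1'; lra.
have mu0 (t : R) : 0 <= t -> t <= 1 -> 0 < mu_ a b t.
  by move=> t0 t1'; rewrite /mu_ lt_min ltr01 invr_gt0 dmu.
have mu1 t : mu_ a b t <= 1 by rewrite /mu_ ge_min lexx.
have mu2 t : 0 <= t -> t <= 1 -> mu_ a b t * (a + b - t * b) <= 1.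
  move=> t0 t1'; have d := dmu t t0 t1'.
  by rewrite -ler_pdivlMr// div1r /mu_ ge_min lexx orbT.
have memK K t : hexbody K -> is_top K t -> K (mu_ a b t * a, mu_ a b t * b).
  move=> hK pK; have t0 := top_ge0 hK pK; have t_1 := top_le1 hK pK.
  have m0 := mu0 t t0 t_1; have m2 := mu2 t t0 t_1.
  have e1 : 0 <= mu_ a b t * ((a - b) * t) by rewrite !mulr_ge0 ?(ltW m0)// subr_ge0.
  apply: (top_hull hK pK); rewrite ?mulr_ge0 ?(ltW m0)// ?(ltW a0)//; lra.
have zmin (t : R) : 0 <= Num.min t1 t2 -> Num.min t1 t2 <= t -> t <= 1 ->
    ze_ a b (Num.min t1 t2) * (1 + a + b - t * a) <= 1.
  move=> q0 q1 q2.
  have q3 : t * a <= a by rewrite ler_piMl// ltW.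
  have q4 : Num.min t1 t2 * a <= t * a by rewrite ler_pM2r.
  have d : 0 < 1 + a + b - Num.min t1 t2 * a by lra.
  by rewrite /ze_ mulrC ler_pdivrMr// mul1r; lra.
have m0 : 0 <= Num.min t1 t2 by rewrite le_min t10.
have z0 : 0 < ze_ a b (Num.min t1 t2).
  rewrite /ze_ invr_gt0; have q : Num.min t1 t2 <= 1 by rewrite ge_min t11.
  have q' : Num.min t1 t2 * a <= a by rewrite ler_piMl// ltW.
  by clear -q' b0; lra.
have n0 : 0 < (1 + a + b)^-1 by rewrite invr_gt0; clear -a0 b0; lra.
have memZ K t : hexbody K -> is_top K t -> Num.min t1 t2 <= t ->
    K (ze_ a b (Num.min t1 t2) * a, ze_ a b (Num.min t1 t2) * (1 + b)).
  move=> hK pK mt; have t0 := top_ge0 hK pK; have t_1 := top_le1 hK pK.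
  have z2 := zmin t m0 mt t_1.
  have e1 : 0 <= ze_ a b (Num.min t1 t2) * (t * (1 + b - a)).
    have : a <= 1 + b.
      have : 0 <= a * b by rewrite mulr_ge0// ltW.
      have : 0 <= b ^+ 2 by exact: sqr_ge0.
      move=> u1 u2.
      have u3 : a ^+ 2 <= 1 by clear -u1 u2 ab1; lra.
      have u4 : a <= 1 by rewrite -(@expr_le1 _ 2)// ltW.
      by clear -u4 b0; lra.
    by move=> u; rewrite !mulr_ge0 ?(ltW z0)//; clear -u; lra.
  by apply: (top_hull hK pK); rewrite ?mulr_ge0 ?(ltW z0)// ?(ltW a0)//; clear -e1 z2 b0; lra.
have memN K t : hexbody K -> is_top K t -> K ((1 + a + b)^-1 * (1 + a), (1 + a + b)^-1 * b).
  move=> hK pK; have t0 := top_ge0 hK pK.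
  have e : (1 + a + b)^-1 * (1 + a) + (1 + a + b)^-1 * b = 1 by field; lra.
  have e1 : 0 <= (1 + a + b)^-1 * (1 + a) by rewrite mulr_ge0 ?(ltW n0)//; lra.
  have e2 : 0 <= (1 + a + b)^-1 * b by rewrite mulr_ge0 ?(ltW n0).
  have e3 := mulr_ge0 t0 e1. have e4 := mulr_ge0 t0 e2.
  by apply: (top_hull hK pK) => //; lra.
have Kr (x y : R) : rotk 1 K2 (x, y) -> K2 (- y, x + y) by [].
rewrite [b / _]mulrC.
apply: (@area_sector S a b (mu_ a b t3) (mu_ a b t1) (1 + a + b)^-1 (ze_ a b (Num.min t1 t2)) (mu_ a b t2)) => //; rewrite ?mu0//.
- move=> be; split; last first.
    rewrite /mu_ be !mulr0 !addr0 !subr0.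
    by [].
  move: ab1; rewrite be mulr0 expr0n /= !addr0 => /eqP; rewrite sqrf_eq1 => /orP[/eqP//|/eqP h].
  by move: a0; rewrite h ltr0N1.
- split; first exact: hex00.
  by rewrite /gmap /= !mulr0 subr0 addr0; exact: hex00.
- split.
    by have := scale_hull h1 (ltW (mu0 _ t30 t31)) (mu1 t3) (hex10 h1); rewrite mulr1 mulr0.
  have := Kr _ _ (memK _ _ h3 p3); rewrite /gmap /=.
  by congr K2; congr pair; ring.
- split; first exact: (memN _ _ h1 p1).
  have := Kr _ _ (memN _ _ h3 p3); rewrite /gmap /=.
  congr K2; congr pair; first by ring.
  transitivity ((1 + a + b)^-1 * (1 + a + b)); first by ring.
  transitivity ((1 + a + b)^-1 * ((a ^+ 2 + a * b + b ^+ 2) + a + b)); last by ring.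
  by rewrite ab1.
- split; first exact: memK.
  have := scale_hull h2 (ltW (mu0 _ t10 t11)) (mu1 t1) (hex01 h2); rewrite /gmap /=.
  congr K2; congr pair; first by ring.
  transitivity (mu_ a b t1 * (a ^+ 2 + a * b + b ^+ 2)); last by ring.
  by rewrite ab1.
- split; first by apply: (memZ _ _ h1 p1); rewrite ge_min lexx.
  have := memZ _ _ h2 p2; rewrite ge_min lexx orbT => /(_ isT); rewrite /gmap /=.
  congr K2; congr pair; first by ring.
  transitivity (ze_ a b (Num.min t1 t2) * ((a ^+ 2 + a * b + b ^+ 2) + b)); last by ring.
  by rewrite ab1.
- split.
    by have := scale_hull h1 (ltW (mu0 _ t20 t21)) (mu1 t2) (hex01 h1); rewrite mulr1 mulr0.
  have := memK _ _ h2 p2; rewrite /gmap /=.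
  by congr K2; congr pair; ring.
Qed.

End Sector.

(** * Summation over the six sectors *)

Section Normalized.
Variable R : realType.
Implicit Types (A K S : set (R * R)) (P Q x : R * R).

Lemma is_top_uniq K t u : is_top K t -> is_top K u -> t = u :> R.
Proof.
move=> [[P [KP p1 p2 ep]] Ht] [[Q [KQ q1 q2 eq]] Hu].
by have := Ht _ KQ q1 q2; have := Hu _ KP p1 p2; lra.
Qed.

(** The half-angle substitution: w is sqrt 3 times the tangent of half the angle of rotation, which
    makes a and b rational. At 30 degrees w = 2 sqrt 3 - 3, slightly below 13/28. *)
Lemma rotation_param (a b : R) : 0 <= b -> b <= a -> a ^+ 2 + a * b + b ^+ 2 = 1 ->
  exists w : R, [/\ 0 <= w, w <= 13 / 28, a = (3 - 2 * w - w ^+ 2) / (3 + w ^+ 2) & b = 4 * w / (3 + w ^+ 2)].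
Proof.
move=> b0 ba ab1.
have [u uE] : exists u, u = 2 * a + b by eexists.
have u0 : 0 <= u by rewrite uE; lra.
have ub : 3 * b ^+ 2 = (2 - u) * (2 + u).
  transitivity (4 * (a ^+ 2 + a * b + b ^+ 2) - u ^+ 2); first by rewrite uE; ring.
  by rewrite ab1; ring.
have u2 : 0 < 2 + u by lra.
exists (3 * b / (2 + u)).
have ww : (3 * b / (2 + u)) ^+ 2 = 3 * (2 - u) / (2 + u).
  transitivity (3 * (3 * b ^+ 2) / (2 + u) ^+ 2); first by field; rewrite gt_eqF.
  by rewrite ub; field; rewrite gt_eqF.
have w3 : 3 + (3 * b / (2 + u)) ^+ 2 = 12 / (2 + u) by rewrite ww; field; rewrite gt_eqF.
split.
- by rewrite divr_ge0 ?mulr_ge0// ltW.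
- rewrite leNgt; apply/negP => h.
  have w0 : 0 <= 3 * b / (2 + u) by rewrite divr_ge0 ?mulr_ge0// ltW.
  have : (13 / 28) ^+ 2 < (3 * b / (2 + u)) ^+ 2 by rewrite ltrXn2r//; lra.
  have hb : 3 * b / (2 + u) * (2 + u) = 3 * b by field; rewrite gt_eqF.
  have hw : 3 * b / (2 + u) * 3 + 3 * (2 - u) / (2 + u) * 3 / 2 - 9 / 2 = 9 * (b - u) / (2 + u) by field; rewrite gt_eqF.
  have hbu : 9 * (b - u) / (2 + u) <= - 6 * (3 * b / (2 + u)).
    have -> : - 6 * (3 * b / (2 + u)) = 9 * (- 2 * b) / (2 + u) by field; rewrite gt_eqF.
    by rewrite ler_pM2r ?invr_gt0// uE; lra.
  by rewrite ww; move: h hw hbu; rewrite expr2; lra.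
- by rewrite w3 ww; field: uE; rewrite ?gt_eqF//; lra.
- by rewrite w3; field; rewrite gt_eqF.
Qed.

(** Over the six sectors every [mut w (T k)] occurs twice in each of the two kinds of terms;
    collecting them yields half the sum of the expressions in [term_ge_Jt], to which [sum_Jt]
    applies. *)
Lemma area_gsym_ge (a b : R) K : hexbody K -> 0 <= b -> b <= a -> a ^+ 2 + a * b + b ^+ 2 = 1 ->
  41 / 59 * area K <= area (gsym a b K).
Proof.
move=> hK b0 ba ab1.
have [w [w0 w1 aE bE]] := rotation_param b0 ba ab1.
have w3 : 3 + w ^+ 2 != 0 by rewrite gt_eqF// ltr_wpDr ?sqr_ge0.
have w3' : 3 + w != 0 by rewrite gt_eqF// ltr_wpDr.
have s1 : b / (1 + a + b) = 2 * w / (3 + w).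
  have e : 1 + a + b = 2 * (3 + w) / (3 + w ^+ 2) by rewrite aE bE; field.
  by rewrite e bE; field; rewrite w3'.
have muE t : mu_ a b t = mut w t.
  rewrite /mu_ /mut; congr Num.min; rewrite -[RHS]invrK invf_div; congr (_^-1).
  by rewrite aE bE; field.
have zeE t : a * ze_ a b t = (1 - w) / 2 * rt w t.
  have e : a = (1 - w) * (3 + w) / (3 + w ^+ 2) by rewrite aE; field.
  have e2 : 1 + a + b - t * a = (3 + w) / (3 + w ^+ 2) * (2 - t * (1 - w)).
    by rewrite aE bE; field.
  rewrite /ze_ /rt e2 !invfM invrK [in LHS]e.
  move: (2 - t * (1 - w))^-1 => v.
  by field; rewrite w3' w3.
have hT k : {t | is_top (rotk k K) t} := cid (hex_top (hexbody_rotk k hK)).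
pose T k := sval (hT k).
have topT k : is_top (rotk k K) (T k) := svalP (hT k).
have T6 : T 6%N = T 0%N.
  by apply: (@is_top_uniq K); [rewrite -{1}(rotk6 K); exact: topT|exact: (topT 0%N)].
have T7 : T 7%N = T 1%N.
  apply: (@is_top_uniq (rotk 1 K)); last exact: topT.
  by rewrite -{1}(rotk6 K) rotk_rotk; exact: topT.
have sec k : (k <= 6)%N ->
    ((mut w (T (7 - k)%N) + mut w (T k)) * (2 * w / (3 + w)) +
      (1 - w) / 2 * rt w (Num.min (T k) (T (6 - k)%N)) * (mut w (T k) + mut w (T (6 - k)%N))) / 2
      <= area (rotk k (gsym a b K) `&` @C0 R).
  move=> k6; rewrite (rotk_gsym _ _ _ k6) -!muE -zeE -s1.
  apply: area_gsym_sector => //; try exact: hexbody_rotk.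
  by rewrite rotk_rotk add1n -subSn//; exact: topT.
have S0 := sec 0%N isT. have S1 := sec 1%N isT. have S2 := sec 2%N isT.
have S3 := sec 3%N isT. have S4 := sec 4%N isT. have S5 := sec 5%N isT.
move: S0 S1 S2 S3 S4 S5; rewrite !subn0 ?T6 ?T7 /=.
change (7 - 2)%N with 5%N; change (7 - 3)%N with 4%N; change (7 - 4)%N with 3%N; change (7 - 5)%N with 2%N.
change (6 - 1)%N with 5%N; change (6 - 2)%N with 4%N; change (6 - 3)%N with 3%N; change (6 - 4)%N with 2%N;
  change (6 - 5)%N with 1%N.
rewrite ?T6 ?T7 [Num.min (T 5%N) _]minC [Num.min (T 4%N) _]minC !minxx => S0 S1 S2 S3 S4 S5.
have T_ge0 k : 0 <= T k := top_ge0 (hexbody_rotk k hK) (topT k).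
have T_le1 k : T k <= 1 := top_le1 (hexbody_rotk k hK) (topT k).
have m15 : 0 <= Num.min (T 1%N) (T 5%N) by rewrite le_min !T_ge0.
have m24 : 0 <= Num.min (T 2%N) (T 4%N) by rewrite le_min !T_ge0.
have J k p (p0 : 0 <= p) (pk : p <= T k) := term_ge_Jt w0 w1 p0 pk (T_le1 k).
have ml (x y : R) : Num.min x y <= x by rewrite ge_min lexx.
have mr (x y : R) : Num.min x y <= y by rewrite ge_min lexx orbT.
have J0 := J 0%N _ (T_ge0 _) (lexx _); have J3 := J 3%N _ (T_ge0 _) (lexx _).
have J1 := J 1%N _ m15 (ml _ _); have J5 := J 5%N _ m15 (mr _ _).
have J2 := J 2%N _ m24 (ml _ _); have J4 := J 4%N _ m24 (mr _ _).
pose c k := cap (rotk k K).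
have cp k : c k + c k.+1 <= 1.
  by have := cap_pair (hexbody_rotk k hK); rewrite rotk_rotk.
have c6 : c 6%N = c 0%N by rewrite /c rotk6.
have cH k : [/\ 0 <= T k, T k <= 1, 0 <= c k, c k <= 1 & c k <= 2 * T k - T k ^+ 2].
  have hk := hexbody_rotk k hK.
  by split => //; [exact: cap_ge0|exact: (cap_le1 hk (topT k))|exact: (cap_top hk (topT k))].
have SJ : 41 / 59 * (6 + (c 0%N + c 1%N + c 2%N + c 3%N + c 4%N + c 5%N)) <=
  Jt (T 0%N) (T 0%N) + Jt (T 3%N) (T 3%N) + Jt (T 1%N) (Num.min (T 1%N) (T 5%N)) + Jt (T 5%N) (Num.min (T 1%N) (T 5%N))
   + Jt (T 2%N) (Num.min (T 2%N) (T 4%N)) + Jt (T 4%N) (Num.min (T 2%N) (T 4%N)).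
  apply: (sum_Jt _ (cp 0%N) (cp 1%N) (cp 2%N) (cp 3%N) (cp 4%N)).
    move=> t u; rewrite !inE.
    do 5 (case/orP; first by case/eqP => -> ->; exact: cH).
    by case/eqP => -> ->; exact: cH.
  by have := cp 5%N; rewrite c6.
have aK : area K = 1 / 2 * (6 + (c 0%N + c 1%N + c 2%N + c 3%N + c 4%N + c 5%N)).
  rewrite (area_sectors (hex_mble hK) (hex_bdd hK)) !big_ord_recr big_ord0 /= add0r /c /cap.
  move: (area _) (area _) (area _) (area _) (area _) (area _) => *.
  by clear; lra.
have mG : mble (gsym a b K).
  have Sd : - b * b - a * (a + b) != 0.
    have -> : - b * b - a * (a + b) = - 1 by rewrite -ab1; ring.
    by rewrite oppr_eq0 oner_eq0.
  apply: (@mbleI _ K (gmap a b @^-1` K)); first exact: hex_mble.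
  by rewrite gmap_affmap; apply: mble_affmap => //; exact: hex_mble.
have bG : bdd (gsym a b K) by apply: bdd_sub (hex_bdd hK) => x [].
rewrite aK (area_sectors mG bG) !big_ord_recr big_ord0 /= add0r.
have w2E : 4 * w / (3 + w) = 2 * (2 * w / (3 + w)) by field.
move: J0 J1 J2 J3 J4 J5 SJ S0 S1 S2 S3 S4 S5.
rewrite w2E.
move: (2 * w / (3 + w)) (rt w _) (rt w _) (rt w _) (rt w _) (Jt _ _) (Jt _ _) (Jt _ _) (Jt _ _) (Jt _ _) (Jt _ _)
  (mut w _) (mut w _) (mut w _) (mut w _) (mut w _) (mut w _) (area _) (area _) (area _) (area _) (area _) (area _)
  (c _ + _ + _ + _ + _ + _).
clear; move=> *; lra.
Qed.

End Normalized.

(** * Inscribed affinely regular hexagons *)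

Section Interior.
Variable R : realType.
Implicit Types (K : set (R * R)) (P Q x : R * R).

Lemma interiorP K x : K^° x <-> exists2 r : R, 0 < r & forall P, `|P.1 - x.1| < r -> `|P.2 - x.2| < r -> K P.
Proof.
split.
  rewrite /interior -nbhs_ballE => -[r /= r0 H]; exists r => // P h1 h2; apply: H.
  by split => /=; rewrite /ball /= distrC.
move=> [r r0 H]; rewrite /interior -nbhs_ballE; exists r => // P [/= h1 h2].
by apply: H; rewrite distrC.
Qed.

(** The homothety with centre [Q] and ratio t carries a neighbourhood of [P] inside [K] to one of
    the new point. *)
Lemma interior_seg K P Q (t : R) : convex_set2 K -> K^° P -> K Q -> 0 < t -> t <= 1 ->
  K^° (t * P.1 + (1 - t) * Q.1, t * P.2 + (1 - t) * Q.2).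
Proof.
move=> vK /interiorP[r r0 H] KQ t0 t1; apply/interiorP; exists (t * r); first exact: mulr_gt0.
move=> X /= h1 h2.
have tn : t != 0 by rewrite gt_eqF.
have e (x p q : R) : t * (p + (x - (t * p + (1 - t) * q)) / t) + (1 - t) * q = x by field.
have KP : K (P.1 + (X.1 - (t * P.1 + (1 - t) * Q.1)) / t, P.2 + (X.2 - (t * P.2 + (1 - t) * Q.2)) / t).
  by apply: H => /=; rewrite addrAC subrr add0r normrM normfV (gtr0_norm t0) ltr_pdivrMr// [r * t]mulrC.
by have := vK _ _ KP KQ t (ltW t0) t1; rewrite /= !e -surjective_pairing.
Qed.

Definition bd K : set (R * R) := K `\` K^°.

Lemma closed_bd K : closed K -> closed (bd K).
Proof.
move=> cK; rewrite /bd setDE; apply: closedI => //.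
by apply: open_closedC; exact: open_interior.
Qed.

(* Among the points of [K] on a line through [x] and an interior point, those beyond [x] would make [x] interior;
   hence the slopes, seen from [x], of points on the two sides of that line are separated. *)
Lemma support_line K x : convex_set2 K -> K^° !=set0 -> bd K x ->
  exists p q : R, (p != 0 \/ q != 0) /\ forall P, K P -> p * (P.1 - x.1) + q * (P.2 - x.2) <= 0.
Proof.
move=> vK [c Kc] [Kx nx].
have [q1 q1E] : exists q1, q1 = c.1 - x.1 by eexists.
have [q2 q2E] : exists q2, q2 = c.2 - x.2 by eexists.
pose u P := q1 * (P.2 - x.2) - q2 * (P.1 - x.1).
pose v P := q1 * (P.1 - x.1) + q2 * (P.2 - x.2).
have qq : 0 < q1 ^+ 2 + q2 ^+ 2.
  rewrite lt_neqAle addr_ge0 ?sqr_ge0// andbT eq_sym paddr_eq0 ?sqr_ge0// !sqrf_eq0.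
  apply/negP => /andP[/eqP h1 /eqP h2]; apply: nx.
  have -> : x = c.
    by rewrite [x]surjective_pairing [c]surjective_pairing; congr pair; lra.
  exact: Kc.
have key M : K M -> u M = 0 -> 0 <= v M.
  move=> KM uM; rewrite leNgt; apply/negP => vM; apply: nx.
  have [s sE] : exists s, s = q1 ^+ 2 + q2 ^+ 2 by eexists.
  rewrite -sE in qq.
  have sv : 0 < s - v M by rewrite subr_gt0 (lt_trans vM).
  pose t := - v M / (s - v M).
  have t0 : 0 < t by rewrite divr_gt0// oppr_gt0.
  have t1 : t <= 1 by rewrite ler_pdivrMr// mul1r; lra.
  have h1 : s * (M.1 - x.1) = q1 * v M.
    transitivity (q1 * v M - q2 * u M); last by rewrite uM mulr0 subr0.
    by rewrite sE /v /u; ring.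
  have h2 : s * (M.2 - x.2) = q2 * v M.
    transitivity (q2 * v M + q1 * u M); last by rewrite uM mulr0 addr0.
    by rewrite sE /v /u; ring.
  have m1 : M.1 = x.1 + q1 * v M / s by rewrite -h1; field; rewrite gt_eqF.
  have m2 : M.2 = x.2 + q2 * v M / s by rewrite -h2; field; rewrite gt_eqF.
  have -> : x = (t * c.1 + (1 - t) * M.1, t * c.2 + (1 - t) * M.2).
    have c1 : c.1 = x.1 + q1 by rewrite q1E; ring.
    have c2 : c.2 = x.2 + q2 by rewrite q2E; ring.
    have sn : s != 0 by rewrite gt_eqF.
    have svn : s - v M != 0 by rewrite gt_eqF.
    rewrite c1 c2 m1 m2 /t [LHS]surjective_pairing.
    by congr pair; field; rewrite sn svn.
  exact: interior_seg.
have key2 A B : K A -> K B -> 0 < u A -> u B < 0 -> v B / u B <= v A / u A.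
  move=> KA KB uA uB.
  have uAB : 0 < u A - u B by rewrite subr_gt0 (lt_trans uB).
  pose l := - u B / (u A - u B).
  have l0 : 0 <= l by rewrite divr_ge0 ?oppr_ge0 ?(ltW uB) ?(ltW uAB).
  have l1 : l <= 1 by rewrite ler_pdivrMr// mul1r; clear -uA; lra.
  have un : u A - u B != 0 by rewrite gt_eqF.
  have KM := vK _ _ KA KB l l0 l1.
  have e1 : u (l * A.1 + (1 - l) * B.1, l * A.2 + (1 - l) * B.2) = l * u A + (1 - l) * u B.
    by rewrite /u /=; ring.
  have e2 : v (l * A.1 + (1 - l) * B.1, l * A.2 + (1 - l) * B.2) = l * v A + (1 - l) * v B.
    by rewrite /v /=; ring.
  have z : l * u A + (1 - l) * u B = 0 by rewrite /l; field.
  have := key _ KM; rewrite e1 e2 => /(_ z).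
  have -> : l * v A + (1 - l) * v B = (u A * v B - u B * v A) / (u A - u B) by rewrite /l; field.
  rewrite pmulr_lge0 ?invr_gt0// => h.
  rewrite ler_pdivlMr// mulrAC ler_ndivrMr//; lra.
(* If [K] lies on one side of the line through [x] and [c], that line itself supports it. *)
have [[B [KB uB]]|noB] := pselect (exists B, K B /\ u B < 0); last first.
  exists q2, (- q1); split.
    have [q10|q10] := eqVneq q1 0; [left|right]; last by rewrite oppr_eq0.
    by apply/eqP => q20; move: qq; rewrite q10 q20 expr0n addr0 ltxx.
  move=> P KP; have [h|h] := lerP 0 (u P); last by case: noB; exists P.
  by move: h; rewrite /u; lra.
have [[A [KA uA]]|noA] := pselect (exists A, K A /\ 0 < u A); last first.
  exists (- q2), q1; split.
    have [q10|q10] := eqVneq q1 0; [left|by right].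
    by apply/eqP => q20; move: qq; rewrite q10 -[q2]opprK q20 oppr0 expr0n addr0 ltxx.
  move=> P KP; have [h|h] := lerP (u P) 0; last by case: noA; exists P.
  by move: h; rewrite /u; lra.
pose E := [set r : R | exists B, [/\ K B, u B < 0 & r = v B / u B]].
have supE : has_sup E.
  split; first by exists (v B / u B); exists B.
  by exists (v A / u A) => _ [B' [KB' uB' ->]]; exact: key2.
have [s sE] : exists s, s = sup E by eexists.
exists (- q1 - s * q2), (- q2 + s * q1); split.
  have [h1|h1] := eqVneq (- q1 - s * q2) 0; [right|by left].
  apply/eqP => h2; move: qq.
  have -> : q1 ^+ 2 + q2 ^+ 2 = - q1 * (- q1 - s * q2) - q2 * (- q2 + s * q1) by ring.
  by rewrite h1 h2 !mulr0 subr0 ltxx.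
move=> P KP.
suff : s * u P <= v P by rewrite /u /v; lra.
have [uP|uP|uP] := ltrgtP (u P) 0.
- rewrite -ler_ndivrMr//.
  rewrite sE; apply: sup_upper_bound => //; by exists P.
- rewrite -ler_pdivlMr// sE; apply: ge_sup; first by case: supE.
  by move=> _ [B' [KB' uB' ->]]; exact: key2.
- by rewrite uP mulr0; exact: key.
Qed.

End Interior.

(* [W z l] stands for: the section at level [z] has length at least [l]. The levels [y - h, y, y + h] are those of two
   opposite sides and of the parallel diagonal of an inscribed hexagon; they are unique because the width is concave. *)
Definition extw (R : realType) (W : R -> R -> Prop) (y h a : R) :=
  [/\ 0 < a, 0 < h, W y (2 * a), W (y + h) a & W (y - h) a] /\
  ((forall l, W y l -> l <= 2 * a) /\ (forall z l, W z l -> a <= l -> y - h <= z /\ z <= y + h)).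

(** * Uniqueness for concave width functions *)

Section Widths.
Variables (R : realType) (W : R -> R -> Prop).
Hypothesis W_conv : forall z1 z2 l1 l2 t : R, W z1 l1 -> W z2 l2 -> 0 <= t -> t <= 1 ->
  W (t * z1 + (1 - t) * z2) (t * l1 + (1 - t) * l2).
Implicit Types (y h a z l : R).

(** Suppose a1 < a2; then h2 <= h1. Concavity between the levels y1 - h1 and y2 makes a1 (y2 - y1)
    at least 2 (a2 - a1) h1 ([H1]), while sections of length a2 must not lie below y2 - h2, which
    makes it at most (a2 - a1) h1 ([H2]). *)
Lemma extw_le y1 h1 a1 y2 h2 a2 : extw W y1 h1 a1 -> extw W y2 h2 a2 -> y1 <= y2 -> a2 <= a1.
Proof.
move=> [[a10 h10 A1 B1 F1] [M1 E1]] [[a20 h20 A2 B2 F2] [M2 E2]] y12.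
rewrite leNgt; apply/negP => a12.
have [_ i1] := E1 _ _ B2 (ltW a12); have [i2 _] := E1 _ _ F2 (ltW a12).
have H1 : 2 * a2 * h1 <= 2 * a1 * h1 + a1 * (y2 - y1).
  have d0 : 0 < y2 - y1 + h1 by lra.
  have dn : y2 - y1 + h1 != 0 by rewrite gt_eqF.
  have t0 : 0 <= h1 / (y2 - y1 + h1) by rewrite divr_ge0// ltW.
  have t1 : h1 / (y2 - y1 + h1) <= 1 by rewrite ler_pdivrMr// mul1r; lra.
  have := W_conv A2 F1 t0 t1.
  have -> : h1 / (y2 - y1 + h1) * y2 + (1 - h1 / (y2 - y1 + h1)) * (y1 - h1) = y1 by field.
  move=> /M1.
  have -> : h1 / (y2 - y1 + h1) * (2 * a2) + (1 - h1 / (y2 - y1 + h1)) * a1 = (h1 * (2 * a2) + (y2 - y1) * a1) / (y2 - y1 + h1) by field.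
  by rewrite ler_pdivrMr//; lra.
have [c|c] := ltP y1 (y2 - h2).
  have a21 : 2 * a1 < a2.
    by rewrite ltNge; apply/negP => /(E2 _ _ A1) [h _]; lra.
  have h3 : a1 * (y2 - y1) <= a1 * h1 by rewrite ler_pM2l//; lra.
  have h4 : 2 * a1 * h1 < a2 * h1 by rewrite ltr_pM2r.
  have h5 : 0 < a1 * h1 by rewrite mulr_gt0.
  by lra.
have H2 : a1 * (y2 - h2 - y1 + h1) <= h1 * (a2 - a1).
  have [c2|c2] := leP a2 (2 * a1).
    have an : a1 != 0 by rewrite gt_eqF.
    have t0 : 0 <= (a2 - a1) / a1 by apply: divr_ge0; lra.
    have t1 : (a2 - a1) / a1 <= 1 by rewrite ler_pdivrMr// mul1r; lra.
    have := W_conv A1 F1 t0 t1.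
    have -> : (a2 - a1) / a1 * (2 * a1) + (1 - (a2 - a1) / a1) * a1 = a2 by field.
    move=> /E2 -/(_ (lexx _)) [+ _].
    have -> : (a2 - a1) / a1 * y1 + (1 - (a2 - a1) / a1) * (y1 - h1) = y1 - h1 + (h1 * (a2 - a1)) / a1 by field.
    by rewrite -lerBlDl ler_pdivlMr//; lra.
  have h3 : 0 <= a1 * (y1 - (y2 - h2)) by rewrite mulr_ge0; lra.
  have h4 : h1 * a1 < h1 * (a2 - a1) by rewrite ltr_pM2l//; lra.
  by lra.
have h5 : a1 * h2 <= a1 * h1 by rewrite ler_pM2l//; lra.
have h6 : a1 * h1 < a2 * h1 by rewrite ltr_pM2r.
by lra.
Qed.

(** Sections of length r over a whole interval of levels keep solutions from degenerating. The
    bounds do not depend on the solution, as compactness of the set of hexagons requires. *)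
Lemma extw_bounds y h a z0 r e : extw W y h a -> 0 < r -> 0 < e ->
  (forall z, z0 - e <= z -> z <= z0 + e -> W z r) -> r / 4 <= a /\ e / 2 <= h.
Proof.
move=> [[a0 h0 A B F] [M E]] r0 e0 H.
have half : 0 <= (1 / 2 : R) /\ (1 / 2 : R) <= 1 by lra.
split; last first.
  have [c|c] := leP y z0.
    have W1 : W (z0 + e) r by apply: H; lra.
    have /E[] := W_conv A W1 half.1 half.2; lra.
  have W1 : W (z0 - e) r by apply: H; lra.
  have /E[] := W_conv A W1 half.1 half.2; lra.
have [|ar] := leP r a; first lra.
have W0 : W z0 r by apply: H; lra.
have [i1 i2] := E _ _ W0 (ltW ar).
have fin t : 0 <= t -> t <= 1 -> 1 / 2 <= t -> t * r + (1 - t) * a <= 2 * a -> r / 4 <= a.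
  move=> t0 t1 t2 h1.
  have : 0 <= (1 - t) * a by rewrite mulr_ge0; lra.
  have : 0 <= (t - 1 / 2) * r by rewrite mulr_ge0; lra.
  by lra.
have [c|c] := leP z0 y.
  have d0 : 0 < y + h - z0 by lra.
  have t0 : 0 <= h / (y + h - z0) by rewrite divr_ge0// ltW.
  have t1 : h / (y + h - z0) <= 1 by rewrite ler_pdivrMr// mul1r; lra.
  have t2 : 1 / 2 <= h / (y + h - z0) by rewrite ler_pdivlMr//; lra.
  apply: (fin _ t0 t1 t2); apply: M.
  have := W_conv W0 B t0 t1; congr W.
  by field; rewrite gt_eqF.
have d0 : 0 < z0 - (y - h) by lra.
have t0 : 0 <= h / (z0 - (y - h)) by rewrite divr_ge0// ltW.
have t1 : h / (z0 - (y - h)) <= 1 by rewrite ler_pdivrMr// mul1r; lra.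
have t2 : 1 / 2 <= h / (z0 - (y - h)) by rewrite ler_pdivlMr//; lra.
apply: (fin _ t0 t1 t2); apply: M.
have := W_conv W0 F t0 t1; congr W.
by field; rewrite gt_eqF.
Qed.

End Widths.

(** Reversing the order of levels turns [extw_le] into its opposite case, so the lengths agree; then
    each solution confines the levels of the other. *)
Lemma extw_uniq (R : realType) (W : R -> R -> Prop) (y1 h1 a1 y2 h2 a2 : R) :
  (forall z1 z2 l1 l2 t : R, W z1 l1 -> W z2 l2 -> 0 <= t -> t <= 1 ->
    W (t * z1 + (1 - t) * z2) (t * l1 + (1 - t) * l2)) ->
  extw W y1 h1 a1 -> extw W y2 h2 a2 -> [/\ y1 = y2, h1 = h2 & a1 = a2].
Proof.
move=> Wc S1 S2.
pose W' z l := W (- z) l.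
have Wc' (z1 z2 l1 l2 t : R) : W' z1 l1 -> W' z2 l2 -> 0 <= t -> t <= 1 ->
    W' (t * z1 + (1 - t) * z2) (t * l1 + (1 - t) * l2).
  rewrite /W' => w1 w2 t0 t1; have := Wc _ _ _ _ _ w1 w2 t0 t1; congr W; ring.
have refl y h a : extw W y h a -> extw W' (- y) h a.
  move=> [[a0 h0 A B F] [M E]]; rewrite /W'; split.
    by split => //; rewrite ?opprD !opprK.
  split => [l|z l]; first by rewrite opprK; exact: M.
  by move=> /E H /H; lra.
have le y h a y' h' a' : extw W y h a -> extw W y' h' a' -> a' <= a.
  move=> e1 e2; have [c|c] := leP y y'.
    exact: (extw_le Wc e1 e2 c).
  have c' : - y <= - y' by rewrite lerN2 ltW.
  exact: (extw_le Wc' (refl _ _ _ e1) (refl _ _ _ e2) c').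
have a12 : a1 = a2 by apply/eqP; rewrite eq_le (le _ _ _ _ _ _ S1 S2) (le _ _ _ _ _ _ S2 S1).
move: S1 S2; rewrite a12 => -[[a0 h10 A1 B1 F1] [M1 E1]] [[_ h20 A2 B2 F2] [M2 E2]].
have := E1 _ _ B2 (lexx _); have := E1 _ _ F2 (lexx _).
have := E2 _ _ B1 (lexx _); have := E2 _ _ F1 (lexx _).
by move=> [u1 u2] [u3 u4] [u5 u6] [u7 u8]; split => //; lra.
Qed.

(** * Chords in a fixed direction *)

Section Chords.
Variables (R : realType) (K : set (R * R)) (u : R * R).
Hypotheses (vK : convex_set2 K) (K0 : K^° !=set0) (u0 : 0 < u.1 ^+ 2 + u.2 ^+ 2).
Implicit Types (P Q A B F : R * R) (z l a h y s t : R).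

Definition lv P := u.1 * P.2 - u.2 * P.1.
Definition sh P l : R * R := (P.1 + l * u.1, P.2 + l * u.2).
(** Chords need not be maximal; the predicate takes the place of [W] in [extw]. *)
Definition chord z l := exists P, [/\ K P, K (sh P l) & lv P = z].

Lemma sh0 P : sh P 0 = P.
Proof. by rewrite /sh !mul0r !addr0 -surjective_pairing. Qed.
Lemma sh_sh P l l' : sh (sh P l) l' = sh P (l + l').
Proof. by rewrite /sh /=; congr pair; ring. Qed.
Lemma lv_sh P l : lv (sh P l) = lv P.
Proof. by rewrite /lv /sh /=; ring. Qed.

Lemma lv_eq P Q : lv P = lv Q -> exists q, Q = sh P q.
Proof.
rewrite /lv => e.
exists ((u.1 * (Q.1 - P.1) + u.2 * (Q.2 - P.2)) / (u.1 ^+ 2 + u.2 ^+ 2)).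
have un : u.1 ^+ 2 + u.2 ^+ 2 != 0 by rewrite gt_eqF.
have e1 : (u.1 * (Q.1 - P.1) + u.2 * (Q.2 - P.2)) * u.1 = (Q.1 - P.1) * (u.1 ^+ 2 + u.2 ^+ 2).
  transitivity ((Q.1 - P.1) * (u.1 ^+ 2 + u.2 ^+ 2) + u.2 * ((u.1 * Q.2 - u.2 * Q.1) - (u.1 * P.2 - u.2 * P.1))).
    by ring.
  by rewrite e subrr mulr0 addr0.
have e2 : (u.1 * (Q.1 - P.1) + u.2 * (Q.2 - P.2)) * u.2 = (Q.2 - P.2) * (u.1 ^+ 2 + u.2 ^+ 2).
  transitivity ((Q.2 - P.2) * (u.1 ^+ 2 + u.2 ^+ 2) - u.1 * ((u.1 * Q.2 - u.2 * Q.1) - (u.1 * P.2 - u.2 * P.1))).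
    by ring.
  by rewrite e subrr mulr0 subr0.
rewrite [LHS]surjective_pairing /sh; congr pair.
  by rewrite mulrAC e1 mulfK//; ring.
by rewrite mulrAC e2 mulfK//; ring.
Qed.

Lemma chord_conv z1 z2 l1 l2 t : chord z1 l1 -> chord z2 l2 -> 0 <= t -> t <= 1 ->
  chord (t * z1 + (1 - t) * z2) (t * l1 + (1 - t) * l2).
Proof.
move=> [P [KP KP' <-]] [Q [KQ KQ' <-]] t0 t1.
exists (t * P.1 + (1 - t) * Q.1, t * P.2 + (1 - t) * Q.2); split; first exact: vK.
  have := vK KP' KQ' t0 t1.
  by rewrite /sh /=; congr K; congr pair; ring.
by rewrite /lv /=; ring.
Qed.

Lemma chord_le z l l' : chord z l -> 0 <= l' -> l' <= l -> chord z l'.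
Proof.
move=> [P [KP KP' e]] l0 ll; exists P; split => //.
have [l1|l1] := lerP l 0.
  have -> : l' = 0 by lra.
  by rewrite sh0.
have := vK KP' KP (divr_ge0 l0 (ltW l1)).
rewrite ler_pdivrMr// mul1r => /(_ ll).
by rewrite /sh /=; congr K; congr pair; field; rewrite gt_eqF.
Qed.

Lemma level_interior P1 P2 y : K P1 -> K P2 -> lv P1 < y -> y < lv P2 -> exists Q, K^° Q /\ lv Q = y.
Proof.
move=> k1 k2 y1 y2; have [c Kc] := K0.
have H P : K P -> (lv P < y /\ y <= lv c) \/ (y < lv P /\ lv c <= y) -> exists Q, K^° Q /\ lv Q = y.
  move=> KP h; have lc : lv c - lv P != 0 by apply/eqP; lra.
  exists ((y - lv P) / (lv c - lv P) * c.1 + (1 - (y - lv P) / (lv c - lv P)) * P.1,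
          (y - lv P) / (lv c - lv P) * c.2 + (1 - (y - lv P) / (lv c - lv P)) * P.2); split.
    apply: interior_seg => //; case: h => -[h1 h2].
    - by apply: divr_gt0; lra.
    - by rewrite -[_ / _]mulrNN -invrN; apply: divr_gt0; lra.
    - by rewrite ler_pdivrMr ?mul1r; lra.
    - by rewrite ler_ndivrMr ?mul1r; lra.
  transitivity ((y - lv P) / (lv c - lv P) * lv c + (1 - (y - lv P) / (lv c - lv P)) * lv P).
    by move: (_ / _) => s; rewrite /lv /=; ring.
  by field.
have [h|h] := lerP y (lv c); first by apply: (H P1) => //; left.
by apply: (H P2) => //; right; split => //; exact: ltW.
Qed.

Lemma sh_interior A q r s : K^° (sh A q) -> K (sh A s) -> (q < r /\ r < s) \/ (s < r /\ r < q) -> K^° (sh A r).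
Proof.
move=> Kq Ks h.
have n : q - s != 0 by apply/eqP; lra.
have -> : sh A r = ((r - s) / (q - s) * (sh A q).1 + (1 - (r - s) / (q - s)) * (sh A s).1,
                 (r - s) / (q - s) * (sh A q).2 + (1 - (r - s) / (q - s)) * (sh A s).2).
  by rewrite /sh /=; congr pair; field.
apply: interior_seg => //; case: h => -[h1 h2].
- by rewrite -[_ / _]mulrNN -invrN; apply: divr_gt0; lra.
- by apply: divr_gt0; lra.
- by rewrite ler_ndivrMr ?mul1r; lra.
- by rewrite ler_pdivrMr ?mul1r; lra.
Qed.

(** The line meets the interior, so a point of [K] beyond a boundary point on it would make that
    point interior. *)
Lemma chord_full A b p q : 0 < b -> bd K A -> bd K (sh A b) -> K^° (sh A q) -> K (sh A p) -> 0 <= p /\ p <= b.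
Proof.
move=> b0 [KA nA] [Kb nb] Kq Kp.
rewrite -{1}(sh0 A) in KA; rewrite -(sh0 A) in nA.
have q0 : 0 < q.
  have [//|h|h] := ltrgtP 0 q; last by rewrite -h in Kq.
  by case: nA; apply: (sh_interior Kq Kb); left.
have qb : q < b.
  have [//|h|h] := ltrgtP q b; last by rewrite h in Kq.
  by case: nb; apply: (sh_interior Kq KA); right.
split; rewrite leNgt; apply/negP => h.
  by case: nA; apply: (sh_interior Kq Kp); right.
by case: nb; apply: (sh_interior Kq Kp); left.
Qed.

Lemma chord_max A b P1 P2 l : 0 < b -> bd K A -> bd K (sh A b) -> K P1 -> K P2 -> lv P1 < lv A -> lv A < lv P2 ->
  chord (lv A) l -> l <= b.
Proof.
move=> b0 bA bA' k1 k2 h1 h2 [P [KP KP' e]].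
have [Q [KQ eQ]] := level_interior k1 k2 h1 h2.
have [q qE] := lv_eq (esym eQ); have [p pE] := lv_eq (esym e).
rewrite qE in KQ; rewrite pE in KP KP'; rewrite sh_sh in KP'.
have [H1 _] := chord_full b0 bA bA' KQ KP.
have [_ H2] := chord_full b0 bA bA' KQ KP'.
lra.
Qed.

(* Top side [B, B + au], diagonal [A, A + 2au] and bottom side [F, F + au]; the three chords may still be shifted
   against each other. *)
Definition hexsol B A F a := [/\ bd K B, bd K (sh B a), bd K A, bd K (sh A (2 * a)) & bd K F] /\
  [/\ bd K (sh F a), 0 < a, lv A < lv B & lv B - lv A = lv A - lv F].

Definition extchord := extw chord.

(** Interpolation between the diagonal, of length 2 a, and a chord of length at least a beyond the
    side at [X] would give a chord longer than a at the level of that side. *)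
Lemma chord_outside A X Z a z l t : 0 < a -> bd K X -> bd K (sh X a) -> K A -> K (sh A (2 * a)) -> K Z ->
  lv Z = z -> chord z l -> a <= l -> 0 < t -> t < 1 -> lv X = t * z + (1 - t) * lv A ->
  (z < lv X /\ lv X < lv A) \/ (lv A < lv X /\ lv X < z) -> False.
Proof.
move=> a0 bX bX' KA KA' KZ eZ Wz al t0 t1 eX between.
have WA : chord (lv A) (2 * a) by exists A.
have W := chord_conv Wz WA (ltW t0) (ltW t1); rewrite -eX in W.
have H : t * l + (1 - t) * (2 * a) <= a.
  by case: between => -[h1 h2];
    [apply: (@chord_max X a Z A _ a0 bX bX' KZ KA) W|apply: (@chord_max X a A Z _ a0 bX bX' KA KZ) W]; rewrite ?eZ.
have h1 : t * a <= t * l by rewrite ler_pM2l.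
have : (1 - t) * a < (1 - t) * (2 * a) by rewrite ltr_pM2l//; lra.
lra.
Qed.

(** Boundary endpoints make the diagonal the longest chord of its level, and [chord_outside]
    excludes long chords beyond the two sides. This opens the way to [extw_uniq]. *)
Lemma hexsol_extchord B A F a : hexsol B A F a -> extchord (lv A) (lv B - lv A) a.
Proof.
move=> [[bB bC bA bD bF] [bE a0 AB e]].
have eB : lv A + (lv B - lv A) = lv B by lra.
have eF : lv A - (lv B - lv A) = lv F by lra.
split.
  split => //; first lra.
  - by exists A; split => //; [case: bA|case: bD].
  - by rewrite eB; exists B; split => //; [case: bB|case: bC].
  - by rewrite eF; exists F; split => //; [case: bF|case: bE].
split.
  move=> l; apply: (@chord_max A _ F B) => //; [lra|by case: bF|by case: bB|lra].
move=> z l Wz al; rewrite eB eF; have [Z [KZ _ eZ]] := Wz.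
split; rewrite leNgt; apply/negP => hz.
  have n : lv A - z != 0 by apply/eqP; lra.
  apply: (@chord_outside A F Z a z l ((lv A - lv F) / (lv A - z))) => //; [by case: bA|by case: bD| | |by field|by left; lra].
    by apply: divr_gt0; lra.
  by rewrite ltr_pdivrMr ?mul1r; lra.
have n : z - lv A != 0 by apply/eqP; lra.
apply: (@chord_outside A B Z a z l ((lv B - lv A) / (z - lv A))) => //; [by case: bA|by case: bD| | |by field|by right; lra].
  by apply: divr_gt0; lra.
by rewrite ltr_pdivrMr ?mul1r; lra.
Qed.

End Chords.

Lemma chord_bound_unif (R : realType) (K : set (R * R)) : compact K ->
  exists b : R, forall u z l, chord K u z l -> l * (u.1 ^+ 2 + u.2 ^+ 2) <= b * (`|u.1| + `|u.2|).
Proof.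
move=> cK; have [b Hb] := bdd_compact cK.
exists (2 * b) => u z l [P [KP KP' _]].
have [h1 h2] := Hb _ KP; have [h3 h4] := Hb _ KP'; move: h3 h4; rewrite /sh /= => h3 h4.
have -> : l * (u.1 ^+ 2 + u.2 ^+ 2) = u.1 * ((P.1 + l * u.1) - P.1) + u.2 * ((P.2 + l * u.2) - P.2) by ring.
have d (x p q : R) : `|p| <= b -> `|q| <= b -> x * (p - q) <= `|x| * (2 * b).
  move=> h5 h6; apply: le_trans (ler_norm _) _; rewrite normrM ler_wpM2l//.
  by apply: le_trans (ler_normB _ _) _; lra.
by have := d u.1 _ _ h3 h1; have := d u.2 _ _ h4 h2; lra.
Qed.

(** * Existence of a hexagon in every direction *)

Section Existence.
Variables (R : realType) (K : set (R * R)) (u : R * R).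
Hypotheses (cK : compact K) (vK : convex_set2 K) (K0 : K^° !=set0) (u0 : 0 < u.1 ^+ 2 + u.2 ^+ 2).
Implicit Types (P Q A B F : R * R) (z l a h y s t : R).
Local Notation lv := (lv u).
Local Notation sh := (sh u).
Local Notation chord := (chord K u).

Let clK : closed K. Proof. exact: compact2_closed. Qed.

Lemma chord_bound : exists M, forall z l, chord z l -> l <= M.
Proof.
have [b Hb] := chord_bound_unif cK.
exists (b * (`|u.1| + `|u.2|) / (u.1 ^+ 2 + u.2 ^+ 2)) => z l /Hb.
by rewrite ler_pdivlMr.
Qed.

Lemma chord_extremes z l : chord z l -> exists zm zp, [/\ chord zm l, chord zp l & forall z', chord z' l -> zm <= z' /\ z' <= zp].
Proof.
move=> [P [KP KP' _]].
pose E := K `&` [set P | K (sh P l)].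
have cE : compact E.
  by apply: compact_closedI => //; apply: closed_pre => //; rewrite /sh; cont.
have E0 : E !=set0 by exists P.
have clv : {within E, continuous lv}.
  by apply: continuous_subspaceT; rewrite /lv; cont.
have [A /set_mem [KA KA'] HA] := compact_EVT_min E0 cE clv.
have [B /set_mem [KB KB'] HB] := compact_EVT_max E0 cE clv.
exists (lv A), (lv B); split; [by exists A|by exists B|].
move=> z' [Q [KQ KQ' <-]]; have QE : Q \in E by rewrite inE.
by split; [exact: HA|exact: HB].
Qed.

(* The highest and lowest chords of length [a] have a chord of length [2a] halfway between them. The largest such [a]
   gives a hexagon: if the middle chord were longer than [2a], then [a] could be increased. *)
Definition Smid a := 0 <= a /\ exists zm zp, [/\ chord zm a, chord zp a, forall z, chord z a -> zm <= z /\ z <= zp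
  & chord ((zm + zp) / 2) (2 * a)].

Lemma chord0 P : K P -> chord (lv P) 0.
Proof. by move=> KP; exists P; split => //; rewrite sh0. Qed.

Lemma half01 : 0 <= (1 / 2 : R) /\ (1 / 2 : R) <= 1. Proof. by lra. Qed.

Lemma Smid0 : Smid 0.
Proof.
split => //; have [c Kc] := K0.
have [zm [zp [Wm Wp H]]] := chord_extremes (chord0 (interior_subset Kc)).
exists zm, zp; split => //; rewrite mulr0.
have := chord_conv vK Wm Wp half01.1 half01.2.
by congr (chord); field.
Qed.

Lemma Smid_max : exists a, Smid a /\ forall a', Smid a' -> a' <= a.
Proof.
have [M HM] := chord_bound.
have M0 : 0 <= M by have [_ [zm [_ [Wm _ _ _]]]] := Smid0; exact: HM Wm.
have supS : has_sup Smid.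
  split; first by exists 0; exact: Smid0.
  by exists M => a [_ [zm [_ [Wm _ _ _]]]]; exact: HM Wm.
have [s sE] : exists s, s = sup Smid by eexists.
have sub a : Smid a -> a <= s by move=> Sa; rewrite sE; exact: sup_upper_bound.
have s0 : 0 <= s by exact: sub Smid0.
pose D1 : set (R * (R * R)) := (`[0, M] `*` K) `&` [set x | K (x.2.1 + x.1 * u.1, x.2.2 + x.1 * u.2)].
have cD1 : compact D1.
  apply: compact_closedI; first by apply: compact_setX => //; exact: segment_compact.
  by apply: closed_pre => //; cont.
have D10 : D1 !=set0.
  have [_ [zm [_ [[P [KP KP' _]] _ _ _]]]] := Smid0.
  by exists (0, P); split => //; split => //=; rewrite in_itv/= lexx.
have cf1 : {within D1, continuous (fun x : R * (R * R) => x.1)} by apply: continuous_subspaceT; cont.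
have [[am Pm] /set_mem [[/= aM KPm] KPm'] Ham] := compact_EVT_max D10 cD1 cf1.
have Wam : chord (lv Pm) am by exists Pm.
have sam : s <= am.
  rewrite sE; apply: ge_sup; first by case: supS.
  move=> a [a0 [zm [_ [Wm _ _ _]]]]; have aM' := HM _ _ Wm; have [P [KP KP' _]] := Wm.
  by apply: (Ham (a, P)); rewrite inE; split => //; split => //=; rewrite in_itv/= a0.
have [zm [zp [Wm Wp H]]] := chord_extremes (chord_le vK Wam s0 sam).
(* Extremality of the outer chords is not a closed condition. It is relaxed to lying at or beyond
   [zm] and [zp], the extreme levels for length s. A maximizer has length at least s, so its outer
   chords, shortened to s, must lie exactly at these levels. *)
pose D2 : set (R * ((R * R) * ((R * R) * (R * R)))) := (`[0, M] `*` (K `*` (K `*` K))) `&`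
  ([set x | K (x.2.1.1 + x.1 * u.1, x.2.1.2 + x.1 * u.2)] `&`
  [set x | K (x.2.2.1.1 + x.1 * u.1, x.2.2.1.2 + x.1 * u.2)] `&`
  [set x | K (x.2.2.2.1 + 2 * x.1 * u.1, x.2.2.2.2 + 2 * x.1 * u.2)] `&`
  [set x | lv x.2.1 <= zm] `&` [set x | zp <= lv x.2.2.1] `&`
  [set x | lv x.2.1 + lv x.2.2.1 <= 2 * lv x.2.2.2] `&` [set x | 2 * lv x.2.2.2 <= lv x.2.1 + lv x.2.2.1]).
have cD2 : compact D2.
  apply: compact_closedI.
    apply: compact_setX; first exact: segment_compact.
    by apply: compact_setX => //; exact: compact_setX.
  rewrite /lv; do ?apply: closedI; first [apply: closed_le0; cont | apply: closed_pre => //; cont].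
have memD2 a : Smid a -> exists x, x \in D2 /\ x.1 = a.
  move=> Sa; have as_ := sub _ Sa; move: Sa => [a0 [za [zb [Wa Wb Hab [A [KA KA' eA]]]]]].
  have aM' := HM _ _ Wa.
  have [c1 _] := Hab _ (chord_le vK Wm a0 as_); have [_ c2] := Hab _ (chord_le vK Wp a0 as_).
  move: Wa Wb => [P [KP KP' eP]] [Q [KQ KQ' eQ]].
  exists (a, (P, (Q, A))); split => //; rewrite inE; split.
    by split => //=; rewrite in_itv/= a0.
  by do !split => //=; rewrite ?eP ?eQ ?eA//; lra.
have D20 : D2 !=set0 by have [x [/set_mem xD _]] := memD2 _ Smid0; exists x.
have cf2 : {within D2, continuous (fun x : R * ((R * R) * ((R * R) * (R * R))) => x.1)} by apply: continuous_subspaceT; cont.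
have [[a [P [Q A]]] /set_mem [[/= aI [KP [KQ KA]]] [[[[[[KP' KQ'] KA'] /= h1] h2] h3] h4]] Ha] := compact_EVT_max D20 cD2 cf2.
have sa : s <= a.
  rewrite sE; apply: ge_sup; first by case: supS.
  by move=> b /memD2 [x [xD <-]]; exact: (Ha x).
exists s; split => //; split => //; exists zm, zp; split => //.
have WP : chord (lv P) s by apply: (@chord_le _ _ _ vK _ a) => //; exists P.
have WQ : chord (lv Q) s by apply: (@chord_le _ _ _ vK _ a) => //; exists Q.
have eP : lv P = zm by apply/eqP; rewrite eq_le h1; have [] := H _ WP.
have eQ : lv Q = zp by apply/eqP; rewrite eq_le h2; have [_ ->] := H _ WQ.
have -> : (zm + zp) / 2 = lv A by move: h3 h4; rewrite eP eQ; lra.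
by apply: (@chord_le _ _ _ vK _ (2 * a)) => //; [exists A|lra|lra].
Qed.

Lemma chord_between z1 z2 l z : chord z1 l -> chord z2 l -> z1 <= z -> z <= z2 -> chord z l.
Proof.
move=> W1 W2 h1 h2; have [h|h] := leP z2 z1.
  by have -> : z = z1 by lra.
have n : z2 - z1 != 0 by apply/eqP; lra.
have t0 : 0 <= (z - z1) / (z2 - z1) by apply: divr_ge0; lra.
have t1 : (z - z1) / (z2 - z1) <= 1 by rewrite ler_pdivrMr ?mul1r; lra.
have := chord_conv vK W2 W1 t0 t1.
by congr (chord); field.
Qed.

Lemma Smid_grow a zm zp l : 0 <= a -> chord zm a -> chord zp a -> (forall z, chord z a -> zm <= z /\ z <= zp) ->
  chord ((zm + zp) / 2) l -> 2 * a < l -> exists2 a', a < a' & Smid a'.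
Proof.
move=> a0 Wm Wp H Wl al.
have [m mE] : exists m, m = (zm + zp) / 2 by eexists.
rewrite -mE in Wl.
have la : 0 < l - a by lra.
(* The weight for which (1 - s) l + s a, the length of chords available near the middle, is twice
   the new length a + s (l - a). The new halfway level stays within reach of those chords. *)
have [s sE] : exists s, s = (l - 2 * a) / (3 * (l - a)) by eexists.
have s0 : 0 < s by rewrite sE; apply: divr_gt0; lra.
have s1 : s <= 1 by rewrite sE ler_pdivrMr ?mul1r; lra.
have s3 : 3 * (s * (l - a)) = l - 2 * a by rewrite sE; field; rewrite gt_eqF.
have sla : 0 < s * (l - a) by rewrite mulr_gt0.
have Wp' := chord_conv vK Wl Wp (ltW s0) s1.
have Wm' := chord_conv vK Wl Wm (ltW s0) s1.
have eL : s * l + (1 - s) * a = a + s * (l - a) by ring.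
rewrite eL in Wp' Wm'.
exists (a + s * (l - a)); first by lra.
split; first by lra.
have [zm' [zp' [Vm Vp H']]] := chord_extremes Wp'.
exists zm', zp'; split => //.
have [a1 a2] := H _ (chord_le vK Vp a0 (ltac:(by lra) : a <= a + s * (l - a))).
have [b1 b2] := H _ (chord_le vK Vm a0 (ltac:(by lra) : a <= a + s * (l - a))).
have [c1 c2] := H' _ Wp'; have [d1 d2] := H' _ Wm'.
have s01 : 0 <= 1 - s by lra.
have s11 : 1 - s <= 1 by lra.
have Xp := chord_conv vK Wl Wp s01 s11.
have Xm := chord_conv vK Wl Wm s01 s11.
have zpm : zm <= zp by have [] := H _ Wp.
have sp : 0 <= s * (zp - zm) by rewrite mulr_ge0 ?(ltW s0)// subr_ge0.
have lE : (1 - s) * l + (1 - (1 - s)) * a = 2 * (a + s * (l - a)) by move: s3; lra.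
rewrite lE in Xp Xm.
have mm : zm = 2 * m - zp by lra.
by apply: (chord_between Xm Xp); move: c1 c2 d1 d2 a1 a2 b1 b2 sp; rewrite mm; lra.
Qed.

Lemma interior_move Q (d : R * R) : K^° Q -> exists2 e : R, 0 < e & forall s, `|s| <= e -> K (Q.1 + s * d.1, Q.2 + s * d.2).
Proof.
move=> /interiorP[r r0 H].
have D0 : 0 < 1 + `|d.1| + `|d.2| by rewrite ltr_wpDr// ltr_wpDr.
exists (r / 2 / (1 + `|d.1| + `|d.2|)); first by rewrite !divr_gt0.
have d1 := normr_ge0 d.1; have d2 := normr_ge0 d.2.
move=> s; rewrite ler_pdivlMr// => hs; have s0 := normr_ge0 s.
have e1 := mulr_ge0 s0 d1; have e2 := mulr_ge0 s0 d2.
by apply: H => /=; rewrite addrAC subrr add0r normrM; lra.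
Qed.

(** If one end is interior, sliding the chord slightly along its own line makes both ends
    interior. *)
Lemma chord_lift B a : 0 < a -> K B -> K (sh B a) -> K^° B \/ K^° (sh B a) ->
  exists r, K^° (sh B r) /\ K^° (sh B (r + a)).
Proof.
move=> a0 KB KB' [iB|iB].
  have [e e0 H] := interior_move u iB.
  have Ke : K (sh B (- e)) by apply: H; rewrite normrN gtr0_norm.
  rewrite -(sh0 u B) in iB.
  exists (- (Num.min e a / 2)).
  have m1 : Num.min e a <= e by rewrite ge_min lexx.
  have m2 : Num.min e a <= a by rewrite ge_min lexx orbT.
  have m0 : 0 < Num.min e a by rewrite lt_min e0.
  split.
    by apply: (sh_interior vK iB Ke); right; lra.
  by apply: (sh_interior vK iB KB'); left; lra.
have [e e0 H] := interior_move u iB.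
have Ke : K (sh B (a + e)).
  have := H e; rewrite gtr0_norm// lexx => /(_ isT).
  by rewrite /sh /=; congr K; congr pair; ring.
rewrite -(sh0 u B) in KB.
exists (Num.min e a / 2).
have m1 : Num.min e a <= e by rewrite ge_min lexx.
have m2 : Num.min e a <= a by rewrite ge_min lexx orbT.
have m0 : 0 < Num.min e a by rewrite lt_min e0.
split.
  by apply: (sh_interior vK iB KB); right; lra.
by apply: (sh_interior vK iB Ke); left; lra.
Qed.

(** With both ends interior, the chord could be translated along the normal of [u] to higher and
    lower levels. *)
Lemma chord_end_bd z a P : 0 < a -> K P -> K (sh P a) -> lv P = z ->
  (forall z', chord z' a -> z' <= z) \/ (forall z', chord z' a -> z <= z') -> bd K P /\ bd K (sh P a).
Proof.
move=> a0 KP KP' <- H.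
suff h : ~ (K^° P \/ K^° (sh P a)) by split; split => // i; apply: h; [left|right].
move=> /(chord_lift a0 KP KP') [r [i1 i2]].
have [e1 e10 H1] := interior_move (- u.2, u.1) i1.
have [e2 e20 H2] := interior_move (- u.2, u.1) i2.
have [e [e0 he1 he2]] : exists e, [/\ 0 < e, e <= e1 & e <= e2].
  by exists (Num.min e1 e2); rewrite lt_min e10 e20 !ge_min !lexx orbT.
have move_ s : `|s| <= e -> chord (lv P + s * (u.1 ^+ 2 + u.2 ^+ 2)) a.
  move=> hs; exists ((sh P r).1 + s * - u.2, (sh P r).2 + s * u.1); split.
  - by apply: H1; lra.
  - have := H2 s; rewrite /sh /= => /(_ (ltac:(by lra) : `|s| <= e2)).
    by congr K; congr pair; ring.
  - by rewrite /lv /sh /=; ring.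
have eu : 0 < e * (u.1 ^+ 2 + u.2 ^+ 2) by rewrite mulr_gt0.
case: H => H.
  by have /H := move_ e (ltac:(by rewrite gtr0_norm) : `|e| <= e); lra.
by have /H := move_ (- e) (ltac:(by rewrite normrN gtr0_norm) : `|- e| <= e); rewrite mulNr; lra.
Qed.

Lemma exists_hexsol : exists B A F a, hexsol K u B A F a.
Proof.
have [a [[a0 [zm [zp [Wm Wp H Wa]]]] amax]] := Smid_max.
have nogrow l : chord ((zm + zp) / 2) l -> l <= 2 * a.
  move=> Wl; rewrite leNgt; apply/negP => al.
  by have [a' aa' /amax] := Smid_grow a0 Wm Wp H Wl al; rewrite leNgt aa'.
have [c Kc] := K0.
have [e e0 He] := interior_move (- u.2, u.1) Kc.
have lvc s : lv (c.1 + s * (- u.2), c.2 + s * u.1) = lv c + s * (u.1 ^+ 2 + u.2 ^+ 2) by rewrite /lv /=; ring.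
have eu : 0 < e * (u.1 ^+ 2 + u.2 ^+ 2) by rewrite mulr_gt0.
have Kp := He e; rewrite gtr0_norm// lexx in Kp; have {}Kp := Kp isT.
have Km := He (- e); rewrite normrN gtr0_norm// lexx in Km; have {}Km := Km isT.
(* If the extreme levels coincided, averaging any point of [K] with the middle chord would put that
   point on the same level. *)
have zmp : zm < zp.
  rewrite ltNge; apply/negP => h.
  have ez : zm = zp by have [] := H _ Wp; lra.
  have aa : a <= 2 * a by lra.
  have noP P : K P -> lv P = zp.
    move=> KP; have := chord_conv vK (chord0 KP) Wa half01.1 half01.2.
    have -> : 1 / 2 * 0 + (1 - 1 / 2) * (2 * a) = a by field.
    by move=> /H; rewrite ez; lra.
  by have := noP _ Kp; have := noP _ Km; rewrite !lvc; lra.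
(* For a = 0 the middle level contains an interior point, hence a chord of positive length. *)
have {}a0 : 0 < a.
  rewrite lt_neqAle a0 andbT; apply/eqP => a_0; rewrite -a_0 in Wm Wp nogrow.
  have [P1 [KP1 _ e1]] := Wm; have [P2 [KP2 _ e2]] := Wp.
  have [Q [KQ eQ]] : exists Q, K^° Q /\ lv Q = (zm + zp) / 2.
    by apply: (level_interior vK K0 KP1 KP2); lra.
  have [r r0 Hr] := interior_move u KQ.
  have : chord ((zm + zp) / 2) r.
    exists Q; split => //; first exact: interior_subset.
    by apply: Hr; rewrite gtr0_norm.
  by move=> /nogrow; lra.
have [F [KF KF' eF]] := Wm; have [B [KB KB' eB]] := Wp; have [A [KA KA' eA]] := Wa.
have [bB bC] : bd K B /\ bd K (sh B a) by apply: (chord_end_bd a0 KB KB' eB); left => z' /H[].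
have [bF bE] : bd K F /\ bd K (sh F a) by apply: (chord_end_bd a0 KF KF' eF); right => z' /H[].
have a2 : 0 < 2 * a by lra.
have [bA bD] : bd K A /\ bd K (sh A (2 * a)).
  suff h : ~ (K^° A \/ K^° (sh A (2 * a))) by split; split => // i; apply: h; [left|right].
  move=> /(chord_lift a2 KA KA') [r [i1 i2]].
  have [d d0 Hd] := interior_move u i2.
  have : chord ((zm + zp) / 2) (2 * a + d).
    exists (sh A r); split; [exact: interior_subset| |by rewrite lv_sh].
    have := Hd d; rewrite gtr0_norm// lexx => /(_ isT).
    by rewrite /sh /=; congr K; congr pair; ring.
  by move=> /nogrow; lra.
exists B, A, F, a; split; split => //; rewrite ?eA ?eB ?eF; lra.
Qed.

End Existence.

(** * Turning the direction until the hexagon is centrally symmetric *)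

Section Hexagon.
Variables (R : realType) (K : set (R * R)).
Hypotheses (cK : compact K) (vK : convex_set2 K) (K0 : K^° !=set0).
Implicit Types (P Q A B F : R * R) (z l a h y s t : R).

Let clK : closed K. Proof. exact: compact2_closed. Qed.

(** When the boundary contains a segment, a chord of given level and length may have several
    positions; they form a convex set. *)
Lemma bd_mid P1 P2 u b t : 0 < b -> bd K P1 -> bd K (sh u P1 b) -> bd K P2 -> bd K (sh u P2 b) ->
  (exists s, P2 = sh u P1 s) -> 0 <= t -> t <= 1 ->
  let P := (t * P1.1 + (1 - t) * P2.1, t * P1.2 + (1 - t) * P2.2) in bd K P /\ bd K (sh u P b).
Proof.
move=> b0.
wlog : P1 P2 t / exists2 s, 0 <= s & P2 = sh u P1 s.
  move=> W h1 h2 h3 h4 [s sE] t0 t1.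
  have [s0|s0] := leP 0 s; first by apply: W => //; exists s.
  have -> : (t * P1.1 + (1 - t) * P2.1, t * P1.2 + (1 - t) * P2.2) =
      ((1 - t) * P2.1 + (1 - (1 - t)) * P1.1, (1 - t) * P2.2 + (1 - (1 - t)) * P1.2) by congr pair; ring.
  have e : P1 = sh u P2 (- s) by rewrite sE sh_sh addrN sh0.
  by apply: W => //; [exists (- s) => //; lra|exists (- s)|lra|lra].
move=> [s s0 ->] [k1 n1] [k2 n2] [k3 n3] [k4 n4] _ t0 t1 /=.
rewrite sh_sh in k4 n4.
have e : (t * P1.1 + (1 - t) * (P1.1 + s * u.1), t * P1.2 + (1 - t) * (P1.2 + s * u.2)) = sh u P1 ((1 - t) * s).
  by rewrite /sh; congr pair; ring.
rewrite e sh_sh.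
have ts : 0 <= (1 - t) * s by rewrite mulr_ge0//; lra.
have ts2 : 0 <= t * s by rewrite mulr_ge0.
have KP : K (sh u P1 ((1 - t) * s)).
  by have := vK k1 k3 t0 t1; rewrite e.
have KPb : K (sh u P1 ((1 - t) * s + b)).
  have := vK k2 k4 t0 t1; rewrite /sh /=.
  by congr K; congr pair; ring.
split; split => // iP.
  have [h|h] := leP s ((1 - t) * s).
    by have e2 : (1 - t) * s = s by [lra]; rewrite e2 in iP.
  by apply: n3; apply: (sh_interior vK iP k4); left; lra.
have [h|h] := leP ((1 - t) * s) 0.
  by have e2 : (1 - t) * s = 0 by [lra]; rewrite e2 add0r in iP.
rewrite -(sh0 u P1) in k1.
by apply: n2; apply: (sh_interior vK iP k1); right; lra.
Qed.

(* Leads from a direction to its opposite without passing through 0; [off] changes sign when the direction is reversed. *)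
Definition dir t : R * R := (1 - 2 * t, 4 * t * (1 - t)).

Lemma dir_sq t : 3 / 4 <= (dir t).1 ^+ 2 + (dir t).2 ^+ 2.
Proof.
have -> : (dir t).1 ^+ 2 + (dir t).2 ^+ 2 = 3 / 4 + (4 * (t * (1 - t)) - 1 / 2) ^+ 2 by rewrite /dir /=; field.
by rewrite lerDl sqr_ge0.
Qed.

Lemma dir_gt0 t : 0 < (dir t).1 ^+ 2 + (dir t).2 ^+ 2.
Proof. by apply: lt_le_trans (dir_sq t); lra. Qed.

Lemma dir_le1 t : 0 <= t -> t <= 1 -> `|(dir t).1| <= 1 /\ `|(dir t).2| <= 1.
Proof.
move=> t0 t1; rewrite /dir /= !ler_norml.
have h1 : 0 <= t * (1 - t) by rewrite mulr_ge0//; lra.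
have h2 := sqr_ge0 (t - 1 / 2).
by move: h2; rewrite expr2 => h2; split; apply/andP; split; lra.
Qed.

(** A small square inside [K] supplies chords of length r/2 over an interval of levels, for all
    directions at once. *)
Lemma hexsol_bounds : exists e : R, 0 < e /\ forall t B A F a, 0 <= t -> t <= 1 -> hexsol K (dir t) B A F a ->
  e <= a /\ e <= lv (dir t) B - lv (dir t) A.
Proof.
have [c Kc] := K0; have [r r0 H] := (interiorP K c).1 Kc.
exists (r / 8); split; first lra.
move=> t B A F a t0 t1 /(hexsol_extchord vK K0 (dir_gt0 t)) S.
have [u1 u2] := dir_le1 t0 t1.
have uu := dir_sq t.
move: S u1 u2 uu; move: (dir t) => u S u1 u2 uu.
have u0 : 0 < u.1 ^+ 2 + u.2 ^+ 2 by lra.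
have r2 : 0 < r / 2 by lra.
have e0 : 0 < 3 * r / 8 by lra.
suff /(extw_bounds (chord_conv vK) S r2 e0) : forall z, lv u c - 3 * r / 8 <= z -> z <= lv u c + 3 * r / 8 -> chord K u z (r / 2) by lra.
move=> z z1 z2.
have [s sE] : exists s, s = (z - lv u c) / (u.1 ^+ 2 + u.2 ^+ 2) by eexists.
have su : s * (u.1 ^+ 2 + u.2 ^+ 2) = z - lv u c by rewrite sE; field; rewrite gt_eqF.
have sr : `|s| <= r / 2.
  rewrite sE normrM normfV (gtr0_norm u0) ler_pdivrMr//.
  have h : 3 * r / 8 <= r / 2 * (u.1 ^+ 2 + u.2 ^+ 2).
    have : 0 <= r / 2 * (u.1 ^+ 2 + u.2 ^+ 2 - 3 / 4) by rewrite mulr_ge0; lra.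
    by lra.
  by apply: le_trans h; rewrite ler_norml; apply/andP; split; lra.
have n (x y k : R) : `|x| <= 1 -> `|y| <= 1 -> `|k| <= r / 4 -> `|k * x + s * y| < r.
  move=> h1 h2 h3; apply: le_lt_trans (ler_normD _ _) _; rewrite !normrM.
  have : `|k| * `|x| <= r / 4 * 1 by rewrite ler_pM.
  have : `|s| * `|y| <= r / 2 * 1 by rewrite ler_pM.
  by lra.
have u2' : `|- u.2| <= 1 by rewrite normrN.
have k1 : `|- (r / 4)| <= r / 4 by rewrite normrN gtr0_norm//; lra.
have k2 : `|r / 4| <= r / 4 by rewrite gtr0_norm//; lra.
have d (x y : R) : x + y - x = y by ring.
exists (c.1 + (- (r / 4) * u.1 + s * - u.2), c.2 + (- (r / 4) * u.2 + s * u.1)); split.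
- by apply: H; rewrite /= d; exact: n.
- have -> : sh u (c.1 + (- (r / 4) * u.1 + s * - u.2), c.2 + (- (r / 4) * u.2 + s * u.1)) (r / 2) =
    (c.1 + ((r / 4) * u.1 + s * - u.2), c.2 + ((r / 4) * u.2 + s * u.1)) by rewrite /sh /=; congr pair; field.
  by apply: H; rewrite /= d; exact: n.
- transitivity (lv u c + s * (u.1 ^+ 2 + u.2 ^+ 2)); first by rewrite /lv /=; ring.
  by rewrite su; ring.
Qed.

(* Vanishes when the hexagon is centrally symmetric, hence affinely regular. *)
Definition off (u : R * R) B A F a :=
  u.1 * (B.1 + F.1 - 2 * A.1 - a * u.1) + u.2 * (B.2 + F.2 - 2 * A.2 - a * u.2).

Local Notation T := (R * ((R * R) * ((R * R) * ((R * R) * R))))%type.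

Definition hexsols : set T :=
  [set x | [/\ 0 <= x.1, x.1 <= 1 & hexsol K (dir x.1) x.2.1 x.2.2.1 x.2.2.2.1 x.2.2.2.2]].

Lemma hexsol_compact : compact hexsols.
Proof.
have [e [e0 He]] := hexsol_bounds.
have [b Hb] := chord_bound_unif cK.
have bM : forall t B A F a, 0 <= t -> t <= 1 -> hexsol K (dir t) B A F a -> a <= 8 / 3 * `|b|.
  move=> t B A F a t0 t1 S.
  have [[bB bC _ _ _] [_ a0 _ _]] := S.
  have W : chord K (dir t) (lv (dir t) B) a by exists B; split => //; [case: bB|case: bC].
  have := Hb _ _ _ W.
  have [u1 u2] := dir_le1 t0 t1; have uu := dir_sq t.
  have h1 : a * (3 / 4) <= a * ((dir t).1 ^+ 2 + (dir t).2 ^+ 2) by rewrite ler_pM2l.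
  have h2 : b * (`|(dir t).1| + `|(dir t).2|) <= `|b| * 2.
    apply: le_trans (ler_norm _) _; rewrite normrM ler_wpM2l// ger0_norm ?addr_ge0//; lra.
  by lra.
(* The strict inequalities of [hexsol] are not closed conditions; [hexsol_bounds] allows lower
   bounds by [e] in their place. *)
have -> : hexsols =
   (`[0, 1] `*` (K `*` (K `*` (K `*` `[0, 8 / 3 * `|b|])))) `&`
   ([set x : T | bd K x.2.1] `&` [set x : T | bd K (sh (dir x.1) x.2.1 x.2.2.2.2)] `&`
   [set x : T | bd K x.2.2.1] `&` [set x : T | bd K (sh (dir x.1) x.2.2.1 (2 * x.2.2.2.2))] `&`
   [set x : T | bd K x.2.2.2.1] `&` [set x : T | bd K (sh (dir x.1) x.2.2.2.1 x.2.2.2.2)] `&`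
   [set x : T | e <= x.2.2.2.2] `&` [set x : T | e <= lv (dir x.1) x.2.1 - lv (dir x.1) x.2.2.1] `&`
   [set x : T | lv (dir x.1) x.2.1 - lv (dir x.1) x.2.2.1 <= lv (dir x.1) x.2.2.1 - lv (dir x.1) x.2.2.2.1] `&`
   [set x : T | lv (dir x.1) x.2.2.1 - lv (dir x.1) x.2.2.2.1 <= lv (dir x.1) x.2.1 - lv (dir x.1) x.2.2.1]).
  rewrite /hexsols; apply/seteqP; split => [[t [B [A [F a]]]] /= [t0 t1 S]|[t [B [A [F a]]]] /=].
    have [ea eh] := He _ _ _ _ _ t0 t1 S; have aM := bM _ _ _ _ _ t0 t1 S.
    have [[bB bC bA bD bF] [bE a0 AB eAB]] := S.
    split; last by do !split => //; rewrite eAB.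
    split; first by rewrite /= in_itv/= t0.
    by do !split => //=; [case: bB|case: bA|case: bF|rewrite in_itv/= (ltW a0)].
  move=> [[ht [_ [_ [_ ha]]]] [[[[[[[[[bB bC] bA] bD] bF] bE] ea] eh] h1] h2]].
  move: ht; rewrite /= in_itv/= => /andP[t0 t1].
  split => //; split; split => //; [lra|lra|].
  by apply/eqP; rewrite eq_le h1.
have cb := closed_bd clK.
apply: compact_closedI.
  apply: compact_setX; first exact: segment_compact.
  do 3 (apply: compact_setX => //); exact: segment_compact.
move: cb; rewrite /lv /sh /dir; move: (bd K) => bK cb.
do ?apply: closedI; first [by apply: closed_le0; cont | by apply: closed_pre; [cont|]].
Qed.

(** The directions with a solution of nonnegative offset and those with one of nonpositive offset
    form two closed sets that cover the interval. If they were disjoint, connectedness would give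
    the whole interval to one of them, contrary to [flip]. At a common direction the two solutions
    share levels and length by [extw_uniq], and [bd_mid] admits the convex combination with offset
    0. *)
Lemma exists_hexagon : exists u A B F a, hexsol K u B A F a /\ off u B A F a = 0.
Proof.
pose f (x : T) := off (dir x.1) x.2.1 x.2.2.1 x.2.2.2.1 x.2.2.2.2.
have cf : continuous f by rewrite /f /off /dir; cont.
pose P := fst @` (hexsols `&` [set x | 0 <= f x]).
pose N := fst @` (hexsols `&` [set x | f x <= 0]).
have closedX (X : set T) : closed X -> closed (fst @` (hexsols `&` X)).
  move=> cX; apply: compact_closed; first exact: norm_hausdorff.
  apply: continuous_compact; first by apply: continuous_subspaceT => x; exact: cvg_fst.
  by apply: compact_closedI => //; exact: hexsol_compact.
have cP : closed P by apply: closedX; apply: (@closed_le0 _ _ (fun=> 0) f) => //; exact: cst_continuous.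
have cN : closed N by apply: closedX; apply: (@closed_le0 _ _ f (fun=> 0)) => //; exact: cst_continuous.
have PN t : 0 <= t -> t <= 1 -> P t \/ N t.
  move=> t0 t1; have [B [A [F [a S]]]] := exists_hexsol cK vK K0 (dir_gt0 t).
  have Zx : hexsols (t, (B, (A, (F, a)))) by [].
  have [h|h] := leP 0 (f (t, (B, (A, (F, a))))).
    by left; exists (t, (B, (A, (F, a)))).
  by right; exists (t, (B, (A, (F, a)))) => //; split => //; exact: ltW.
have flip B A F a : hexsol K (dir 0) B A F a ->
    hexsol K (dir 1) (sh (dir 0) F a) (sh (dir 0) A (2 * a)) (sh (dir 0) B a) a /\
    off (dir 1) (sh (dir 0) F a) (sh (dir 0) A (2 * a)) (sh (dir 0) B a) a = - off (dir 0) B A F a.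
  have e0 : dir 0 = (1, 0) by rewrite /dir; congr pair; ring.
  have e1 : dir 1 = (-1, 0) by rewrite /dir; congr pair; ring.
  have s0 Q l : sh (-1, 0) (sh (1, 0) Q l) l = Q :> R * R.
    by rewrite [RHS]surjective_pairing /sh /=; congr pair; ring.
  rewrite e0 e1 => -[[bB bC bA bD bF] [bE a0 AB eAB]]; split; last by rewrite /off /sh /=; ring.
  split; split => //; rewrite ?s0//; move: AB eAB; rewrite /lv /sh /=; lra.
have [t [Pt Nt]] : exists t, P t /\ N t.
  apply: contrapT => no.
  have disj t : P t -> ~ N t by move=> h1 h2; apply: no; exists t.
  have sP t : P t -> 0 <= t /\ t <= 1 by move=> [x [[x0 x1 _] _] <-].
  have sN t : N t -> 0 <= t /\ t <= 1 by move=> [x [[x0 x1 _] _] <-].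
  have PE : P = [set` `[0, 1]].
    have P0 : P !=set0.
      have [|N0] := PN 0 (lexx 0) ler01; first by exists 0.
      exists 1; have [[t [B [A [F a]]]] [[/= _ _ S] /= fx] tE] := N0.
      rewrite /= in tE; rewrite tE in S fx; have [S' fS'] := flip _ _ _ _ S.
      exists (1, (sh (dir 0) F a, (sh (dir 0) A (2 * a), (sh (dir 0) B a, a)))) => //; split.
        by split => //=; exact: S'.
      by rewrite /f /= fS' oppr_ge0; move: fx; rewrite /f.
    apply: (@segment_connected R 0 1 P P0).
      exists (~` N); first exact: closed_openC.
      apply/seteqP; split => t /=.
        by move=> Pt; split; [rewrite /= in_itv/=; apply/andP; exact: sP|exact: disj].
      by rewrite /= in_itv/= => -[/andP[t0 t1] nt]; have [] := PN t t0 t1.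
    exists P => //; apply/seteqP; split => t /=; last by case.
    by move=> Pt; split => //; rewrite /= in_itv/=; apply/andP; exact: sP.
  have P0 : P 0 by rewrite PE /= in_itv/= lexx ler01.
  have P1 : P 1 by rewrite PE /= in_itv/= lexx ler01.
  apply: (disj 1 P1).
  have [[t [B [A [F a]]]] [[/= _ _ S] /= fx] tE] := P0.
  rewrite /= in tE; rewrite tE in S fx; have [S' fS'] := flip _ _ _ _ S.
  exists (1, (sh (dir 0) F a, (sh (dir 0) A (2 * a), (sh (dir 0) B a, a)))) => //; split.
    by split => //=; exact: S'.
  by rewrite /f /= fS' oppr_le0; move: fx; rewrite /f.
have [[t1 [B1 [A1 [F1 a1]]]] [[/= t0 t01 S1] /= f1] /= tE1] := Pt.
have [[t2 [B2 [A2 [F2 a2]]]] [[/= _ _ S2] /= f2] /= tE2] := Nt.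
rewrite tE1 in S1 f1 t0 t01; rewrite tE2 in S2 f2; move: f1 f2; rewrite /f /=.
have u0 := dir_gt0 t; move: (dir t) u0 S1 S2 => u u0 S1 S2 f1 f2.
have [yE hE aE] := extw_uniq (chord_conv vK) (hexsol_extchord vK K0 u0 S1) (hexsol_extchord vK K0 u0 S2).
rewrite -aE in S2 f2.
have [s [s0 s1 sE]] : exists s, [/\ 0 <= s, s <= 1 & s * off u B1 A1 F1 a1 + (1 - s) * off u B2 A2 F2 a1 = 0].
  have [h|h] := leP (off u B1 A1 F1 a1) (off u B2 A2 F2 a1).
    by exists 1; split => //; lra.
  exists (- off u B2 A2 F2 a1 / (off u B1 A1 F1 a1 - off u B2 A2 F2 a1)); split.
  - by apply: divr_ge0; lra.
  - by rewrite ler_pdivrMr ?mul1r; lra.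
  - by field; apply/eqP; lra.
have [[bB1 bC1 bA1 bD1 bF1] [bE1 a0 AB1 e1]] := S1.
have [[bB2 bC2 bA2 bD2 bF2] [bE2 _ AB2 e2]] := S2.
have lB : lv u B1 = lv u B2 by lra.
have lF : lv u F1 = lv u F2 by lra.
have a20 : 0 < 2 * a1 by lra.
have [bB bC] := bd_mid a0 bB1 bC1 bB2 bC2 (lv_eq u0 lB) s0 s1.
have [bF bE] := bd_mid a0 bF1 bE1 bF2 bE2 (lv_eq u0 lF) s0 s1.
have [bA bD] := bd_mid a20 bA1 bD1 bA2 bD2 (lv_eq u0 yE) s0 s1.
have lm X Y : lv u X = lv u Y -> lv u (s * X.1 + (1 - s) * Y.1, s * X.2 + (1 - s) * Y.2) = lv u X.
  move=> e; transitivity (s * lv u X + (1 - s) * lv u Y); first by rewrite /lv /=; ring.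
  by rewrite -e; ring.
exists u; eexists; eexists; eexists; exists a1; split.
  split; first by split; [exact: bB|exact: bC|exact: bA|exact: bD|exact: bF].
  by split => //; rewrite !lm.
by rewrite -sE /off /=; ring.
Qed.

End Hexagon.

(** * Reduction to a regular hexagon *)

Section Prehex.
Variables (R : realType).
Implicit Types (K S : set (R * R)) (P Q A B F : R * R).

Lemma interior_affmap (a b e c d f : R) K : a * d - b * c != 0 ->
  (affmap a b e c d f @^-1` K)^° = affmap a b e c d f @^-1` K^°.
Proof.
move=> D0; have [a' [b' [e' [c' [d' [f' [h1 h2 _]]]]]]] := affmap_inv e f D0.
have sub (g h : R * R -> R * R) X : continuous g -> cancel g h -> cancel h g -> g @^-1` X^° `<=` (g @^-1` X)^°.
  move=> cg _ _ x /= gx; rewrite /interior /=.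
  by apply: cg.
apply/seteqP; split; last exact: (sub _ (affmap a' b' e' c' d' f') K (@continuous_affmap _ _ _ _ _ _ _)).
move=> x Hx /=.
have /(_ (affmap a b e c d f x)) := sub (affmap a' b' e' c' d' f') (affmap a b e c d f) (affmap a b e c d f @^-1` K) (@continuous_affmap _ _ _ _ _ _ _) h2 h1.
rewrite /= h1 => /(_ Hx).
by congr (_^° _); apply/funext => y; rewrite /= h2.
Qed.

Lemma bd_affmap (a b e c d f : R) K : a * d - b * c != 0 ->
  bd (affmap a b e c d f @^-1` K) = affmap a b e c d f @^-1` bd K.
Proof. by move=> D0; rewrite /bd interior_affmap. Qed.

Definition prehex S := [/\ compact S, convex_set2 S, S^° !=set0 & forall k, bd S (iter k (@rot R) (0, 1))].

Lemma prehex_affmap (a b e c d f : R) S : a * d - b * c != 0 -> compact S -> convex_set2 S -> S^° !=set0 ->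
  (forall k, bd S (affmap a b e c d f (iter k (@rot R) (0, 1)))) -> prehex (affmap a b e c d f @^-1` S).
Proof.
move=> D0 cS vS [x Sx] bS; split.
- exact: compact_affmap.
- exact: convex_affmap.
- have [a' [b' [e' [c' [d' [f' [h1 h2 _]]]]]]] := affmap_inv e f D0.
  by exists (affmap a' b' e' c' d' f' x); rewrite interior_affmap//= h2.
- by move=> k; rewrite bd_affmap//=; exact: bS.
Qed.

Lemma hexv : [/\ iter 1 (@rot R) (0, 1) = (-1, 1), iter 2 (@rot R) (0, 1) = (-1, 0), iter 3 (@rot R) (0, 1) = (0, -1),
  iter 4 (@rot R) (0, 1) = (1, -1) & iter 5 (@rot R) (0, 1) = (1, 0)].
Proof. by rewrite /= /rot /=; split; congr pair; ring. Qed.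

Lemma iter_rot_mod6 (P : R * R -> Prop) : P (0, 1) -> P (-1, 1) -> P (-1, 0) -> P (0, -1) -> P (1, -1) -> P (1, 0) ->
  forall k, P (iter k (@rot R) (0, 1)).
Proof.
have [e1 e2 e3 e4 e5] := hexv.
move=> p0 p1 p2 p3 p4 p5 k; rewrite (divn_eq k 6) addnC iterD.
have -> : iter (k %/ 6 * 6) (@rot R) (0, 1) = (0, 1).
  by elim: (k %/ 6)%N => [//|n IH]; rewrite mulSn iterD IH iter6_rot.
have : (k %% 6 < 6)%N by rewrite ltn_mod.
by case: (k %% 6)%N => [//|[|[|[|[|[|//]]]]]] _; rewrite ?e1 ?e2 ?e3 ?e4 ?e5.
Qed.

Lemma prehex_rotk j S : prehex S -> prehex (rotk j S).
Proof.
elim: j => [//|j IH] /IH [c v i b]; rewrite rotkS rot_affmap; apply: prehex_affmap => //.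
by move=> k; have := b k.+1; rewrite /= -[rot _]/(@rot R (iter k (@rot R) (0, 1))) rot_affmap.
Qed.

Lemma swap_affmap : @swap2 R = affmap 0 1 0 1 0 0.
Proof. by apply/funext => -[x y]; rewrite /swap2 /affmap /=; congr pair; ring. Qed.

Lemma prehex_swap S : prehex S -> prehex (@swap2 R @^-1` S).
Proof.
move=> [c v i b]; rewrite swap_affmap; apply: prehex_affmap => //.
rewrite -swap_affmap; have [e1 e2 e3 e4 e5] := hexv.
by apply: (iter_rot_mod6 (P := fun x => bd S (swap2 x))) => /=; rewrite /swap2 /=; [rewrite -e5|rewrite -e4|rewrite -e3|rewrite -e2|rewrite -e1|rewrite -[(0, 1)]/(iter 0 (@rot R) (0, 1))].
Qed.

(** The vertices (-1,1) and (1,0) next to (0,1) lie on the same side of a supporting line there,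
    which forces its slope parameter into [0,1]. *)
Lemma prehex_supp1 S : prehex S -> supp1 S.
Proof.
move=> [c v i b]; have [e1 e2 e3 e4 e5] := hexv.
have k0 := b 0%N; split; first by case: k0.
have [p [q [pq H]]] := support_line v i k0.
have H1 := H _ (b 1%N).1; have H2 := H _ (b 2%N).1; have H3 := H _ (b 3%N).1; have H5 := H _ (b 5%N).1.
rewrite e1 /= in H1; rewrite e2 /= in H2; rewrite e3 /= in H3; rewrite e5 /= in H5.
have q0 : 0 < q.
  rewrite lt_neqAle; apply/andP; split; last lra.
  by apply/eqP => q_0; case: pq => /eqP; apply; lra.
exists (p / q); split.
- by apply: divr_ge0; lra.
- by rewrite ler_pdivrMr ?mul1r; lra.
- move=> P /H /=.
  have -> : p / q * P.1 + P.2 = (p * P.1 + q * P.2) / q by field; rewrite gt_eqF.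
  by rewrite ler_pdivrMr//; lra.
Qed.

Lemma prehex_hexbody S : prehex S -> hexbody S.
Proof.
move=> h; have [c v _ _] := h; split => // k.
by apply: prehex_supp1; exact: prehex_rotk.
Qed.

Lemma exists_prehex K : convex_body2 K -> exists a b e c d f : R,
  a * d - b * c != 0 /\ prehex (affmap a b e c d f @^-1` K).
Proof.
move=> [cK [vK K0]].
have [u [A [B [F [a [S o]]]]]] := exists_hexagon cK vK K0.
have [[bB bC bA bD bF] [bE a0 AB e]] := S.
(* The centre of the hexagon becomes the origin, the far end of the diagonal (1,0) and the far end
   of the top side (0,1). *)
exists (a * u.1), (B.1 - A.1), (A.1 + a * u.1), (a * u.2), (B.2 - A.2), (A.2 + a * u.2).
have D : a * u.1 * (B.2 - A.2) - (B.1 - A.1) * (a * u.2) = a * (lv u B - lv u A) by rewrite /lv; ring.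
have D0 : a * u.1 * (B.2 - A.2) - (B.1 - A.1) * (a * u.2) != 0 by rewrite D mulf_neq0 // gt_eqF // subr_gt0.
have u0 : u.1 ^+ 2 + u.2 ^+ 2 != 0.
  apply/eqP => /eqP; rewrite paddr_eq0 ?sqr_ge0// !sqrf_eq0 => /andP[/eqP h1 /eqP h2].
  by move: AB; rewrite /lv h1 h2 !mul0r ltxx.
have l : u.1 * (B.2 + F.2 - 2 * A.2 - a * u.2) - u.2 * (B.1 + F.1 - 2 * A.1 - a * u.1) = 0.
  by move: e; rewrite /lv; lra.
(* [off] is the component of this vector along [u]; the equal spacing of the levels annihilates the
   other component. *)
have w1 : B.1 + F.1 - 2 * A.1 - a * u.1 = 0.
  apply: (mulfI u0); rewrite mulr0.
  transitivity (u.1 * off u B A F a - u.2 * (u.1 * (B.2 + F.2 - 2 * A.2 - a * u.2) - u.2 * (B.1 + F.1 - 2 * A.1 - a * u.1))).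
    by rewrite /off; ring.
  by rewrite o l; ring.
have w2 : B.2 + F.2 - 2 * A.2 - a * u.2 = 0.
  apply: (mulfI u0); rewrite mulr0.
  transitivity (u.2 * off u B A F a + u.1 * (u.1 * (B.2 + F.2 - 2 * A.2 - a * u.2) - u.2 * (B.1 + F.1 - 2 * A.1 - a * u.1))).
    by rewrite /off; ring.
  by rewrite o l; ring.
split => //; apply: prehex_affmap => //.
have cg P Q : Q = P -> bd K P -> bd K Q by move=> ->.
apply: (iter_rot_mod6 (P := fun x => bd K (affmap (a * u.1) (B.1 - A.1) (A.1 + a * u.1) (a * u.2) (B.2 - A.2) (A.2 + a * u.2) x))).
- by apply: (cg _ _ _ bC); rewrite /affmap /sh /=; congr pair; ring.
- by apply: (cg _ _ _ bB); rewrite [RHS]surjective_pairing /affmap /=; congr pair; ring.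
- by apply: (cg _ _ _ bA); rewrite [RHS]surjective_pairing /affmap /=; congr pair; ring.
- by apply: (cg _ _ _ bF); rewrite [RHS]surjective_pairing /affmap /=; congr pair; lra.
- by apply: (cg _ _ _ bE); rewrite /affmap /sh /=; congr pair; lra.
- by apply: (cg _ _ _ bD); rewrite /affmap /sh /=; congr pair; ring.
Qed.

Lemma mble_gsym (a b : R) S : a ^+ 2 + a * b + b ^+ 2 = 1 -> mble S -> mble (gsym a b S).
Proof.
move=> ab1 mS; apply: (@mbleI _ S (gmap a b @^-1` S)) => //; rewrite gmap_affmap; apply: mble_affmap => //.
have -> : - b * b - a * (a + b) = - 1 by rewrite -ab1; ring.
by rewrite oppr_eq0 oner_eq0.
Qed.

(* The two signs belong to the two axes of the ellipse. *)
Definition gsym_large (a b : R) := forall S, prehex S ->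
  41 / 59 * area S <= area (gsym a b S) \/ 41 / 59 * area S <= area (gsym (- a) (- b) S).

Lemma gsym_largeN a b : gsym_large a b -> gsym_large (- a) (- b).
Proof. by move=> H S hS; rewrite !opprK; have [] := H S hS; [right|left]. Qed.

(** Conjugation by a rotation by 60 degrees turns the parameter (a, b) by 120 degrees. *)
Lemma gsym_large_rot (a b : R) : a ^+ 2 + a * b + b ^+ 2 = 1 -> gsym_large b (- (a + b)) -> gsym_large a b.
Proof.
move=> ab1 H S hS; have [c v i bb] := hS.
have mS : mble S by exact: mble_compact.
have bS : bdd S by exact: bdd_compact.
have := H _ (prehex_rotk 1 hS); rewrite area_rotk//.
have e x y : x ^+ 2 + x * y + y ^+ 2 = 1 -> gsym y (- (x + y)) (rotk 1 S) = rotk 1 (gsym x y S).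
  move=> xy1; apply/seteqP; rewrite /gsym /rotk /=.
  have g P : rot (gmap y (- (x + y)) P) = gmap x y (rot P) by rewrite /gmap /rot /=; congr pair; ring.
  by split => P /=; rewrite g.
have ab1' : (- a) ^+ 2 + (- a) * (- b) + (- b) ^+ 2 = 1 by rewrite -ab1; ring.
rewrite e//.
have -> : - - (a + b) = - (- a + - b) by ring.
rewrite e// !area_rotk//; first [exact: mble_gsym | by apply: bdd_sub bS => x []].
Qed.

(** Conjugation by the reflection [swap2] reverses the angle of (a, b). *)
Lemma gsym_large_swap (a b : R) : a ^+ 2 + a * b + b ^+ 2 = 1 -> gsym_large (a + b) (- b) -> gsym_large a b.
Proof.
move=> ab1 H S hS; have [c v i bb] := hS.
have mS : mble S by exact: mble_compact.
have bS : bdd S by exact: bdd_compact.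
have := H _ (prehex_swap hS); rewrite lam2_swap_area//.
have e x y : gsym (x + y) (- y) (@swap2 R @^-1` S) = @swap2 R @^-1` (gsym x y S).
  apply/seteqP; rewrite /gsym /=.
  have g P : swap2 (gmap (x + y) (- y) P) = gmap x y (swap2 P) by rewrite /gmap /swap2 /=; congr pair; ring.
  by split => P /=; rewrite g.
have ab1' : (- a) ^+ 2 + (- a) * (- b) + (- b) ^+ 2 = 1 by rewrite -ab1; ring.
rewrite e; have -> : - (a + b) = - a + - b by ring.
rewrite e !lam2_swap_area//; first [exact: mble_gsym | by apply: bdd_sub bS => x []].
Qed.

(* The symmetries of the hexagon together with the sign move (a, b) into the sector 0 <= b <= a of 30 degrees. *)
Lemma gsym_largeT (a b : R) : a ^+ 2 + a * b + b ^+ 2 = 1 -> gsym_large a b.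
Proof.
have H1 (x y : R) : x ^+ 2 + x * y + y ^+ 2 = 1 -> 0 <= y -> y <= x -> gsym_large x y.
  by move=> xy1 y0 yx S hS; left; apply: area_gsym_ge => //; exact: prehex_hexbody.
have H2 (x y : R) : x ^+ 2 + x * y + y ^+ 2 = 1 -> y <= x -> 0 <= x + 2 * y -> gsym_large x y.
  move=> xy1 yx xy; have [y0|y0] := leP 0 y; first exact: H1.
  by apply: gsym_large_swap => //; apply: H1; [rewrite -xy1; ring|lra|lra].
have H3 (x y : R) : x ^+ 2 + x * y + y ^+ 2 = 1 -> 2 * x + y <= 0 -> 0 <= x + 2 * y -> gsym_large x y.
  by move=> xy1 yx xy; apply: gsym_large_rot => //; apply: H2; [rewrite -xy1; ring|lra|lra].
have H4 (x y : R) : x ^+ 2 + x * y + y ^+ 2 = 1 -> 0 <= x + 2 * y -> gsym_large x y.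
  move=> xy1 xy; have [yx|yx] := leP y x; first exact: H2.
  have [h|h] := leP (2 * x + y) 0; first exact: H3.
  apply: gsym_large_rot => //; rewrite -[y in gsym_large y _]opprK; apply: gsym_largeN.
  by apply: H3; [rewrite -xy1; ring|lra|lra].
move=> ab1; have [h|h] := leP 0 (a + 2 * b); first exact: H4.
rewrite -[a]opprK -[b]opprK; apply: gsym_largeN.
by apply: H4; [rewrite -ab1; ring|lra].
Qed.

(** For r = p/q this is a quadratic equation whose roots have product -1: they are real and belong
    to perpendicular directions. *)
Lemma unit_root (al be : R) : exists p q : R, p ^+ 2 + q ^+ 2 = 1 /\ al * (p ^+ 2 - q ^+ 2) + be * (p * q) = 0.
Proof.
have [->|al0] := eqVneq al 0; first by exists 1, 0; split; ring.
have [w sD] : exists w : R, w ^+ 2 = be ^+ 2 + 4 * al ^+ 2.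
  by exists (Num.sqrt (be ^+ 2 + 4 * al ^+ 2)); rewrite sqr_sqrtr// addr_ge0 ?sqr_ge0// mulr_ge0 ?sqr_ge0.
have [r rE] : exists r, r = (- be + w) / (2 * al) by eexists.
have re : al * (r ^+ 2 - 1) + be * r = 0.
  have -> : al * (r ^+ 2 - 1) + be * r = (w ^+ 2 - (be ^+ 2 + 4 * al ^+ 2)) / (4 * al) by rewrite rE; field.
  by rewrite sD subrr mul0r.
have n0 : 0 < 1 + r ^+ 2 by rewrite ltr_wpDr// sqr_ge0.
have [v v0 sn] : exists2 v : R, v != 0 & v ^+ 2 = 1 + r ^+ 2.
  exists (Num.sqrt (1 + r ^+ 2)); first by rewrite gt_eqF// sqrtr_gt0.
  by rewrite sqr_sqrtr// ltW.
exists (r / v), (1 / v); split.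
  by rewrite !expr_div_n sn; field; rewrite gt_eqF.
transitivity ((al * (r ^+ 2 - 1) + be * r) / v ^+ 2); first by field.
by rewrite re mul0r.
Qed.

End Prehex.

(** * Reflections in lines and the lower bound *)

Section Lower.
Variables (R : realType).
Implicit Types (K S : set (R * R)) (P Q : R * R).

Lemma refl_lineK (a b c : R) : a ^+ 2 + b ^+ 2 = 1 -> involutive (refl_line a b c).
Proof.
move=> ab [x y]; rewrite /refl_line /=.
have e : a * (x - 2 * (a * x + b * y - c) * a) + b * (y - 2 * (a * x + b * y - c) * b) - c =
   (a * x + b * y - c) * (1 - 2 * (a ^+ 2 + b ^+ 2)) by ring.
by rewrite e ab; congr pair; ring.
Qed.

Lemma refl_line_image (a b c : R) K : a ^+ 2 + b ^+ 2 = 1 -> refl_line a b c @` K = refl_line a b c @^-1` K.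
Proof.
move=> ab; apply/seteqP; split => x /=.
  by move=> [y Ky <-]; rewrite refl_lineK.
by move=> Kx; exists (refl_line a b c x) => //; rewrite refl_lineK.
Qed.

Lemma refl_affmap (a b c : R) :
  refl_line a b c = affmap (1 - 2 * a ^+ 2) (- 2 * a * b) (2 * a * c) (- 2 * a * b) (1 - 2 * b ^+ 2) (2 * b * c).
Proof. by apply/funext => -[x y]; rewrite /refl_line /affmap /=; congr pair; ring. Qed.

Lemma refl_det (a b : R) : a ^+ 2 + b ^+ 2 = 1 ->
  (1 - 2 * a ^+ 2) * (1 - 2 * b ^+ 2) - (- 2 * a * b) * (- 2 * a * b) = - 1.
Proof.
move=> ab; transitivity (1 - 2 * (a ^+ 2 + b ^+ 2)); first by ring.
by rewrite ab; ring.
Qed.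

Lemma mble_refl (a b c : R) K : a ^+ 2 + b ^+ 2 = 1 -> mble K -> mble (refl_line a b c @^-1` K).
Proof.
move=> ab mK; rewrite refl_affmap; apply: mble_affmap => //.
by rewrite refl_det// oppr_eq0 oner_eq0.
Qed.

Definition overlap K (a b c : R) := area (K `&` (refl_line a b c @^-1` K)).

Lemma sym1_ratiosE K : sym1_ratios K = [set r | exists a b c : R, a ^+ 2 + b ^+ 2 = 1 /\ r = overlap K a b c / area K].
Proof.
by apply/seteqP; split => r /= [a [b [c [ab ->]]]]; exists a, b, c; split => //;
  rewrite /overlap /area /= refl_line_image.
Qed.

Lemma overlap_le K (a b c : R) : mble K -> bdd K -> a ^+ 2 + b ^+ 2 = 1 -> overlap K a b c <= area K.
Proof. by move=> mK bK ab; apply: area_mono => //; apply: mbleI => //; exact: mble_refl. Qed.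

Lemma has_sup_sym1 K : mble K -> bdd K -> 0 < area K -> has_sup (sym1_ratios K).
Proof.
move=> mK bK aK; rewrite sym1_ratiosE; split.
  by exists (overlap K 1 0 0 / area K); exists 1, 0, 0; split => //; ring.
exists 1 => r [a [b [c [ab ->]]]].
by rewrite ler_pdivrMr// mul1r overlap_le.
Qed.

Lemma Sym1_ge K (a b c r : R) : mble K -> bdd K -> 0 < area K -> a ^+ 2 + b ^+ 2 = 1 ->
  r * area K <= overlap K a b c -> r <= Sym1 K.
Proof.
move=> mK bK aK ab h; apply: le_trans (_ : overlap K a b c / area K <= _); first by rewrite ler_pdivlMr.
apply: sup_upper_bound; first exact: has_sup_sym1.
by rewrite sym1_ratiosE; exists a, b, c.
Qed.

Lemma Sym1_le K (r : R) : mble K -> bdd K -> 0 < area K ->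
  (forall a b c : R, a ^+ 2 + b ^+ 2 = 1 -> overlap K a b c <= r * area K) -> Sym1 K <= r.
Proof.
move=> mK bK aK H; apply: ge_sup; first by case: (has_sup_sym1 mK bK aK).
by rewrite sym1_ratiosE => _ [a [b [c [ab ->]]]]; rewrite ler_pdivrMr// H.
Qed.

(* The lines through the centre in the directions of the principal axes of the image of the hexagon's norm: their
   reflections preserve that norm. [unit_root] solves the eigenvector equation. *)
Lemma refl_hexframe (n11 n12 e1 n21 n22 e2 : R) : n11 * n22 - n12 * n21 != 0 ->
  exists p q a b : R, [/\ p ^+ 2 + q ^+ 2 = 1, a ^+ 2 + a * b + b ^+ 2 = 1 &
    forall s : R, (s = 1 \/ s = - 1) -> exists p' q' : R, p' ^+ 2 + q' ^+ 2 = 1 /\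
      forall x, refl_line p' q' (p' * e1 + q' * e2) (affmap n11 n12 e1 n21 n22 e2 x) =
         affmap n11 n12 e1 n21 n22 e2 (gmap (s * a) (s * b) x)].
Proof.
pose fr := affmap n11 n12 e1 n21 n22 e2; rewrite -/fr => D0.
have [p [q [pq E]]] := unit_root (n11 * (n22 - 2 * n21) - n12 * (2 * n22 - n21))
   (n11 * (- n12 + 2 * n11) - n12 * (- 2 * n12 + n11) + n21 * (n22 - 2 * n21) - n22 * (2 * n22 - n21)).
have [D DE] : exists D, D = n11 * n22 - n12 * n21 by eexists.
rewrite -DE in D0.
(* In the coordinates of the frame the reflection is x - 2 (s . x) m with s . m = 1. [star] says
   that the functional s is proportional to the pairing with m in the form x^2 + xy + y^2, so the
   reflection preserves this form. *)
have [s1 s1E] : exists s, s = p * n11 + q * n21 by eexists.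
have [s2 s2E] : exists s, s = p * n12 + q * n22 by eexists.
have [m1 m1E] : exists m, m = (n22 * p - n12 * q) / D by eexists.
have [m2 m2E] : exists m, m = (- n21 * p + n11 * q) / D by eexists.
have nm1 : n11 * m1 + n12 * m2 = p.
  transitivity (p * (n11 * n22 - n12 * n21) / D); first by rewrite m1E m2E; field.
  by rewrite -DE mulfK.
have nm2 : n21 * m1 + n22 * m2 = q.
  transitivity (q * (n11 * n22 - n12 * n21) / D); first by rewrite m1E m2E; field.
  by rewrite -DE mulfK.
have sm : s1 * m1 + s2 * m2 = 1.
  transitivity (p * (n11 * m1 + n12 * m2) + q * (n21 * m1 + n22 * m2)); first by rewrite s1E s2E; ring.
  by rewrite nm1 nm2 -pq; ring.
have star : s1 * (m1 + 2 * m2) = s2 * (2 * m1 + m2).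
  apply: (mulIf D0); apply/eqP; rewrite -subr_eq0; apply/eqP.
  by rewrite -[RHS]E s1E s2E m1E m2E; field.
have eq1 : 2 * s1 * (m1 ^+ 2 + m1 * m2 + m2 ^+ 2) = 2 * m1 + m2.
  transitivity ((s1 * m1 + s2 * m2) * (2 * m1 + m2) + m2 * (s1 * (m1 + 2 * m2) - s2 * (2 * m1 + m2))); first by ring.
  by rewrite sm star subrr; ring.
have eq2 : 2 * s2 * (m1 ^+ 2 + m1 * m2 + m2 ^+ 2) = m1 + 2 * m2.
  transitivity ((s1 * m1 + s2 * m2) * (m1 + 2 * m2) - m1 * (s1 * (m1 + 2 * m2) - s2 * (2 * m1 + m2))); first by ring.
  by rewrite sm star subrr; ring.
have ab : (- 2 * s2 * m1) ^+ 2 + (- 2 * s2 * m1) * (1 - 2 * s2 * m2) + (1 - 2 * s2 * m2) ^+ 2 = 1.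
  transitivity (2 * s2 * (2 * s2 * (m1 ^+ 2 + m1 * m2 + m2 ^+ 2) - (m1 + 2 * m2)) + 1); first by ring.
  by rewrite eq2 subrr mulr0 add0r.
have b1 : 1 - 2 * s1 * m1 = - (1 - 2 * s2 * m2) by move: sm; lra.
have b2 : - 2 * s1 * m2 = - 2 * s2 * m1 + (1 - 2 * s2 * m2) by move: sm star; lra.
have main x : (fr x).1 - 2 * (s1 * x.1 + s2 * x.2) * p =
    (fr (gmap (- 2 * s2 * m1) (1 - 2 * s2 * m2) x)).1 /\
  (fr x).2 - 2 * (s1 * x.1 + s2 * x.2) * q =
    (fr (gmap (- 2 * s2 * m1) (1 - 2 * s2 * m2) x)).2.
  have -> : gmap (- 2 * s2 * m1) (1 - 2 * s2 * m2) x =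
     (x.1 - 2 * (s1 * x.1 + s2 * x.2) * m1, x.2 - 2 * (s1 * x.1 + s2 * x.2) * m2).
    rewrite /gmap; congr pair.
      transitivity (- 2 * s2 * m1 * x.2 + (1 - 2 * s1 * m1) * x.1); last by ring.
      by rewrite b1; ring.
    transitivity ((1 - 2 * s2 * m2) * x.2 + (- 2 * s1 * m2) * x.1); last by ring.
    by rewrite b2.
  by rewrite /fr /affmap /= -nm1 -nm2; split; ring.
exists p, q, (- 2 * s2 * m1), (1 - 2 * s2 * m2); split => // s [->|->].
  exists p, q; split => // x; rewrite !mul1r.
  have [h1 h2] := main x; rewrite [RHS]surjective_pairing -h1 -h2 /refl_line.
  have -> : p * (fr x).1 + q * (fr x).2 - (p * e1 + q * e2) =
     s1 * x.1 + s2 * x.2 by rewrite /fr /affmap /= s1E s2E; ring.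
  by [].
(* The perpendicular axis through the same centre: its reflection is the first one followed by a
   half-turn. *)
exists (- q), p; split; first by rewrite -pq; ring.
move=> x; have [h1 h2] := main x.
have [r rE] : exists r, r = s1 * x.1 + s2 * x.2 by eexists.
have rr : p * (n11 * x.1 + n12 * x.2) + q * (n21 * x.1 + n22 * x.2) = r by rewrite rE s1E s2E; ring.
rewrite -rE in h1 h2.
have g1 : (fr (gmap (-1 * (- 2 * s2 * m1)) (-1 * (1 - 2 * s2 * m2)) x)).1 =
  2 * e1 - ((fr x).1 - 2 * r * p).
  by rewrite h1 /fr /affmap /gmap /=; ring.
have g2 : (fr (gmap (-1 * (- 2 * s2 * m1)) (-1 * (1 - 2 * s2 * m2)) x)).2 =
  2 * e2 - ((fr x).2 - 2 * r * q).
  by rewrite h2 /fr /affmap /gmap /=; ring.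
rewrite [RHS]surjective_pairing g1 g2 /refl_line /fr /affmap /=.
move: rr; move: (n11 * x.1 + n12 * x.2) (n21 * x.1 + n22 * x.2) => X Y rr.
congr pair.
  transitivity (X + e1 - 2 * ((p ^+ 2 + q ^+ 2) * X - p * (p * X + q * Y))); first by ring.
  by rewrite pq rr; ring.
transitivity (Y + e2 - 2 * ((p ^+ 2 + q ^+ 2) * Y - q * (p * X + q * Y))); first by ring.
by rewrite pq rr; ring.
Qed.

Lemma hexbody_area_gt0 S : hexbody S -> 0 < area S.
Proof.
move=> hS; rewrite (area_sectors (hex_mble hS) (hex_bdd hS)).
have c k : 1 / 2 <= area (rotk k S `&` @C0 R).
  have := cap_ge0 (hexbody_rotk k hS); rewrite /cap.
  by move: (area _) => A; lra.
by rewrite big_ord_recl /= ltr_pwDl//; [apply: lt_le_trans (c 0%N); lra|apply: sumr_ge0 => i _; exact: area_ge0].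
Qed.

Lemma body_area_gt0 K : convex_body2 K -> 0 < area K.
Proof.
move=> cvK; have [a [b [e [c [d [f [D0 hS]]]]]]] := exists_prehex cvK; have [cK _] := cvK.
rewrite -(area_affmap e f D0 (mble_compact cK) (bdd_compact cK)) mulr_gt0 ?normr_gt0//.
by apply: hexbody_area_gt0; exact: prehex_hexbody.
Qed.

Theorem Sym1_lower K : convex_body2 K -> 41 / 59 <= Sym1 K.
Proof.
move=> cvK; have [n11 [n12 [e1 [n21 [n22 [e2 [D0 hS]]]]]]] := exists_prehex cvK; have [cK _] := cvK.
have mK := mble_compact cK; have bK := bdd_compact cK.
have [p [q [a [b [pq ab H]]]]] := refl_hexframe e1 e2 D0.
have aK := area_affmap e1 e2 D0 mK bK.
have G (s : R) : s = 1 \/ s = - 1 -> 41 / 59 * area (affmap n11 n12 e1 n21 n22 e2 @^-1` K) <=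
    area (gsym (s * a) (s * b) (affmap n11 n12 e1 n21 n22 e2 @^-1` K)) -> 41 / 59 <= Sym1 K.
  move=> hs h; have [p' [q' [pq' Hx]]] := H s hs.
  apply: (@Sym1_ge K p' q' (p' * e1 + q' * e2)) => //; first exact: body_area_gt0.
  have m : mble (K `&` (refl_line p' q' (p' * e1 + q' * e2) @^-1` K)) by apply: mbleI => //; exact: mble_refl.
  have bb : bdd (K `&` (refl_line p' q' (p' * e1 + q' * e2) @^-1` K)) by apply: bdd_sub bK => x [].
  rewrite /overlap -aK -(area_affmap e1 e2 D0 m bb) mulrCA ler_wpM2l//.
  apply: le_trans h _; apply: eq_ler; congr area.
  by apply/seteqP; split => x /=; rewrite /gsym /= Hx.
have [h|h] := gsym_largeT ab hS; [apply: (G 1); first by left|apply: (G (- 1)); first by right].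
  by rewrite !mul1r.
by rewrite !mulN1r.
Qed.

Lemma lower_const : 2 / 41 * (10 + 3 * Num.sqrt 2) <= 41 / 59 :> R.
Proof.
have h0 : 0 <= Num.sqrt 2 :> R by exact: sqrtr_ge0.
have : Num.sqrt 2 ^+ 2 = 2 :> R by rewrite sqr_sqrtr.
move: h0; move: (Num.sqrt 2) => s s0; rewrite expr2 => s2.
(* A rational upper bound for sqrt 2 that is still small enough for the comparison with 41/59. *)
have h : s <= 58 / 41.
  rewrite leNgt; apply/negP => h.
  have : (58 / 41) * (58 / 41) < s * s by rewrite ltr_pM//; lra.
  by rewrite s2; lra.
by lra.
Qed.

End Lower.

(** * Thin quadrilaterals *)

Section Symmetrized.
Variables (R : realType).
Implicit Types (A Q : set (R * R)) (P : R * R).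

Lemma area_sym_between A (p q a b : R) : p <= q -> mble A -> bdd A ->
  (forall P, A P -> [/\ p <= P.1, P.1 <= q, - (a * P.1 + b) <= P.2 & P.2 <= a * P.1 + b]) ->
  0 <= a * p + b -> 0 <= a * q + b ->
  area A <= (q - p) * (a * (p + q) + 2 * b).
Proof.
move=> pq mA bA H gp gq.
have -> : (q - p) * (a * (p + q) + 2 * b) = (q - p) * ((a - - a) * (p + q) / 2 + (b - - b)) by field.
apply: area_between => //; [|lra|lra].
by move=> P /H [h1 h2 h3 h4]; split => //; lra.
Qed.

Lemma area_ge_between A (p q a b : R) : p <= q -> mble A -> bdd A ->
  (forall P, p <= P.1 -> P.1 <= q -> 0 <= P.2 -> P.2 <= a * P.1 + b -> A P) ->
  0 <= a * p + b -> 0 <= a * q + b ->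
  (q - p) * (a * (p + q) / 2 + b) <= area A.
Proof.
move=> pq mA bA H gp gq; rewrite -lee_fin areaE//.
have g x : p <= x <= q -> 0 <= a * x + b.
  move=> /andP[px xq]; have [h|h] := leP 0 a.
    have : 0 <= a * (x - p) by rewrite mulr_ge0; lra.
    by lra.
  have : 0 <= - a * (q - x) by rewrite mulr_ge0; lra.
  by lra.
apply: lam2_ge_sections => // x xpq; have gx := g x xpq; case/andP: xpq => px xq.
apply: (@le_trans _ _ (@lebesgue_measure R [set` `[0, (a * x + b)]%R])).
  rewrite lebesgue_measure_itv/= lte_fin; case: ifPn => [_|]; first by rewrite -EFinD subr0.
  by rewrite -leNgt lee_fin.
apply: le_measure; rewrite ?inE; [exact: measurable_itv|exact: measurable_xsection|].
by move=> y /=; rewrite in_itv/= => /andP[y0 y1]; apply/xsectionP; exact: H.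
Qed.

Definition axisym Q : set (R * R) := [set P | Q P /\ Q (P.1, - P.2)].

Lemma flip_affmap : (fun P : R * R => (P.1, - P.2)) = affmap 1 0 0 0 (-1) 0.
Proof. by apply/funext => -[x y]; rewrite /affmap /=; congr pair; ring. Qed.

Lemma axisymE Q : axisym Q = Q `&` (affmap 1 0 0 0 (-1) 0 @^-1` Q).
Proof. by rewrite -flip_affmap. Qed.

Lemma compact_axisym Q : compact Q -> compact (axisym Q).
Proof.
move=> cQ; rewrite axisymE; apply: compact_closedI => //; apply: compact2_closed.
by apply: compact_affmap => //; rewrite mul1r mul0r subr0 oppr_eq0 oner_eq0.
Qed.

Lemma area_eq0_set0 A : ~ (A !=set0) -> area A = 0.
Proof.
move=> h; have -> : A = set0.
  by rewrite -subset0 => P AP; apply: h; exists P.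
by rewrite /area /lam2 measure0.
Qed.

(* The set is symmetric about the first axis; on the outer quarters of its projection it is bounded by the two upper
   lines, on the inner half by the lower line. The inner and outer integrals of the latter agree. *)
Lemma area_axisym_le Q (l1 l0 u1 u0 v1 v0 : R) : compact Q ->
  (forall P, Q P -> [/\ l1 * P.1 + l0 <= P.2, P.2 <= u1 * P.1 + u0 & P.2 <= v1 * P.1 + v0]) ->
  area (axisym Q) = 0 \/ exists s t : R, [/\ s <= t,
    0 <= (u1 - l1) * s + (u0 - l0) /\ 0 <= (u1 - l1) * t + (u0 - l0),
    0 <= (v1 - l1) * s + (v0 - l0) /\ 0 <= (v1 - l1) * t + (v0 - l0) &
    area (axisym Q) <= (t - s) / 2 * ((u1 - l1) * (s + (t - s) / 8) + (u0 - l0) + ((v1 - l1) * (t - (t - s) / 8) + (v0 - l0)))].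
Proof.
move=> cQ H; have [A0|A0] := pselect (axisym Q !=set0); last by left; exact: area_eq0_set0.
right; have cA := compact_axisym cQ.
have cf : {within axisym Q, continuous (@fst R R)} by apply: continuous_subspaceT => x; exact: cvg_fst.
have [S /set_mem AS HS] := compact_EVT_min A0 cA cf.
have [T /set_mem AT HT] := compact_EVT_max A0 cA cf.
have axis P : axisym Q P -> [/\ l1 * P.1 + l0 <= 0, 0 <= u1 * P.1 + u0 & 0 <= v1 * P.1 + v0].
  by move=> [/H[h1 h2 h3] /H[/= k1 k2 k3]]; split; lra.
have inA P : axisym Q P -> [/\ S.1 <= P.1, P.1 <= T.1 & [/\ l1 * P.1 + l0 <= P.2, P.2 <= - (l1 * P.1 + l0),
    - (u1 * P.1 + u0) <= P.2, P.2 <= u1 * P.1 + u0 & - (v1 * P.1 + v0) <= P.2 /\ P.2 <= v1 * P.1 + v0]].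
  move=> AP; have PA : P \in axisym Q by rewrite inE.
  have hS := HS _ PA; have hT := HT _ PA.
  by move: AP => [/H[h1 h2 h3] /H[/= k1 k2 k3]]; do !split => //; lra.
have ST : S.1 <= T.1 by apply: HS; rewrite inE.
have [s1 s2 s3] := axis S AS; have [t1 t2 t3] := axis T AT.
move: S.1 T.1 ST inA s1 s2 s3 t1 t2 t3 {HS HT AS AT} => s t st inA s1 s2 s3 t1 t2 t3.
exists s, t; split; [by []|by split; lra|by split; lra|].
have mA := mble_compact cA; have bA := bdd_compact cA.
have [d dE] : exists d, d = (t - s) / 4 by eexists.
have tE : t = s + 4 * d by lra.
have d0 : 0 <= d by lra.
have between (a b x : R) : 0 <= a * s + b -> 0 <= a * t + b -> s <= x -> x <= t -> 0 <= a * x + b.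
  move=> h1 h2 h3 h4; have [h|h] := leP 0 a.
    have : 0 <= a * (x - s) by rewrite mulr_ge0; lra.
    by lra.
  have : 0 <= - a * (t - x) by rewrite mulr_ge0; lra.
  by lra.
have mle (a : R) := mble_le1 a.
have pts : [/\ s <= s + d, s + d <= s + 3 * d & s + 3 * d <= t] by split; lra.
have pts2 : s + d <= t /\ s <= s + 3 * d by split; lra.
have l0' x : s <= x -> x <= t -> 0 <= - l1 * x + - l0 by apply: between; lra.
have u0' x : s <= x -> x <= t -> 0 <= u1 * x + u0 by apply: between.
have v0' x : s <= x -> x <= t -> 0 <= v1 * x + v0 by apply: between.
have inA' P : axisym Q P -> - (- l1 * P.1 + - l0) <= P.2 /\ P.2 <= - l1 * P.1 + - l0.
  by move=> /inA[_ _ [h1 h2 _ _ _]]; lra.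
have [[pt1 pt2 pt3] [pt4 pt5]] := (pts, pts2).
have mA2 : mble (axisym Q `&` ~` [set x | x.1 <= s + d]) by apply: mbleI => //; exact: mbleC.
have bA2 : bdd (axisym Q `&` ~` [set x | x.1 <= s + d]) by apply: bdd_sub bA => x [].
have h1 : area (axisym Q `&` [set x | x.1 <= s + d]) <= (s + d - s) * (u1 * (s + (s + d)) + 2 * u0).
  apply: area_sym_between => //; [exact: mbleI|by apply: bdd_sub bA => x []| |exact: u0'].
  by move=> P [/inA[q1 q2 [_ _ q5 q6 _]] /= q9].
have h3 : area (axisym Q `&` ~` [set x | x.1 <= s + d] `&` [set x | x.1 <= s + 3 * d]) <=
    (s + 3 * d - (s + d)) * (- l1 * (s + d + (s + 3 * d)) + 2 * - l0).
  apply: area_sym_between => //; [exact: mbleI|by apply: bdd_sub bA2 => x []| |exact: l0'|exact: l0'].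
  by move=> P [[/inA'[q3 q4] /= /negP]]; rewrite -ltNge => /ltW q9 q10.
have h4 : area (axisym Q `&` ~` [set x | x.1 <= s + d] `&` ~` [set x | x.1 <= s + 3 * d]) <=
    (t - (s + 3 * d)) * (v1 * (s + 3 * d + t) + 2 * v0).
  apply: area_sym_between => //; [by apply: mbleI => //; exact: mbleC|by apply: bdd_sub bA2 => x []| |exact: v0'].
  by move=> P [[/inA[q1 q2 [_ _ _ _ [q7 q8]]] _] /= /negP]; rewrite -ltNge => /ltW q10.
rewrite (area_split mA (mle (s + d)) bA) (area_split mA2 (mle (s + 3 * d)) bA2).
apply: le_trans (lerD h1 (lerD h3 h4)) _.
by apply: eq_ler; rewrite tE; field.
Qed.

End Symmetrized.

(** * Coordinates adapted to the mirror line; crossing strips *)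

Section Mirror.
Variables (R : realType).
Implicit Types (A Q K : set (R * R)) (P : R * R).

Definition axisym2 Q : set (R * R) := [set P | Q P /\ Q (- P.1, P.2)].

Lemma compact_axisym2 Q : compact Q -> compact (axisym2 Q).
Proof.
have E : (fun P : R * R => (- P.1, P.2)) = affmap (-1) 0 0 0 1 0.
  by apply/funext => -[x y]; rewrite /affmap /=; congr pair; ring.
move=> cQ; have -> : axisym2 Q = Q `&` (affmap (-1) 0 0 0 1 0 @^-1` Q) by rewrite -E.
apply: compact_closedI => //; apply: compact2_closed.
by apply: compact_affmap => //; rewrite mulr1 mul0r subr0 oppr_eq0 oner_eq0.
Qed.

(** For the point farthest from the mirror, the trapezoid over the abscissas from 0 to [P.1] bounds
    one half, and the same bound serves its mirror image. The point is returned because it restricts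
    the position of the mirror in [thin_vert]. *)
Lemma area_axisym2_le Q (l1 l0 u1 u0 : R) : compact Q ->
  (forall P, Q P -> l1 * P.1 + l0 <= P.2 /\ P.2 <= u1 * P.1 + u0) ->
  area (axisym2 Q) = 0 \/ exists P, [/\ axisym2 Q P, 0 <= P.1, 0 <= (u1 - l1) * P.1 + (u0 - l0) &
    area (axisym2 Q) <= 2 * P.1 * ((u1 - l1) * P.1 / 2 + (u0 - l0))].
Proof.
move=> cQ H; have [A0|A0] := pselect (axisym2 Q !=set0); last by left; exact: area_eq0_set0.
right; have cA := compact_axisym2 cQ.
have cf : {within axisym2 Q, continuous (@fst R R)} by apply: continuous_subspaceT => x; exact: cvg_fst.
have [S /set_mem AS HS] := compact_EVT_max A0 cA cf.
have AS' : axisym2 Q (- S.1, S.2).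
  by case: AS => h1 h2; split => //=; rewrite opprK -surjective_pairing.
have S0 : 0 <= S.1 by have := HS (- S.1, S.2); rewrite inE => /(_ AS') /=; lra.
exists S; have [gS1 gS2] := H _ AS.1.
have g0 : 0 <= (u0 - l0).
  by have [] := H _ AS.1; have [] := H _ AS.2; rewrite /=; lra.
have gS : 0 <= (u1 - l1) * S.1 + (u0 - l0) by lra.
split => //.
have mA := mble_compact cA; have bA := bdd_compact cA.
have inA P : axisym2 Q P -> P.1 <= S.1 /\ - S.1 <= P.1.
  move=> AP; have PA : P \in axisym2 Q by rewrite inE.
  have PA' : (- P.1, P.2) \in axisym2 Q.
    by rewrite inE; case: AP => h1 h2; split => //=; rewrite opprK -surjective_pairing.
  by split; [exact: HS|rewrite lerNl; exact: (HS (- P.1, P.2))].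
move: S.1 S0 inA gS {AS AS' HS gS1 gS2} => s s0 inA gs.
have h1 : area (axisym2 Q `&` [set x | x.1 <= 0]) <= (0 - - s) * ((- u1 - - l1) * (- s + 0) / 2 + (u0 - l0)).
  apply: area_between; [lra|by apply: mbleI => //; exact: mble_le1|by apply: bdd_sub bA => x []| |lra|lra].
  move=> P [AP /= p0]; have [i1 i2] := inA _ AP; have [h1 h2] := H _ AP.2.
  by move: h1 h2 => /=; split => //; lra.
have h2 : area (axisym2 Q `&` ~` [set x | x.1 <= 0]) <= (s - 0) * ((u1 - l1) * (0 + s) / 2 + (u0 - l0)).
  apply: area_between; [lra|by apply: mbleI => //; apply: mbleC; exact: mble_le1|by apply: bdd_sub bA => x []| |lra|lra].
  move=> P [AP /= /negP]; rewrite -ltNge => /ltW p0; have [i1 i2] := inA _ AP; have [h3 h4] := H _ AP.1.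
  by split.
rewrite (area_split mA (mble_le1 0) bA); apply: le_trans (lerD h1 h2) _.
by apply: eq_ler; field.
Qed.

Lemma overlap_isometry K (a b c p q r p' q' r' : R) (g : R * R -> R * R) : compact K -> a ^+ 2 + b ^+ 2 = 1 ->
  p * q' - q * p' = 1 -> (forall P, refl_line a b c (affmap p q r p' q' r' P) = affmap p q r p' q' r' (g P)) ->
  overlap K a b c = area [set P | K (affmap p q r p' q' r' P) /\ K (affmap p q r p' q' r' (g P))].
Proof.
move=> cK ab D H; have D0 : p * q' - q * p' != 0 by rewrite D oner_eq0.
have mK := mble_compact cK.
rewrite /overlap -(area_affmap r r' D0).
- by rewrite D normr1 mul1r; congr area; apply/seteqP; split => P; rewrite /= H.
- by apply: mbleI => //; exact: (@mble_refl _ a b c K ab).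
- by apply: bdd_sub (bdd_compact cK) => x [].
Qed.

Lemma overlap_rot1 K (a b c : R) : compact K -> a ^+ 2 + b ^+ 2 = 1 ->
  overlap K a b c = area (axisym (affmap b a (a * c) (- a) b (b * c) @^-1` K)).
Proof.
move=> cK ab; apply: (overlap_isometry cK ab) => [|P]; first by rewrite -ab; ring.
have e1 : a * (b * P.1 + a * P.2 + a * c) + b * (- a * P.1 + b * P.2 + b * c) - c = P.2.
  transitivity ((a ^+ 2 + b ^+ 2) * P.2 + (a ^+ 2 + b ^+ 2) * c - c); first by ring.
  by rewrite ab; ring.
by rewrite /refl_line /affmap /= e1; congr pair; ring.
Qed.

Lemma overlap_rot2 K (a b c : R) : compact K -> a ^+ 2 + b ^+ 2 = 1 ->
  overlap K a b c = area (axisym2 (affmap a (- b) (a * c) b a (b * c) @^-1` K)).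
Proof.
move=> cK ab; apply: (overlap_isometry cK ab) => [|P]; first by rewrite -ab; ring.
have e1 : a * (a * P.1 + - b * P.2 + a * c) + b * (b * P.1 + a * P.2 + b * c) - c = P.1.
  transitivity ((a ^+ 2 + b ^+ 2) * P.1 + (a ^+ 2 + b ^+ 2) * c - c); first by ring.
  by rewrite ab; ring.
by rewrite /refl_line /affmap /= e1; congr pair; ring.
Qed.

Lemma overlapN K (a b c : R) : overlap K (- a) (- b) (- c) = overlap K a b c.
Proof.
rewrite /overlap; have -> // : refl_line (- a) (- b) (- c) = refl_line a b c.
by apply/funext => x; rewrite /overlap /refl_line; congr pair; ring.
Qed.

(** On the overlap both the ordinate of a point and that of its mirror image lie in [0, h]; the map
    to these two ordinates has determinant -2ab. *)
Lemma overlap_strip K (a b c h : R) : mble K -> bdd K -> a ^+ 2 + b ^+ 2 = 1 -> 0 <= h ->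
  (forall P, K P -> 0 <= P.2 /\ P.2 <= h) -> a * b != 0 -> 2 * `|a * b| * overlap K a b c <= h ^+ 2.
Proof.
move=> mK bK ab h0 H ab0.
have D : (- 2 * a * b) * 1 - (1 - 2 * b ^+ 2) * 0 = - (2 * (a * b)) by ring.
have D0 : (- 2 * a * b) * 1 - (1 - 2 * b ^+ 2) * 0 != 0 by rewrite D oppr_eq0 mulf_neq0.
have mS := @mble_trap R 0 h 0 h; have bS := @bdd_trap R 0 h 0 h.
have e := area_affmap (2 * b * c) 0 D0 mS bS.
have h1 : area (trap 0 h 0 h) <= (h - 0) * (0 * (0 + h) / 2 + h) by apply: area_trap_le => //; lra.
have h2 : overlap K a b c <= area (affmap (- 2 * a * b) (1 - 2 * b ^+ 2) (2 * b * c) 0 1 0 @^-1` trap 0 h 0 h).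
  apply: area_mono; [by apply: mbleI => //; exact: (@mble_refl _ a b c K ab)|exact: mble_affmap|exact: bdd_affmap|].
  move=> P [/H[p1 p2] /H[]]; rewrite /trap /refl_line /affmap /= => p3 p4.
  by split; lra.
rewrite D normrN normrM ger0_norm// in e.
apply: le_trans (_ : 2 * `|a * b| * area (affmap (- 2 * a * b) (1 - 2 * b ^+ 2) (2 * b * c) 0 1 0 @^-1` trap 0 h 0 h) <= _).
  by rewrite ler_wpM2l// mulr_ge0.
by rewrite e; apply: le_trans h1 _; apply: eq_ler; field.
Qed.

End Mirror.

Lemma area_ge_between2 (R : realType) (A : set (R * R)) (p q r a b c d : R) : p <= q -> q <= r -> mble A -> bdd A ->
  (forall P, p <= P.1 -> P.1 <= q -> 0 <= P.2 -> P.2 <= a * P.1 + b -> A P) ->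
  (forall P, q <= P.1 -> P.1 <= r -> 0 <= P.2 -> P.2 <= c * P.1 + d -> A P) ->
  0 <= a * p + b -> 0 <= a * q + b -> 0 <= c * q + d -> 0 <= c * r + d ->
  (q - p) * (a * (p + q) / 2 + b) + (r - q) * (c * (q + r) / 2 + d) <= area A.
Proof.
move=> pq qr mA bA H1 H2 g1 g2 g3 g4.
have mge : mble [set x : R * R | q <= x.1].
  have := @mble_le_lin R (-1) 0 q; congr mble; apply/seteqP; split => x /=; lra.
have mC : mble (A `&` ~` [set x | x.1 <= q]) by apply: mbleI => //; apply: mbleC; exact: mble_le1.
have bC : bdd (A `&` ~` [set x | x.1 <= q]) by apply: bdd_sub bA => x [].
have mL : mble (A `&` ([set x | x.1 <= q] `&` [set x | q <= x.1])).
  by apply: mbleI => //; apply: mbleI => //; exact: mble_le1.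
have bL : bdd (A `&` ([set x | x.1 <= q] `&` [set x | q <= x.1])) by apply: bdd_sub bA => x [].
have [M HM] := bA.
have h4 : area (A `&` ([set x | x.1 <= q] `&` [set x | q <= x.1])) <= 0.
  have z : (q - q) * ((0 - 0) * (q + q) / 2 + (`|M| - - `|M|)) = 0 by rewrite subrr mul0r.
  have nM := normr_ge0 M; rewrite -z; apply: area_between => //; [|lra|lra].
  move=> P [AP [/= i1 i2]]; have [_ i3] := HM _ AP.
  have := le_trans i3 (ler_norm M); rewrite ler_norml => /andP[i4 i5].
  by split => //; lra.
have h1 : (q - p) * (a * (p + q) / 2 + b) <= area (A `&` [set x | x.1 <= q]).
  apply: area_ge_between => //; first by apply: mbleI => //; exact: mble_le1.
    by apply: bdd_sub bA => x [].
  by move=> P p1 p2 p3 p4; split => //; exact: H1.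
have h2 : (r - q) * (c * (q + r) / 2 + d) <= area (A `&` [set x | q <= x.1]).
  apply: area_ge_between => //; first exact: mbleI.
    by apply: bdd_sub bA => x [].
  by move=> P p1 p2 p3 p4; split => //; exact: H2.
have h3 : area (A `&` [set x | q <= x.1]) <= area (A `&` ~` [set x | x.1 <= q]) + area (A `&` ([set x | x.1 <= q] `&` [set x | q <= x.1])).
  apply: area_subadd => //; first exact: mbleI.
  move=> x [Ax /= qx]; have [h|h] := leP x.1 q; [by right|].
  by left; split => //=; apply/negP; rewrite -ltNge.
rewrite (area_split mA (mble_le1 q) bA).
move: h1 h2 h3 h4; move: (area _) (area _) (area _) (area _) => w1 w2 w3 w4 h1 h2 h3 h4.
apply: le_trans (lerD h1 h2) _; rewrite lerD2l.
by clear -h3 h4; lra.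
Qed.

(** * The thin quadrilateral and its area *)

Section Thin.
Variables (R : realType) (m e : R).
Implicit Types (P : R * R).

(* For m = sqrt 2 + 1 a quadrilateral with vertices (0,0), (1,0), ((3 - m)/2, e (m + 1)/2), (0,e). *)
Definition thin : set (R * R) := [set P | [/\ 0 <= P.1, 0 <= P.2, P.2 <= e * (1 + m * P.1) & P.2 <= e * m * (1 - P.1)]].

(** The quadratic equation is all that the exact identities use of sqrt 2 + 1; the rational bounds
    serve the linear estimates. *)
Hypothesis par : [/\ m * m = 2 * m + 1, 12 / 5 <= m, m <= 29 / 12, 0 < e & e <= 1 / 100].

Lemma em_gt0 : 0 < e * m.
Proof. by case: par => _ m1 _ e0 _; apply: mulr_gt0 => //; lra. Qed.

Lemma thin_box P : thin P -> [/\ P.1 <= 1, P.2 <= e * ((m + 1) / 2) & P.2 <= 2 * e].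
Proof.
have em0 := em_gt0; have [mm m1 m2 e0 e1] := par.
move=> [p1 p2 h1 h2].
have hm : P.2 <= e * ((m + 1) / 2).
  have -> : e * ((m + 1) / 2) = (e * (1 + m * P.1) + e * m * (1 - P.1)) / 2 by field.
  by lra.
split => //; last first.
  by apply: le_trans hm _; rewrite mulrC ler_pM2r//; lra.
by rewrite -subr_ge0 -(pmulr_rge0 _ em0); exact: le_trans h2.
Qed.

Lemma compact_thin : compact thin.
Proof.
have -> : thin = (`[0, 1] `*` `[0, 2 * e]) `&` ([set P | 0 <= P.1] `&` [set P | 0 <= P.2] `&`
    [set P | P.2 <= e * (1 + m * P.1)] `&` [set P | P.2 <= e * m * (1 - P.1)]).
  apply/seteqP; split => P; last by move=> [_ [[[? ?] ?] ?]].
  move=> TP; have [b1 b2 b3] := thin_box TP; case: TP => p1 p2 h1 h2.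
  by split; [split; rewrite /= in_itv/=; apply/andP|].
apply: compact_closedI; first by apply: compact_setX; exact: segment_compact.
apply: closedI; [apply: closedI; [apply: closedI|]|].
- by apply: (@closed_le0 _ _ (fun=> 0) (fun P => P.1)); cont.
- by apply: (@closed_le0 _ _ (fun=> 0) (fun P => P.2)); cont.
- by apply: (@closed_le0 _ _ (fun P => P.2) (fun P => e * (1 + m * P.1))); cont.
- by apply: (@closed_le0 _ _ (fun P => P.2) (fun P => e * m * (1 - P.1))); cont.
Qed.

Lemma convex_thin : convex_set2 thin.
Proof.
move=> P Q [p1 p2 p3 p4] [q1 q2 q3 q4] t t0 t1; have t1' : 0 <= 1 - t by lra.
split => /=.
- by rewrite addr_ge0// mulr_ge0.
- by rewrite addr_ge0// mulr_ge0.
- have h1 := ler_wpM2l t0 p3; have h2 := ler_wpM2l t1' q3.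
  by apply: le_trans (lerD h1 h2) _; apply: eq_ler; ring.
- have h1 := ler_wpM2l t0 p4; have h2 := ler_wpM2l t1' q4.
  by apply: le_trans (lerD h1 h2) _; apply: eq_ler; ring.
Qed.

Lemma thin_body : convex_body2 thin.
Proof.
have em0 := em_gt0; have [mm m1 m2 e0 e1] := par.
split; first exact: compact_thin.
split; first exact: convex_thin.
exists (1 / 3, e / 3); apply/interiorP; exists (e / 4); first lra.
move=> P /=; rewrite !ltr_norml => /andP[a1 a2] /andP[b1 b2].
have h1 : 0 <= e * (m * P.1) by rewrite mulr_ge0 ?mulr_ge0 ?(ltW e0)//; lra.
have h2 : 0 <= e * m * (1 - P.1 - 1 / 2) by rewrite mulr_ge0 ?(ltW em0)//; lra.
have h3 : e * (12 / 5) <= e * m by rewrite ler_pM2l.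
by split; lra.
Qed.

Let mT : mble thin. Proof. exact: mble_compact compact_thin. Qed.
Let bT : bdd thin. Proof. exact: bdd_compact compact_thin. Qed.

Lemma area_thin : area thin = e.
Proof.
have em0 := em_gt0; have [mm m1 m2 e0 e1] := par.
(* (3 - m)/2 equals (m - 1)/(2 m), the abscissa at which the two upper sides meet. *)
have be0 : 0 <= (3 - m) / 2 by lra.
have be1 : (3 - m) / 2 <= 1 by lra.
have mb : m * ((3 - m) / 2) = (m - 1) / 2.
  transitivity ((3 * m - m * m) / 2); first by field.
  by rewrite mm; field.
have mS1 : mble (thin `&` [set x | x.1 <= (3 - m) / 2]) by apply: mbleI => //; exact: mble_le1.
have mS2 : mble (thin `&` ~` [set x | x.1 <= (3 - m) / 2]) by apply: mbleI => //; apply: mbleC; exact: mble_le1.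
have bS1 : bdd (thin `&` [set x | x.1 <= (3 - m) / 2]) by apply: bdd_sub bT => x [].
have bS2 : bdd (thin `&` ~` [set x | x.1 <= (3 - m) / 2]) by apply: bdd_sub bT => x [].
have ep k : 0 <= k -> 0 <= e * k by move=> k0; rewrite mulr_ge0// ltW.
have v1 : ((3 - m) / 2 - 0) * (e * m * (0 + (3 - m) / 2) / 2 + e) + (1 - (3 - m) / 2) * (- (e * m) * ((3 - m) / 2 + 1) / 2 + e * m) = e.
  transitivity (e * ((3 - m) / 2 * (m * ((3 - m) / 2)) / 2 + (3 - m) / 2 + (m - m * ((3 - m) / 2)) * (1 - (3 - m) / 2) / 2)); first by field.
  by rewrite mb; field.
apply/eqP; rewrite eq_le; apply/andP; split.
  have a1 : area (thin `&` [set x | x.1 <= (3 - m) / 2]) <= ((3 - m) / 2 - 0) * ((e * m - 0) * (0 + (3 - m) / 2) / 2 + (e - 0)).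
    apply: area_between => //; [|lra|].
      by move=> P [[p1 p2 p3 p4] /= p5]; split => //; lra.
    by rewrite mul0r addr0 addr_ge0 ?(ltW e0)// mulr_ge0// ltW.
  have a2 : area (thin `&` ~` [set x | x.1 <= (3 - m) / 2]) <= (1 - (3 - m) / 2) * ((- (e * m) - 0) * ((3 - m) / 2 + 1) / 2 + (e * m - 0)).
    apply: area_between => //.
    - move=> P [TP /= /negP]; rewrite -ltNge => p5; have [b1 _ _] := thin_box TP; case: TP => p1 p2 p3 p4.
      by split => //; lra.
    - have : 0 <= e * m * (1 - (3 - m) / 2) by rewrite mulr_ge0 ?(ltW em0)// subr_ge0.
      by lra.
    - by lra.
  rewrite (area_split mT (mble_le1 ((3 - m) / 2)) bT); apply: le_trans (lerD a1 a2) _; rewrite !subr0 in v1 *.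
  by rewrite v1.
rewrite -[leLHS]v1; apply: area_ge_between2 => //.
- move=> P p1 p2 p3 p4; split => //; first by rewrite mulrDr mulr1 mulrA addrC.
  have : 0 <= e * (m - m * P.1 - (1 + m * P.1)).
    apply: ep; have : m * P.1 <= m * ((3 - m) / 2) by rewrite ler_pM2l//; lra.
    by rewrite mb; lra.
  by lra.
- move=> P p1 p2 p3 p4; have p0 : 0 <= P.1 by exact: le_trans p1.
  split => //; last by rewrite mulrBr mulr1 addrC -mulNr.
  have : 0 <= e * (1 + m * P.1 - (m - m * P.1)).
    apply: ep; have : m * ((3 - m) / 2) <= m * P.1 by rewrite ler_pM2l//; lra.
    by rewrite mb; lra.
  by lra.
- by rewrite mulr0 add0r ltW.
- by rewrite addr_ge0 ?(ltW e0)// mulr_ge0// ltW.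
- have -> : - (e * m) * ((3 - m) / 2) + e * m = e * m * (1 - (3 - m) / 2) by ring.
  by rewrite mulr_ge0 ?(ltW em0)// subr_ge0.
- by rewrite mulr1 addNr.
Qed.

End Thin.

Section AffineDiv.
Variable R : realFieldType.
Implicit Types a b d x y : R.

Lemma le_affine_div d a b x y : 0 < d -> d * y <= a * x + b -> y <= a / d * x + b / d.
Proof. by move=> d0 h; rewrite mulrAC -mulrDl ler_pdivlMr// mulrC. Qed.

Lemma ge_affine_div d a b x y : 0 < d -> a * x + b <= d * y -> a / d * x + b / d <= y.
Proof. by move=> d0 h; rewrite mulrAC -mulrDl ler_pdivrMr// [y * d]mulrC. Qed.

End AffineDiv.

(** * The line x = 1/3 and the nearly horizontal lines *)

Section ThinOverlap.
Variables (R : realType) (m e : R).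
Hypothesis par : [/\ m * m = 2 * m + 1, 12 / 5 <= m, m <= 29 / 12, 0 < e & e <= 1 / 100].
Implicit Types (P : R * R).
Local Notation thin := (thin m e).

(** Over [1/3, 2/3] the region below the side from (1,0) is reflected into the body, so the overlap
    contains this region and its mirror image. *)
Lemma overlap_thin_ge : m / 3 * e <= overlap thin 1 0 (1 / 3).
Proof.
have em0 := em_gt0 par; have [mm m1 m2 e0 e1] := par.
have ab : 1 ^+ 2 + 0 ^+ 2 = 1 :> R by ring.
have mT := mble_compact (compact_thin par); have bT := bdd_compact (compact_thin par).
have -> : m / 3 * e = (1 / 3 - 0) * (e * m * (0 + 1 / 3) / 2 + e * m / 3) + (2 / 3 - 1 / 3) * (- (e * m) * (1 / 3 + 2 / 3) / 2 + e * m) by field.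
have rE P : refl_line 1 0 (1 / 3) P = (2 / 3 - P.1, P.2) by rewrite /refl_line; congr pair; field.
have em3 : e * m / 3 <= e by have : e * m <= e * 3 by [rewrite ler_pM2l//; lra]; lra.
apply: area_ge_between2.
- by lra.
- by lra.
- by apply: mbleI => //; exact: mble_refl.
- by apply: bdd_sub bT => x [].
- move=> P p1 p2 p3 p4; rewrite /= rE.
  have h1 : 0 <= e * m * P.1 by rewrite mulr_ge0// ltW.
  have h2 : 0 <= e * m * (1 / 3 - P.1) by rewrite mulr_ge0 ?(ltW em0)// subr_ge0.
  by split; split => /=; lra.
- move=> P p1 p2 p3 p4; rewrite /= rE.
  have h1 : 0 <= e * m * (P.1 - 1 / 3) by rewrite mulr_ge0 ?(ltW em0)// subr_ge0.
  have h2 : 0 <= e * m * (2 / 3 - P.1) by rewrite mulr_ge0 ?(ltW em0)// subr_ge0.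
  by split; split => /=; lra.
- by lra.
- by lra.
- by lra.
- by lra.
Qed.

(** 17 = 9 + 8: a^2 is at most 9 e^2, and the product e m a b is at most 8 e^2 in absolute value
    because 3 m < 8. *)
Lemma small_prod (a b : R) : a ^+ 2 + b ^+ 2 = 1 -> `|a| <= 3 * e ->
  1 - 17 * (e * e) <= b ^+ 2 - e * m * (a * b) /\ 1 - 17 * (e * e) <= b ^+ 2 + e * m * (a * b).
Proof.
move=> ab ha; have em0 := em_gt0 par; have [mm m1 m2 e0 e1] := par.
have b1 : `|b| <= 1.
  rewrite -(@expr_le1 _ 2)// -normrX ger0_norm ?sqr_ge0//.
  by have := sqr_ge0 a; lra.
have a2 : a ^+ 2 <= 9 * (e * e).
  rewrite -(ger0_norm (sqr_ge0 a)) normrX expr2.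
  have : `|a| * `|a| <= 3 * e * (3 * e) by rewrite ler_pM.
  by lra.
have z : `|a * b| <= 3 * e by rewrite normrM -[leRHS]mulr1 ler_pM.
have ez : `|e * m * (a * b)| <= 8 * (e * e).
  rewrite normrM (gtr0_norm em0).
  have h : e * m * `|a * b| <= e * m * (3 * e) by rewrite ler_pM2l.
  have : 0 <= e * e * (29 / 12 - m) by rewrite mulr_ge0 ?subr_ge0// mulr_ge0 ?(ltW e0).
  have : 0 <= e * e by rewrite mulr_ge0 ?(ltW e0).
  by lra.
by move: ez; rewrite ler_norml => /andP[z1 z2]; split; lra.
Qed.

(** One error factor for both kinds of lines: the denominator comes from [small_prod], the square
    from the shift d = 17 e^2 in [vert_alg]. *)
Lemma rho_bound : 0 < 1 - 17 * (e * e) /\ e / (1 - 17 * (e * e)) * (1 + 17 * (e * e)) ^+ 2 <= (1 + e) * e.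
Proof.
have [mm m1 m2 e0 e1] := par.
have h : e * e <= e / 100 by have : e * e <= e * (1 / 100) by [rewrite ler_pM2l]; lra.
have [d dE] : exists d, d = 17 * (e * e) by eexists.
have d0 : 0 <= d by rewrite dE !mulr_ge0// ltW.
rewrite -dE; have d1 : d <= e / 5 by lra.
have d2 : d <= 1 / 100 by lra.
split; first lra.
rewrite mulrAC ler_pdivrMr; last lra.
rewrite [leRHS]mulrAC [leRHS]mulrC ler_pM2l// expr2.
have h1 : d * d <= 1 / 100 * d by rewrite ler_wpM2r.
have h2 : e * d <= 1 / 100 * d by rewrite ler_wpM2r.
by lra.
Qed.

Lemma horiz_alg (b k1 k2 k s t : R) : 0 < b -> b <= 1 -> 0 < k1 -> 0 < k2 -> k1 <= k -> k2 <= k -> s <= t ->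
  0 <= m * k1 * s + b * k1 -> 0 <= - m * k2 * t + m * b * k2 ->
  (t - s) / 2 * (m * k1 * (s + (t - s) / 8) + b * k1 + (- m * k2 * (t - (t - s) / 8) + m * b * k2)) <= m / 3 * k.
Proof.
have [mm m1 m2 _ _] := par.
move=> b0 b1 k10 k20 k1k k2k st g1 g2.
have m0 : 0 < m by lra.
have [L LE] : exists L, L = t - s by eexists.
have tE : t = s + L by lra.
have L0 : 0 <= L by lra.
rewrite -LE.
have h1 : 0 <= m * s + b by rewrite -(pmulr_rge0 _ k10); lra.
have h2 : 0 <= b - t by rewrite -(pmulr_rge0 _ (mulr_gt0 m0 k20)); lra.
have mL : 0 <= m * L by rewrite mulr_ge0// ltW.
have q1 : k1 * (m * (s + L / 8) + b) <= k * (m * (s + L / 8) + b) by rewrite ler_wpM2r//; lra.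
have q2 : k2 * (m * (b - (t - L / 8))) <= k * (m * (b - (t - L / 8))).
  by rewrite ler_wpM2r// mulr_ge0 ?(ltW m0)//; lra.
have k0 : 0 < k by exact: lt_le_trans k1k.
have q3 : m * k1 * (s + L / 8) + b * k1 + (- m * k2 * (t - L / 8) + m * b * k2) <= k * (1 + m - 3 / 4 * (m * L)).
  have : k * (b * (1 + m)) <= k * (1 * (1 + m)) by rewrite ler_pM2l// ler_pM2r//; lra.
  by rewrite tE in q2 *; lra.
apply: le_trans (_ : L / 2 * (k * (1 + m - 3 / 4 * (m * L))) <= _).
  by rewrite ler_wpM2l//; lra.
(* Completing the square in L: the maximum k (1 + m)^2/(6 m) equals k m/3 because m^2 = 2 m + 1. *)
rewrite -subr_ge0.
have -> : m / 3 * k - L / 2 * (k * (1 + m - 3 / 4 * (m * L))) =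
   k / (24 * m) * ((3 * m * L - 2 * (1 + m)) ^+ 2 + 4 * (m * m - (2 * m + 1))).
  by field; rewrite gt_eqF.
by rewrite mm subrr mulr0 addr0 mulr_ge0 ?sqr_ge0// divr_ge0 ?(ltW k0)// mulr_ge0// ltW.
Qed.

(* In coordinates along the axis the vertical gaps to the three long sides are exactly linear, so [area_axisym_le] leaves
   a quadratic in the length of the axis inside the body, whose maximum is m/3 up to the factor 1/(1 - 17 e^2). *)
Lemma thin_horiz (a b c : R) : a ^+ 2 + b ^+ 2 = 1 -> 0 < b -> `|a| <= 3 * e -> overlap thin a b c <= m / 3 * ((1 + e) * e).
Proof.
move=> ab b0 ha; have em0 := em_gt0 par; have [mm m1 m2 e0 e1] := par.
have [s1 s2] := small_prod ab ha; have [r0 rle] := rho_bound.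
have cT := compact_thin par.
have b1 : b <= 1 by rewrite -(@expr_le1 _ 2) ?(ltW b0)//; have := sqr_ge0 a; lra.
have D : b * b - a * - a != 0 by have -> : b * b - a * - a = 1 by [rewrite -ab; ring]; rewrite oner_eq0.
rewrite (overlap_rot1 _ cT ab).
have [D1 D1E] : exists D1, D1 = b - e * m * a by eexists.
have [D2 D2E] : exists D2, D2 = b + e * m * a by eexists.
have bD1 : 1 - 17 * (e * e) <= b * D1 by apply: le_trans s1 _; rewrite D1E; apply: eq_ler; ring.
have bD2 : 1 - 17 * (e * e) <= b * D2 by apply: le_trans s2 _; rewrite D2E; apply: eq_ler; ring.
have D10 : 0 < D1 by rewrite -(pmulr_rgt0 _ b0); exact: lt_le_trans bD1.
have D20 : 0 < D2 by rewrite -(pmulr_rgt0 _ b0); exact: lt_le_trans bD2.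
have bn : b != 0 by rewrite gt_eqF. have D1n : D1 != 0 by rewrite gt_eqF. have D2n : D2 != 0 by rewrite gt_eqF.
have H P : (affmap b a (a * c) (- a) b (b * c) @^-1` thin) P -> [/\ a / b * P.1 + - (b * c) / b <= P.2,
   P.2 <= (e * m * b + a) / D1 * P.1 + (e + e * m * a * c - b * c) / D1 &
   P.2 <= (a - e * m * b) / D2 * P.1 + (e * m - e * m * a * c - b * c) / D2].
  rewrite /affmap /= => -[_ /= p2 p3 p4]; split.
  - by apply: ge_affine_div => //; lra.
  - by apply: le_affine_div => //; rewrite D1E; lra.
  - by apply: le_affine_div => //; rewrite D2E; lra.
have k0 : 0 < e / (1 - 17 * (e * e)) by rewrite divr_gt0.
have kle : m / 3 * (e / (1 - 17 * (e * e))) <= m / 3 * ((1 + e) * e).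
  rewrite ler_pM2l; last lra.
  apply: le_trans rle; rewrite ler_peMr ?(ltW k0)// expr_ge1// ?lerDl.
    by rewrite !mulr_ge0// ltW.
  by rewrite addr_ge0// !mulr_ge0// ltW.
have [->|[s [t [st [g1 g1'] [g2 g2'] Hle]]]] := area_axisym_le (@compact_affmap R b a (a * c) (- a) b (b * c) _ D cT) H.
  by rewrite mulr_ge0 ?mulr_ge0 ?addr_ge0 ?(ltW e0)//; lra.
have k1E : (e * m * b + a) / D1 - a / b = m * (e / (b * D1)).
  transitivity ((e * m * b ^+ 2 + a * b - a * D1) / (b * D1)); first by field; rewrite bn D1n.
  have -> : e * m * b ^+ 2 + a * b - a * D1 = e * m * (a ^+ 2 + b ^+ 2) by rewrite D1E; ring.
  by rewrite ab mulr1; field; rewrite bn D1n.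
have k1F : (e + e * m * a * c - b * c) / D1 - - (b * c) / b = b * (e / (b * D1)).
  transitivity ((e + e * m * a * c - b * c + c * D1) / D1); first by field; rewrite D1n bn.
  have -> : e + e * m * a * c - b * c + c * D1 = e by rewrite D1E; ring.
  by field; rewrite bn D1n.
have k2E : (a - e * m * b) / D2 - a / b = - m * (e / (b * D2)).
  transitivity ((a * b - e * m * b ^+ 2 - a * D2) / (b * D2)); first by field; rewrite bn D2n.
  have -> : a * b - e * m * b ^+ 2 - a * D2 = - (e * m * (a ^+ 2 + b ^+ 2)) by rewrite D2E; ring.
  by rewrite ab mulr1; field; rewrite bn D2n.
have k2F : (e * m - e * m * a * c - b * c) / D2 - - (b * c) / b = m * b * (e / (b * D2)).
  transitivity ((e * m - e * m * a * c - b * c + c * D2) / D2); first by field; rewrite D2n bn.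
  have -> : e * m - e * m * a * c - b * c + c * D2 = e * m by rewrite D2E; ring.
  by field; rewrite bn D2n.
rewrite k1E k1F in g1 Hle; rewrite k2E k2F in g2' Hle.
apply: le_trans kle; apply: le_trans Hle _.
have bD10 : 0 < b * D1 by rewrite mulr_gt0.
have bD20 : 0 < b * D2 by rewrite mulr_gt0.
apply: horiz_alg => //.
- by rewrite divr_gt0.
- by rewrite divr_gt0.
- by rewrite ler_pM2l// lef_pV2.
- by rewrite ler_pM2l// lef_pV2.
Qed.

End ThinOverlap.

(** * Nearly vertical lines, all lines, and the four vertices *)

Section ThinUpper.
Variables (R : realType) (m e : R).
Hypothesis par : [/\ m * m = 2 * m + 1, 12 / 5 <= m, m <= 29 / 12, 0 < e & e <= 1 / 100].
Implicit Types (P : R * R).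
Local Notation thin := (thin m e).

(** With k, a and c replaced by k', 1 and s - d, the left-hand side is a quadratic in s whose
    maximum is at s = (1 + d)/3. *)
Lemma vert_alg (a c k k' s d : R) : 0 < k -> k <= k' -> 0 <= d -> a <= 1 -> 0 <= s -> s - d <= c ->
  0 <= - m * k * s + m * k * (a - c) ->
  2 * s * (- m * k * s / 2 + m * k * (a - c)) <= m / 3 * (k' * (1 + d) ^+ 2).
Proof.
have [mm m1 m2 _ _] := par.
move=> k0 kk d0 a1 s0 sc g.
have m0 : 0 < m by lra.
have mk : 0 < m * k by rewrite mulr_gt0.
have h1 : 0 <= a - c - s by rewrite -(pmulr_rge0 _ mk); lra.
have -> : 2 * s * (- m * k * s / 2 + m * k * (a - c)) = 2 * m * (k * (s * (a - c - s / 2))) by field.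
have h2 : k * (s * (a - c - s / 2)) <= k' * (s * (1 - s + d - s / 2)).
  apply: ler_pM => //; [exact: ltW|by rewrite mulr_ge0//; lra|].
  by rewrite ler_wpM2l//; lra.
apply: le_trans (_ : 2 * m * (k' * (s * (1 - s + d - s / 2))) <= _).
  by rewrite ler_pM2l// mulr_gt0.
rewrite -subr_ge0.
have -> : m / 3 * (k' * (1 + d) ^+ 2) - 2 * m * (k' * (s * (1 - s + d - s / 2))) = m / 3 * k' * (1 + d - 3 * s) ^+ 2 by field.
by rewrite mulr_ge0 ?sqr_ge0// mulr_ge0// ?divr_ge0 ?(ltW m0)// (le_trans (ltW k0)).
Qed.

(* The overlap reaches at most as far beyond the axis as the axis is from the side x = 0, and is bounded there by the
   side from (1,0). *)
Lemma thin_vert (a b c : R) : a ^+ 2 + b ^+ 2 = 1 -> 0 < a -> `|b| <= 3 * e -> overlap thin a b c <= m / 3 * ((1 + e) * e).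
Proof.
move=> ab a0 hb; have em0 := em_gt0 par; have [mm m1 m2 e0 e1] := par.
have ba : b ^+ 2 + a ^+ 2 = 1 by rewrite addrC.
have [s1 _] := small_prod par ba hb; have [r0 rle] := rho_bound par.
have cT := compact_thin par.
have a1 : a <= 1 by rewrite -(@expr_le1 _ 2) ?(ltW a0)//; have := sqr_ge0 b; lra.
have ee : e * e <= e / 100 by have : e * e <= e * (1 / 100) by [rewrite ler_pM2l]; lra.
have a9 : 99 / 100 <= a.
  have b2 : b ^+ 2 <= 9 * (e * e).
    rewrite -(ger0_norm (sqr_ge0 b)) normrX expr2.
    have : `|b| * `|b| <= 3 * e * (3 * e) by rewrite ler_pM.
    by lra.
  have : a ^+ 2 <= a by rewrite expr2 ler_piMl// ltW.
  by lra.
have D0 : a * a - - b * b != 0 by have -> : a * a - - b * b = 1 by [rewrite -ab; ring]; rewrite oner_eq0.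
rewrite (overlap_rot2 _ cT ab).
have [D DE] : exists D, D = a - e * m * b by eexists.
have aD : 1 - 17 * (e * e) <= a * D by apply: le_trans s1 _; rewrite DE; apply: eq_ler; ring.
have Dgt0 : 0 < D by rewrite -(pmulr_rgt0 _ a0); exact: lt_le_trans aD.
have an : a != 0 by rewrite gt_eqF. have Dn : D != 0 by rewrite gt_eqF.
have H P : (affmap a (- b) (a * c) b a (b * c) @^-1` thin) P ->
   - b / a * P.1 + - b * c / a <= P.2 /\ P.2 <= - (b + e * m * a) / D * P.1 + (e * m - e * m * a * c - b * c) / D.
  rewrite /affmap /= => -[_ /= p2 p3 p4]; split.
  - by apply: ge_affine_div => //; lra.
  - by apply: le_affine_div => //; rewrite DE; lra.
have [->|[P [[QP QP'] P0 g Hle]]] := area_axisym2_le (@compact_affmap R a (- b) (a * c) b a (b * c) _ D0 cT) H.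
  by rewrite mulr_ge0 ?mulr_ge0 ?addr_ge0 ?(ltW e0)//; lra.
have kE : - (b + e * m * a) / D - - b / a = - m * (e / (a * D)).
  transitivity ((b * D - a * b - e * m * a ^+ 2) / (a * D)); first by field; rewrite an Dn.
  have -> : b * D - a * b - e * m * a ^+ 2 = - (e * m * (a ^+ 2 + b ^+ 2)) by rewrite DE; ring.
  by rewrite ab mulr1; field; rewrite an Dn.
have kF : (e * m - e * m * a * c - b * c) / D - - b * c / a = m * (e / (a * D)) * (a - c).
  transitivity ((a * (e * m - e * m * a * c - b * c) + b * c * D) / (a * D)); first by field; rewrite an Dn.
  have -> : a * (e * m - e * m * a * c - b * c) + b * c * D = e * m * (a - (a ^+ 2 + b ^+ 2) * c) by rewrite DE; ring.
  by rewrite ab mul1r; field; rewrite an Dn.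
rewrite kE kF in g Hle.
(* The mirror image of [P] lies in the body and has nonnegative abscissa, so a (c - P.1) >= b P.2;
   the right-hand side is of order e^2 and a >= 99/100. *)
have sc : P.1 - 17 * (e * e) <= c.
  have [x1 _ y2] := thin_box par QP.
  move: QP => [x0 y0 _ _]; move: QP' => [x0' _ _ _].
  move: x0 x1 y0 y2 x0'; rewrite /affmap /= => x0 x1 y0 y2 x0'.
  have tE : P.2 = - b * (a * P.1 + - b * P.2 + a * c) + a * (b * P.1 + a * P.2 + b * c).
    transitivity ((a ^+ 2 + b ^+ 2) * P.2); first by rewrite ab mul1r.
    by ring.
  have hP : `|P.2| <= 5 * e.
    rewrite tE; apply: le_trans (ler_normD _ _) _; rewrite !normrM normrN (gtr0_norm a0) (ger0_norm x0) (ger0_norm y0).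
    have : `|b| * (a * P.1 + - b * P.2 + a * c) <= 3 * e * 1 by rewrite ler_pM.
    have : a * (b * P.1 + a * P.2 + b * c) <= 1 * (2 * e) by rewrite ler_pM// ltW.
    by lra.
  have hbP : `|b * P.2| <= 15 * (e * e).
    rewrite normrM; have : `|b| * `|P.2| <= 3 * e * (5 * e) by rewrite ler_pM.
    by lra.
  rewrite leNgt; apply/negP => hc.
  have : a * (c - P.1) <= a * (- 17 * (e * e)) by rewrite ler_pM2l//; lra.
  have : 0 <= (a - 99 / 100) * (e * e) by rewrite mulr_ge0 ?mulr_ge0 ?(ltW e0)//; lra.
  have : 0 < e * e by rewrite mulr_gt0.
  by move: hbP; rewrite ler_norml => /andP[h1 h2]; lra.
apply: le_trans Hle _; apply: le_trans (_ : m / 3 * (e / (1 - 17 * (e * e)) * (1 + 17 * (e * e)) ^+ 2) <= _); last first.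
  by rewrite ler_pM2l//; lra.
have aD0 : 0 < a * D by rewrite mulr_gt0.
apply: vert_alg => //.
- by rewrite divr_gt0.
- by rewrite ler_pM2l// lef_pV2.
- by rewrite !mulr_ge0// ltW.
Qed.

(* If |ab| >= 2e the body and its image lie in strips crossing at a large enough angle. *)
Lemma overlap_thin_le (a b c : R) : a ^+ 2 + b ^+ 2 = 1 -> overlap thin a b c <= m / 3 * ((1 + e) * e).
Proof.
move=> ab; have em0 := em_gt0 par; have [mm m1 m2 e0 e1] := par.
have cT := compact_thin par.
have m3 : m / 3 * e <= m / 3 * ((1 + e) * e).
  by rewrite ler_pM2l; [rewrite mulrDl mul1r lerDl mulr_ge0// ltW|lra].
have nab : `|a| ^+ 2 + `|b| ^+ 2 = 1 by rewrite -!normrX !ger0_norm ?sqr_ge0.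
have [h|h] := leP (2 * e) `|a * b|.
  have ab0 : a * b != 0 by rewrite -normr_gt0; apply: lt_le_trans h; rewrite mulr_gt0.
  have hh : 0 <= e * ((m + 1) / 2) by rewrite mulr_ge0 ?(ltW e0)//; lra.
  have HT P : thin P -> 0 <= P.2 /\ P.2 <= e * ((m + 1) / 2).
    by move=> TP; have [_ q _] := thin_box par TP; case: TP.
  have := overlap_strip c (mble_compact cT) (bdd_compact cT) ab hh HT ab0.
  have ov0 : 0 <= overlap thin a b c by exact: area_ge0.
  have h1 : 2 * e * overlap thin a b c <= `|a * b| * overlap thin a b c by rewrite ler_wpM2r.
  move=> h2; apply: le_trans m3.
  rewrite -(ler_pM2l (mulr_gt0 (ltr0n _ 4) e0)).
  have h3 : (e * ((m + 1) / 2)) ^+ 2 = e * e * (m + 1 / 2).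
    transitivity (e * e * ((m * m + 2 * m + 1) / 4)); first by field.
    by rewrite mm; field.
  move: h1 h2 ov0; rewrite h3; move: (overlap _ _ _ _) `|a * b| => o p h1 h2 ov0.
  have : 0 <= e * e * (m / 3 - 1 / 2) by rewrite mulr_ge0 ?mulr_ge0 ?(ltW e0)//; lra.
  by lra.
have [ha|ha] := leP `|a| (3 * e).
  have [b0|b0|b0] := ltrgtP 0 b.
  - exact: thin_horiz.
  - rewrite -overlapN; apply: thin_horiz => //; [by rewrite !sqrrN|by rewrite oppr_gt0|by rewrite normrN].
  - have : `|a| ^+ 2 = 1 by rewrite -nab -b0 normr0 expr0n addr0.
    have : `|a| * `|a| <= 3 * e * (3 * e) by rewrite ler_pM.
    have : e * e <= e * (1 / 100) by rewrite ler_pM2l.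
    by rewrite expr2; lra.
have [hb|hb] := leP `|b| (3 * e).
  have [a0|a0|a0] := ltrgtP 0 a.
  - exact: thin_vert.
  - rewrite -overlapN; apply: thin_vert => //; [by rewrite !sqrrN|by rewrite oppr_gt0|by rewrite normrN].
  - by move: ha; rewrite -a0 normr0; lra.
(* Both absolute values exceed 3 e, and the one whose square is at least 1/2 is at least 2/3; so
   their product is at least 2 e. *)
exfalso; move: h nab ha hb; rewrite normrM.
move: `|a| `|b| (normr_ge0 a) (normr_ge0 b) => x y x0 y0 h xy hx hy.
have big z w : 0 <= z -> 1 / 2 <= z ^+ 2 -> 3 * e < w -> z * w < 2 * e -> False.
  move=> z0 z2 hw zw.
  have z3 : 2 / 3 <= z.
    rewrite leNgt; apply/negP => hz.
    have : z * z <= 2 / 3 * (2 / 3) by rewrite ler_pM// ltW.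
    by rewrite -expr2; lra.
  have : 2 / 3 * (3 * e) <= z * w by rewrite ler_pM//; lra.
  by lra.
have [h1|h1] := leP (1 / 2) (x ^+ 2); first exact: (big x y).
by apply: (big y x) => //; [lra|rewrite mulrC].
Qed.

Lemma Sym1_thin : m / 3 <= Sym1 thin /\ Sym1 thin <= m / 3 * (1 + e).
Proof.
have [mm m1 m2 e0 e1] := par.
have cT := compact_thin par; have mT := mble_compact cT; have bT := bdd_compact cT.
have aT : 0 < area thin by rewrite area_thin.
split.
  apply: (@Sym1_ge _ thin 1 0 (1 / 3)) => //; first by ring.
  by rewrite area_thin//; exact: overlap_thin_ge.
apply: Sym1_le => // a b c ab; rewrite area_thin// -mulrA.
exact: overlap_thin_le.
Qed.

(** For membership in the hull, a point divides the vertical segment between the base and an upper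
    side; [l] is the ratio, and each end of the segment is a combination of two vertices. *)
Lemma thin_quadrilateral : convex_quadrilateral thin.
Proof.
have em0 := em_gt0 par; have [mm m1 m2 e0 e1] := par.
have be0 : 0 < (3 - m) / 2 by lra.
have be1 : 0 < 1 - (3 - m) / 2 by lra.
have mb : m * ((3 - m) / 2) = (m - 1) / 2.
  transitivity ((3 * m - m * m) / 2); first by field.
  by rewrite mm; field.
exists (0, 0), (1, 0), ((3 - m) / 2, e * ((m + 1) / 2)), (0, e).
have eh : 0 < e * ((m + 1) / 2) by rewrite mulr_gt0//; lra.
have eh2 : e < e * ((m + 1) / 2) by rewrite ltr_pMr//; lra.
split.
- move=> [l1 [l2 [l3 [[h1 h2 h3 h4] [/= E1 E2]]]]].
  have i1 : 0 <= l2 * ((3 - m) / 2) by rewrite mulr_ge0// ltW.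
  have i2 : 0 <= l2 * (e * ((m + 1) / 2)) by rewrite mulr_ge0// ltW.
  have i3 : 0 <= l3 * e by rewrite mulr_ge0// ltW.
  have z1 : l1 = 0 by lra.
  have /eqP : l2 * ((3 - m) / 2) = 0 by lra.
  rewrite mulf_eq0 (gt_eqF be0) orbF => /eqP z2.
  have /eqP : l3 * e = 0 by lra.
  by rewrite mulf_eq0 (gt_eqF e0) orbF => /eqP z3; lra.
- move=> [l1 [l2 [l3 [[h1 h2 h3 h4] [/= E1 E2]]]]].
  have i1 : l2 * ((3 - m) / 2) <= l2 by rewrite ler_piMr//; lra.
  have z2 : l2 = 1 by lra.
  by move: E1; rewrite z2; lra.
- move=> [l1 [l2 [l3 [[h1 h2 h3 h4] [/= E1 E2]]]]].
  have : l3 * e <= e by rewrite ler_piMl ?(ltW e0)//; lra.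
  by lra.
- move=> [l1 [l2 [l3 [[h1 h2 h3 h4] [/= E1 E2]]]]].
  have i1 : 0 <= l3 * ((3 - m) / 2) by rewrite mulr_ge0// ltW.
  have /eqP : l3 * ((3 - m) / 2) = 0 by lra.
  rewrite mulf_eq0 (gt_eqF be0) orbF => /eqP z3.
  by move: E2; rewrite z3; lra.
apply/seteqP; split => P; last first.
  move=> [l1 [l2 [l3 [l4 [[h1 h2 h3 h4 h5] ->]]]]].
  have i1 : 0 <= l3 * ((3 - m) / 2) by rewrite mulr_ge0// ltW.
  have i2 : 0 <= l3 * (e * ((m + 1) / 2)) by rewrite mulr_ge0// ltW.
  have i3 : 0 <= l4 * e by rewrite mulr_ge0// ltW.
  have i4 : 0 <= l1 * e by rewrite mulr_ge0// ltW.
  have i5 : 0 <= l2 * e by rewrite mulr_ge0// ltW.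
  have i6 : 0 <= l1 * (e * m) by rewrite mulr_ge0// ltW.
  have i7 : 0 <= l2 * (e * m) by rewrite mulr_ge0// ltW.
  have i8 : 0 <= l4 * e * (m - 1) by rewrite mulr_ge0//; lra.
  have l4E : l4 = 1 - l1 - l2 - l3 by lra.
  split => /=; [lra|lra| |].
    have -> : e * (1 + m * (l1 * 0 + l2 * 1 + l3 * ((3 - m) / 2) + l4 * 0)) =
        e * (l1 + l2 + l3 + l4) + l2 * (e * m) + l3 * (e * (m * ((3 - m) / 2))) by rewrite h5; ring.
    by rewrite mb; lra.
  have -> : e * m * (1 - (l1 * 0 + l2 * 1 + l3 * ((3 - m) / 2) + l4 * 0)) =
      e * m * (l1 + l2 + l3 + l4) - l2 * (e * m) - l3 * (e * (m * ((3 - m) / 2))) by rewrite h5; ring.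
  by rewrite mb; lra.
move=> TP; have [x1 _ _] := thin_box par TP; case: TP => x0 y0 y1 y2.
have [h|h] := leP P.1 ((3 - m) / 2).
  have t0 : 0 < e * (1 + m * P.1) by rewrite mulr_gt0// ltr_wpDr// mulr_ge0//; lra.
  have [l lE] : exists l, l = P.2 / (e * (1 + m * P.1)) by eexists.
  have l0 : 0 <= l by rewrite lE divr_ge0// ltW.
  have l1 : l <= 1 by rewrite lE ler_pdivrMr// mul1r.
  have l1' : 0 <= 1 - l by lra.
  have x1' : 0 <= 1 - P.1 by lra.
  have [q qE] : exists q, q = P.1 / ((3 - m) / 2) by eexists.
  have qx : q * ((3 - m) / 2) = P.1 by rewrite qE divfK// gt_eqF.
  have q0 : 0 <= q by rewrite qE divr_ge0// ltW.
  have q1 : 0 <= 1 - q by rewrite subr_ge0 qE ler_pdivrMr// mul1r.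
  exists ((1 - l) * (1 - P.1)), ((1 - l) * P.1), (l * q), (l * (1 - q)); split.
    by split; rewrite ?mulr_ge0//; ring.
  rewrite [LHS]surjective_pairing /=; congr pair.
    transitivity ((1 - l) * P.1 + l * (q * ((3 - m) / 2))); last by ring.
    by rewrite qx; ring.
  transitivity (l * (e * (1 + m * P.1))); first by rewrite lE divfK// gt_eqF.
  have qh : q * ((m + 1) / 2) = q + m * P.1.
    have -> : m * P.1 = q * (m * ((3 - m) / 2)) by rewrite -qx; ring.
    by rewrite mb; field.
  transitivity (l * e * (q * ((m + 1) / 2)) + l * (1 - q) * e); last by ring.
  by rewrite qh; ring.
have [l lE] : exists l, l = P.2 / (e * m * (1 - P.1)) by eexists.
have x1' : 0 <= 1 - P.1 by lra.
have t0 : 0 <= e * m * (1 - P.1) by rewrite mulr_ge0// ltW.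
have l0 : 0 <= l by rewrite lE divr_ge0.
(* At the vertex (1,0) the segment degenerates and [l] is 0 by the convention for division by 0;
   there [P.2] is 0 as well. *)
have lP : l * (e * m * (1 - P.1)) = P.2.
  have [z|z] := eqVneq (e * m * (1 - P.1)) 0; last by rewrite lE divfK.
  by move: y2; rewrite z mulr0 => y2; lra.
have l1 : l <= 1.
  move: t0; rewrite le_eqVlt => /predU1P[z|z]; first by rewrite lE -z invr0 mulr0 ler01.
  by rewrite lE ler_pdivrMr// mul1r.
have l1' : 0 <= 1 - l by lra.
have [q qE] : exists q, q = (1 - P.1) / (1 - (3 - m) / 2) by eexists.
have qx : q * (1 - (3 - m) / 2) = 1 - P.1 by rewrite qE divfK// gt_eqF.
have q0 : 0 <= q by rewrite qE divr_ge0// ltW.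
have q1 : 0 <= 1 - q by rewrite subr_ge0 qE ler_pdivrMr// mul1r; lra.
exists ((1 - l) * (1 - P.1)), ((1 - l) * P.1 + l * (1 - q)), (l * q), 0; split.
  by split; rewrite ?addr_ge0 ?mulr_ge0//; ring.
rewrite [LHS]surjective_pairing /=; congr pair.
  transitivity ((1 - l) * P.1 + l * (1 - q * (1 - (3 - m) / 2))); last by ring.
  by rewrite qx; ring.
rewrite -[LHS]lP -qx.
transitivity (l * q * e * (m - m * ((3 - m) / 2))); first by ring.
by rewrite mb; field.
Qed.

End ThinUpper.

Lemma thin_params (R : realType) (e : R) : 0 < e -> e <= 1 / 100 ->
  [/\ (Num.sqrt 2 + 1) * (Num.sqrt 2 + 1) = 2 * (Num.sqrt 2 + 1) + 1 :> R, 12 / 5 <= Num.sqrt 2 + 1 :> R,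
     Num.sqrt 2 + 1 <= 29 / 12 :> R, 0 < e & e <= 1 / 100].
Proof.
move=> e0 e1.
have : Num.sqrt 2 ^+ 2 = 2 :> R by rewrite sqr_sqrtr.
have : 0 <= Num.sqrt 2 :> R by exact: sqrtr_ge0.
move: (Num.sqrt 2) => s s0; rewrite expr2 => s2.
have h1 : s <= 17 / 12.
  rewrite leNgt; apply/negP => h.
  have : (17 / 12) * (17 / 12) < s * s by rewrite ltr_pM//; lra.
  by rewrite s2; lra.
have h2 : 7 / 5 <= s.
  rewrite leNgt; apply/negP => h.
  have : s * s <= 7 / 5 * (7 / 5) by rewrite ler_pM// ltW.
  by rewrite s2; lra.
by split => //; lra.
Qed.

Unset Implicit Arguments.
Theorem theorem1p1 (R : realType) :
  [/\ (forall K : set (R * R), convex_body2 K ->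
         2 / 41 * (10 + 3 * Num.sqrt 2) <= Sym1 K),
      (exists Q : nat -> set (R * R),
         (forall j, convex_quadrilateral (Q j)) /\
         (fun j => Sym1 (Q j)) @ \oo --> (Num.sqrt 2 + 1) / 3)
    & 2 / 41 * (10 + 3 * Num.sqrt 2) <= sigma21 R <= (Num.sqrt 2 + 1) / 3].
Proof.
have low (K : set (R * R)) : convex_body2 K -> 2 / 41 * (10 + 3 * Num.sqrt 2) <= Sym1 K.
  by move=> cK; apply: le_trans (lower_const R) _; exact: Sym1_lower.
have bodies : [set Sym1 K | K in @convex_body2 R] !=set0.
  have par := @thin_params R (1 / 100) ltac:(by lra) (lexx _).
  by exists (Sym1 (thin (Num.sqrt 2 + 1) (1 / 100))), (thin (Num.sqrt 2 + 1) (1 / 100)) => //; exact: thin_body.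
have lowb : lbound [set Sym1 K | K in @convex_body2 R] (2 / 41 * (10 + 3 * Num.sqrt 2)).
  by move=> _ [K cK <-]; exact: low.
split => //.
(* The thickness 1/(100 (j + 1)) stays in the range required by [thin_params]. *)
- pose e (j : nat) : R := 1 / 100 * harmonic j.
  have e0 j : 0 < e j by rewrite mulr_gt0// harmonic_gt0.
  have e1 j : e j <= 1 / 100 by rewrite ler_piMr// /harmonic /= invf_le1// ler1n.
  exists (fun j => thin (Num.sqrt 2 + 1) (e j)); split.
    by move=> j; apply: thin_quadrilateral; exact: thin_params.
  apply: (@squeeze_cvgr _ _ _ _ (fun _ : nat => (Num.sqrt 2 + 1) / 3 : R) (fun j => (Num.sqrt 2 + 1) / 3 * (1 + e j))).
  - apply: nearW => j; have [h1 h2] := Sym1_thin (thin_params (e0 j) (e1 j)).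
    by rewrite h1.
  - exact: cvg_cst.
  - rewrite -[X in _ --> X]mulr1; apply: cvgM; first exact: cvg_cst.
    rewrite -[X in _ --> X]addr0; apply: cvgD; first exact: cvg_cst.
    rewrite -[X in _ --> X](mulr0 (1 / 100)); apply: cvgM; first exact: cvg_cst.
    exact: cvg_harmonic.
- apply/andP; split; first exact: lb_le_inf.
  apply/ler_addgt0Pr => d d0.
  have [e [e0 e1 ed]] : exists e : R, [/\ 0 < e, e <= 1 / 100 & e <= d].
    by exists (Num.min (1 / 100) d); rewrite lt_min d0 !ge_min !lexx orbT; split => //; lra.
  have par := thin_params e0 e1; have [_ hs] := Sym1_thin par.
  apply: le_trans (_ : Sym1 (thin (Num.sqrt 2 + 1) e) <= _).
    apply: ge_inf; first by exists (2 / 41 * (10 + 3 * Num.sqrt 2)).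
    by exists (thin (Num.sqrt 2 + 1) e) => //; exact: thin_body.
  (* The excess (m/3) e is at most e, as m <= 3. *)
  apply: le_trans hs _; rewrite mulrDr mulr1 lerD2l.
  case: par => _ _ m2 _ _; apply: le_trans ed.
  by rewrite ler_piMl ?(ltW e0)//; lra.
Qed.
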